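(* Let $\lambda,\mu>0$, $k\ge1$ an integer and $\nu\in(0,1)$. The interarrival times of a $\nu$-fractional $M/E_k/1$ queue (with arrival rate $\lambda$, $k$ phases and phase rate $k\mu$) are i.i.d. Mittag-Leffler random variables with fractional index $\nu$ and parameter $\lambda$.
   Context: Classical queue: let $\mathcal{S}^*=\{(n,s): n\ge 1,\ 1\le s\le k\}$ ($n,s$ integers) and $\mathcal{S}=\mathcal{S}^*\cup\{(0,0)\}$. The state-phase process $Q(t)=(N(t),S(t))$ of the classical $M/E_k/1$ queue ($N$ = number of customers in the system, $S$ = phase of the customer currently being served, $S=0$ if $N=0$) is the continuous-time Markov chain on $\mathcal{S}$ with transition rates: $(0,0)\to(1,k)$ at rate $\lambda$; $(n,s)\to(n+1,s)$ at rate $\lambda$ for $(n,s)\in\mathcal{S}^*$ (arrivals); $(n,s)\to(n,s-1)$ at rate $k\mu$ for $s\ge2$; $(n,1)\to(n-1,k)$ at rate $k\mu$ for $n\ge2$; $(1,1)\to(0,0)$ at rate $k\mu$ (phase completions). Fractional queue: let $\{\sigma_\nu(t)\}_{t\ge0}$ be a $\nu$-stable subordinator independent of $Q$, with $\mathbb{E}[e^{-v\sigma_\nu(t)}]=e^{-tv^\nu}$ for $v>0$, and let $L_\nu(t)=\inf\{s\ge0:\sigma_\nu(s)>t\}$. The $\nu$-fractional $M/E_k/1$ queue has state-phase process $Q^\nu(t)=(N^\nu(t),S^\nu(t)):=Q(L_\nu(t))$. The interarrival times are the lengths of the time intervals between consecutive arrivals of customers, i.e. between consecutive upward jumps of $N^\nu$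 (the first one being measured from time $0$). A Mittag-Leffler random variable $T$ with fractional index $\nu$ and parameter $\lambda>0$, denoted $T\sim ML_\nu(\lambda)$, has distribution function $F_T(t)=1-E_\nu(-\lambda t^\nu)$, $t\ge0$, where $E_\nu(z)=\sum_{j=0}^{+\infty}\frac{z^j}{\Gamma(\nu j+1)}$. *)

(* Defs.v *)
From HB Require Import structures.
From mathcomp Require Import all_boot all_order all_algebra.
From mathcomp Require Import all_classical all_reals all_analysis.
Set Implicit Arguments.
Unset Strict Implicit.
Unset Printing Implicit Defensive.
Import Order.TTheory GRing.Theory Num.Theory.
Import numFieldNormedType.Exports.
Local Open Scope classical_set_scope.
Local Open Scope ring_scope.

(* Throughout, a process is indexed by R, but only times t >= 0 matter. *)

(* Only the values [rate x y] with [x != y] are used. *)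
Definition exit_rate (R : realType) (S : countType) (rate : S -> S -> R)
    (x : S) : R :=
  fine (\esum_(y in [set~ x]) (rate x y)%:E).

(* [p t x y] is the probability of going from x to y in time t. *)
Record transition_function (R : realType) (S : countType)
    (rate : S -> S -> R) (p : R -> S -> S -> R) : Prop := {
  transition_ge0 : forall t x y, 0 <= t -> 0 <= p t x y ;
  transition_sum1 : forall t x, 0 <= t ->
    (\esum_(y in [set: S]) (p t x y)%:E = 1%:E)%E ;
  transition_start : forall x y, p 0 x y = (x == y)%:R ;
  transition_Chapman_Kolmogorov : forall s t x y, 0 <= s -> 0 <= t ->
    (\esum_(z in [set: S]) (p s x z * p t z y)%:E = (p (s + t) x y)%:E)%E ;
  transition_rate : forall x y, x != y ->
    p h x y / h @[h --> 0^'+] --> rate x y ;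
  transition_exit_rate : forall x,
    (1 - p h x x) / h @[h --> 0^'+] --> exit_rate rate x }.

Definition cadlag_discrete (R : realType) (S : Type) (f : R -> S) : Prop :=
  (forall t, 0 <= t -> \forall s \near t^'+, f s = f t) /\
  (forall t, 0 < t -> exists x, \forall s \near t^'-, f s = x).

(* The Markov property is written with products instead of conditional
   probabilities.  The initial distribution is arbitrary. *)
Definition markov_chain (R : realType) (d : measure_display)
    (Omega : measurableType d) (P : probability Omega R) (S : countType)
    (rate : S -> S -> R) (X : R -> Omega -> S) : Prop :=
  [/\ forall t x, 0 <= t -> measurable (X t @^-1` [set x]),
      {ae P, forall w, cadlag_discrete (X ^~ w)}
    & exists2 p, transition_function rate p &
      forall (n : nat) (t : nat -> R) (x : nat -> S),
        0 <= t 0%N -> (forall i, (i <= n)%N -> t i < t i.+1) ->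
        (P (\bigcap_(i in `I_n.+2) (X (t i) @^-1` [set x i])) =
         P (\bigcap_(i in `I_n.+1) (X (t i) @^-1` [set x i])) *
         (p (t n.+1 - t n) (x n) (x n.+1))%:E)%E].

Definition queue_state_pred (k : nat) (x : nat * nat) : bool :=
  (x == (0, 0)%N) || ((1 <= x.1)%N && (1 <= x.2 <= k)%N).

Definition queue_state (k : nat) := {x : nat * nat | queue_state_pred k x}.

(* In each state the arrival and the phase completion have different targets,
   so the two terms are never nonzero together. *)
Definition queue_rate (R : realType) (lambda mu : R) (k : nat)
    (x y : queue_state k) : R :=
  match val x with
  | (0, _)%N => lambda * (val y == (1, k)%N)%:R
  | (n'.+1 as n, s)%N =>
      lambda * (val y == (n.+1, s))%:R +
      (k%:R * mu) *
      (val y == if (2 <= s)%N then (n, s.-1)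
                else if (2 <= n)%N then (n', k) else (0, 0)%N)%:R
  end.

(* Mutual independence: product rule on every finite subfamily. *)
Definition mutually_independent (R : realType) (d : measure_display)
    (Omega : measurableType d) (P : probability Omega R) (I : eqType)
    (X : I -> Omega -> R) : Prop :=
  forall (s : seq I) (B : I -> set R), uniq s ->
    (forall i, measurable (B i)) ->
    (P (\big[setI/setT]_(i <- s) (X i @^-1` B i)) =
     \prod_(i <- s) P (X i @^-1` B i))%E.

(* The sigma-algebra generated by X(t), t >= 0, where the state space T
   carries the sigma-algebra [mT]. *)
Definition process_sigma_algebra (R : realType) (Omega T : Type)
    (mT : set (set T)) (X : R -> Omega -> T) : set (set Omega) :=
  <<s [set A | exists t B, [/\ 0 <= t, mT B & A = X t @^-1` B]] >>.

(* X takes values in a discrete space, Y in R. *)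
Definition independent_processes (R : realType) (d : measure_display)
    (Omega : measurableType d) (P : probability Omega R) (S : Type)
    (X : R -> Omega -> S) (Y : R -> Omega -> R) : Prop :=
  forall A B, process_sigma_algebra [set: set S] X A ->
    process_sigma_algebra measurable Y B ->
    (P (A `&` B) = P A * P B)%E.

(* Left limits are automatic for nondecreasing paths. *)
Record stable_subordinator (R : realType) (d : measure_display)
    (Omega : measurableType d) (P : probability Omega R) (nu : R)
    (sigma : R -> {RV P >-> R}) : Prop := {
  subordinator_start : {ae P, forall w, sigma 0 w = 0} ;
  subordinator_paths : {ae P, forall w,
    (forall s t, 0 <= s -> s <= t -> sigma s w <= sigma t w) /\
    (forall t, 0 <= t -> sigma s w @[s --> t^'+] --> sigma t w)} ;
  subordinator_independent_increments : forall (n : nat) (t : nat -> R),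
    0 <= t 0%N -> (forall i, (i < n)%N -> t i <= t i.+1) ->
    mutually_independent P
      (fun (i : 'I_n) w => sigma (t i.+1) w - sigma (t i) w) ;
  subordinator_stationary_increments : forall (s t : R) (B : set R),
    0 <= s -> s <= t -> measurable B ->
    P ((fun w => sigma t w - sigma s w) @^-1` B) =
    P (sigma (t - s) @^-1` B) ;
  subordinator_Laplace : forall t v, 0 <= t -> 0 < v ->
    ('E_P[fun w => expR (- v * sigma t w)%R] = (expR (- t * v `^ nu)%R)%:E)%E }.

Definition inverse_subordinator (R : realType) (Omega : Type)
    (sigma : R -> Omega -> R) (t : R) (w : Omega) : R :=
  inf [set s | 0 <= s /\ t < sigma s w].

Definition time_changed (R : realType) (Omega S : Type)
    (Q : R -> Omega -> S) (L : R -> Omega -> R) (t : R) (w : Omega) : S :=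
  Q (L t w) w.

Definition fractional_queue (R : realType) (Omega : Type) (k : nat)
    (Q : R -> Omega -> queue_state k) (sigma : R -> Omega -> R) :
    R -> Omega -> queue_state k :=
  time_changed Q (inverse_subordinator sigma).

Definition number_in_system (k : nat) (x : queue_state k) : nat := (val x).1.

Definition upward_jump (R : realType) (f : R -> nat) (t : R) : Prop :=
  0 < t /\ exists2 m, (\forall s \near t^'-, f s = m) & (m < f t)%N.

(* [T n] is the length of the time interval between the n-th and the (n+1)-st
   upward jump of f (time 0 counting as the 0-th): the upward jumps occur
   exactly at T 0 < T 0 + T 1 < T 0 + T 1 + T 2 < etc.  This determines T. *)
Definition interarrival_times (R : realType) (f : R -> nat) (T : nat -> R) :
    Prop :=
  (forall n, 0 < T n) /\
  (forall t, upward_jump f t <-> exists n, t = \sum_(i < n.+1) T i).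

Definition Gamma (R : realType) (x : R) : R :=
  \int[lebesgue_measure]_(t in `]0, +oo[) (t `^ (x - 1) * expR (- t)).

Definition mittag_leffler (R : realType) (nu z : R) : R :=
  lim (series (fun j : nat => z ^+ j / Gamma (nu * j%:R + 1)) @ \oo).

Definition mittag_leffler_distributed (R : realType) (d : measure_display)
    (Omega : measurableType d) (P : probability Omega R) (nu lambda : R)
    (T : {RV P >-> R}) : Prop :=
  forall t, 0 <= t -> cdf T t = (1 - mittag_leffler nu (- lambda * t `^ nu))%:E.

(* Main.v *)
(* Let tau_0 < tau_1 < ... be the arrival times of the classical queue, sigma
   the subordinator and L its inverse.  Since L(t) >= tau iff
   sigma(tau-) <= t, the upward jumps of N(L(t)) are exactly the times
   sigma(tau_n-), and the interarrival times are the increments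
   T_n = sigma(tau_n-) - sigma(tau_{n-1}-).

   Sample the queue on a grid of step h and record in which cells the number of
   customers goes up.  Given the past a cell is up with probability
   lambda h + O(h^2) uniformly in the state.  By independence, conditionally on
   the up/down pattern of the grid, the subordinator contributes
   exp(-h v_c^nu) per cell, where c is the number of arrivals so far.  With
   psi(c) = prod_{c <= i < n} lambda / (lambda + v_i^nu) the discounted product
   times psi(c) is a martingale up to O(h^2) per cell, so h -> 0 gives
   E prod_i exp(-v_i T_i) = prod_i lambda / (lambda + v_i^nu).

   Laplace transforms determine distributions because (1 - e^{-Nx})^{N e^{Nc}}
   tends to the indicator of x > c.  This yields the independence of the T_n,
   and the comparison with the Laplace transform of E_nu(-lambda t^nu),
   computed term by term, yields their common distribution function. *)
Require Import Defs.
From HB Require Import structures.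
From mathcomp Require Import all_boot all_order all_algebra.
From mathcomp Require Import all_classical all_reals all_analysis.
From mathcomp Require Import measurable_realfun zify ring lra.
Set Implicit Arguments.
Unset Strict Implicit.
Unset Printing Implicit Defensive.
Import Order.TTheory GRing.Theory Num.Theory.
Import numFieldNormedType.Exports.
Local Open Scope classical_set_scope.
Local Open Scope ring_scope.

(** * Uniqueness of Laplace transforms *)

(** The Markov property is available only as a product rule at finitely many deterministic times, so
    the arrival times are never treated as stopping times: probability acts on grid patterns alone,
    and the passage from patterns to interarrival times is a statement about a single path. This
    works because the upward rate is lambda in every state, empty or not; the up/down pattern is
    then nearly an i.i.d. sequence, although the number of customers need not be Markov by itself.

    An increment of sigma over a cell is charged to the number of arrivals counted up to the end of
    that cell. The cell containing tau_n thus goes to T_{n+1}, and the cells charged to T_0, ...,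
    T_n telescope to sigma at the left end of that cell: this is where the left limit comes from.

    Integrating the series of E_nu(-lambda t^nu) term by term converges absolutely only for v^nu >
    lambda. This suffices, since uniqueness needs integer steps only: a factor exp(-v_1 t) with one
    large v_1 leaves just the exponents v_1 + n. *)

Lemma Bernoulli_ineq (R : realDomainType) (x : R) (n : nat) :
  0 <= x <= 1 -> 1 - n%:R * x <= (1 - x) ^+ n.
Proof.
move=> /andP[x0 x1]; elim: n => [|n ih]; first by rewrite mul0r subr0 expr0.
rewrite exprS; apply: (@le_trans _ _ ((1 - x) * (1 - n%:R * x))); last first.
  by rewrite ler_wpM2l// subr_ge0.
have : 0 <= n%:R * x * x by rewrite !mulr_ge0.
by rewrite -natr1; nra.
Qed.

(** The prefactor [n.+1] decides the boundary x = c: there the exponent times e^{-Nx} is about N, so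
    the power tends to 0 and the limit is the indicator of the strict inequality. *)
Definition step_exponent (R : realType) (c : R) (n : nat) : nat :=
  Num.truncn (n.+1%:R * expR (n.+1%:R * c)).

(* These polynomials in [expR (- x)] approximate the indicator of [c < x]:
   the base is 1 - e^{-Nx} and the exponent about N e^{Nc}. *)
Definition step_approx (R : realType) (c : R) (n : nat) (x : R) : R :=
  (1 - expR (- (n.+1%:R * x))) ^+ step_exponent c n.

Lemma step_approx_itv (R : realType) (c x : R) (n : nat) :
  0 <= x -> 0 <= step_approx c n x <= 1.
Proof.
move=> x0; have e1 : expR (- (n.+1%:R * x)) <= 1.
  by rewrite expR_le1 oppr_le0 mulr_ge0.
by rewrite exprn_ge0 ?subr_ge0//= exprn_ile1 ?subr_ge0// lerBlDr lerDl expR_ge0.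
Qed.

Lemma cvg_step_approx (R : realType) (c x : R) : 0 <= x ->
  step_approx c n x @[n --> \oo] --> ((c < x)%R%:R : R).
Proof.
move=> x0; have e1 n : expR (- (n.+1%:R * x)) <= 1 :> R.
  by rewrite expR_le1 oppr_le0 mulr_ge0.
have tr n := truncn_itv (mulr_ge0 (ler0n R n.+1) (expR_ge0 (n.+1%:R * c))).
case: ltP => cx; last first.
  (* Case x <= c, with N = n + 1 and exponent m: since 1 - y <= e^{-y}, the power is at most exp(- m
     e^{-Nx}), and m > N e^{Nc} - 1 gives m e^{-Nx} >= N - 1 = n. *)
  apply: (@squeeze_cvgr _ _ _ _ (cst 0) (fun n => expR (- n%:R))).
  - apply: nearW => n; case/andP: (step_approx_itv c n x0) => -> _ /=.
    have [_ tn] := andP (tr n).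
    have le1 : 1 - expR (- (n.+1%:R * x)) <= expR (- expR (- (n.+1%:R * x))).
      exact: expR_ge1Dx.
    apply: (@le_trans _ _ (expR (- expR (- (n.+1%:R * x))) ^+ step_exponent c n)).
      by rewrite lerXn2r ?nnegrE ?expR_ge0 ?subr_ge0.
    rewrite -expRM_natl ler_expR mulrN lerN2.
    have : (n.+1%:R * expR (n.+1%:R * c) - 1) * expR (- (n.+1%:R * x)) <=
        (step_exponent c n)%:R * expR (- (n.+1%:R * x)).
      rewrite ler_wpM2r ?expR_ge0// lerBlDr natr1; exact: ltW.
    apply: le_trans; rewrite mulrBl mul1r -mulrA -expRD.
    have : 1 <= expR (n.+1%:R * c + - (n.+1%:R * x)).
      by rewrite -mulrBr -expR0 ler_expR mulr_ge0// subr_ge0.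
    move=> /(ler_wpM2l (ler0n R n.+1)); rewrite mulr1 => H.
    by move: (e1 n) H; rewrite -natr1; lra.
  - exact: cvg_cst.
  - exact: cvgn_expR.
have d0 : 0 < x - c by rewrite subr_gt0.
(* Case c < x: Bernoulli bounds the power below by 1 - N e^{-N(x-c)}, and e^y >= y^2 / 2 turns the
   defect into 2 / ((x-c)^2 N). *)
apply: (@squeeze_cvgr _ _ _ _
  (fun n => 1 - 2 / (x - c) ^+ 2 * harmonic n) (cst 1)).
- apply: nearW => n; case/andP: (step_approx_itv c n x0) => _ -> /=.
  rewrite andbT; apply: le_trans (Bernoulli_ineq _ _); last first.
    by rewrite expR_ge0 e1.
  rewrite lerD2l lerN2.
  have [tn _] := andP (tr n).
  apply: (@le_trans _ _ (n.+1%:R * expR (n.+1%:R * c) * expR (- (n.+1%:R * x)))).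
    by rewrite ler_wpM2r ?expR_ge0.
  rewrite -mulrA -expRD -mulrBr -opprB mulrN expRN ler_pdivrMr ?expR_gt0//.
  have := @expR_ge1Dxn R (n.+1%:R * (x - c)) 1 (mulr_ge0 (ler0n _ _) (ltW d0)).
  move=> /(le_trans _); set E := expR _ => H.
  have {}H : (n.+1%:R * (x - c)) ^+ 2 / 2 <= E by apply: H; rewrite lerDr.
  apply: le_trans (ler_wpM2l _ H); last first.
    by rewrite mulr_ge0 ?divr_ge0 ?sqr_ge0// /harmonic/= invr_ge0.
  rewrite le_eqVlt; apply/orP; left; apply/eqP; rewrite /harmonic/=.
  by field; rewrite (lt0r_neq0 d0) andbT addrC natr1 pnatr_eq0.
- rewrite (_ : true%:R = 1 - 2 / (x - c) ^+ 2 * 0); last by rewrite mulr0 subr0.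
  apply: cvgB; first exact: cvg_cst.
  by apply: cvgMr; exact: cvg_harmonic.
- exact: cvg_cst.
Qed.

Lemma integrable_mul_le1 d (T : measurableType d) (R : realType)
    (mu : {measure set T -> \bar R}) (D : set T) (Z g : T -> R) :
  measurable D -> mu.-integrable D (EFin \o Z) -> measurable_fun D g ->
  (forall x, D x -> `|g x| <= 1) ->
  mu.-integrable D (EFin \o (fun x => Z x * g x)).
Proof.
move=> mD iZ mg g1; have mZ := measurable_int _ iZ.
apply: (le_integrable mD) iZ.
  by apply/measurable_EFinP; apply: measurable_funM => //; exact/measurable_EFinP.
move=> x Dx /=; rewrite lee_fin normrM.
by apply: ler_piMr => //; exact: g1.
Qed.

(** [Z] may be signed. By linearity it is orthogonal to every polynomial in e^{-X}, in particular to
    [step_approx c n] of [X]; dominated convergence with bound |Z| reaches the indicator. *)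
Lemma Rintegral_tail_eq0 d (T : measurableType d) (R : realType)
    (mu : {measure set T -> \bar R}) (D : set T) (Z X : T -> R) :
  measurable D -> mu.-integrable D (EFin \o Z) -> measurable_fun D X ->
  (forall x, D x -> 0 <= X x) ->
  (forall n : nat, \int[mu]_(x in D) (Z x * expR (- (n%:R * X x))) = 0) ->
  forall c, \int[mu]_(x in D) (Z x * (c < X x)%R%:R) = 0.
Proof.
move=> mD iZ mX X0 Z0 c.
have mE k : measurable_fun D (fun x => expR (- (k%:R * X x))).
  by apply: measurableT_comp => //; apply: measurableT_comp => //;
    exact: measurable_funM.
have E1 (k : nat) x : D x -> expR (- (k%:R * X x)) <= 1.
  by move=> Dx; rewrite expR_le1 oppr_le0 mulr_ge0// X0.
have mP n m : measurable_fun D (fun x => (1 - expR (- (n%:R * X x))) ^+ m).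
  by apply: measurable_funX; apply: measurable_funB.
have P1 n m x : D x -> `|(1 - expR (- (n%:R * X x))) ^+ m| <= 1.
  move=> Dx; rewrite normrX exprn_ile1// ger0_norm ?subr_ge0; last exact: E1.
  by rewrite lerBlDr lerDl expR_ge0.
(* The extra factor e^{-kX} makes the induction on [m] close: one more factor 1 - e^{-nX} splits the
   integral into the cases [k] and [k + n] for the smaller power. *)
have key n m k :
  \int[mu]_(x in D) (Z x * (expR (- (k%:R * X x)) *
    (1 - expR (- (n%:R * X x))) ^+ m)) = 0.
  elim: m k => [|m ih] k.
    by rewrite -[RHS](Z0 k); apply: eq_Rintegral => x _; rewrite expr0 mulr1.
  rewrite -[RHS]subr0 -{1}(ih k) -(ih (k + n)%N) -RintegralB//; last 2 first.
  - apply: integrable_mul_le1 => //; first exact: measurable_funM.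
    move=> x Dx; rewrite normrM mulr_ile1// ?P1//.
    by rewrite ger0_norm ?expR_ge0// E1.
  - apply: integrable_mul_le1 => //; first exact: measurable_funM.
    move=> x Dx; rewrite normrM mulr_ile1// ?P1//.
    by rewrite ger0_norm ?expR_ge0// E1.
  apply: eq_Rintegral => x _; rewrite natrD mulrDl opprD expRD exprS.
  by ring.
have mstep n : measurable_fun D (step_approx c n \o X).
  exact: mP.
have iZE n : (\int[mu]_(x in D) (Z x * step_approx c n (X x))%:E = 0)%E.
  have iz : mu.-integrable D (EFin \o (fun x => Z x * step_approx c n (X x))).
    apply: integrable_mul_le1 => //; first exact: mstep.
    by move=> x Dx; have /andP[? ?] := step_approx_itv c n (X0 _ Dx); rewrite ger0_norm.
  rewrite -[LHS]fineK; last exact: integrable_fin_num.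
  congr EFin; rewrite -[RHS](key n.+1 (step_exponent c n) 0%N).
  rewrite /Rintegral; congr fine; apply: eq_integral => x _.
  by rewrite mul0r oppr0 expR0 mul1r.
have [] := @dominated_convergence _ _ _ mu D mD
  (fun n x => (Z x * step_approx c n (X x))%:E)
  (fun x => (Z x * (c < X x)%R%:R)%:E) (fun x => `|(Z x)%:E|%E).
- move=> n; apply/measurable_EFinP.
  apply: (@measurable_funM _ _ _ _ Z (step_approx c n \o X)); last exact: mstep.
  exact/measurable_EFinP/(measurable_int _ iZ).
- apply/measurable_EFinP.
  apply: (@measurable_funM _ _ _ _ Z (fun x => (c < X x)%R%:R)).
    exact/measurable_EFinP/(measurable_int _ iZ).
  rewrite (_ : (fun _ => _) = (fun x => if c < X x then 1 else 0)); last first.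
    by apply/funext => x; case: ltP.
  by apply: measurable_fun_if => //; exact: measurable_fun_ltr.
- apply: aeW => x Dx; apply: cvg_EFin; first exact: nearW.
  by apply: cvgM; [exact: cvg_cst | exact: cvg_step_approx (X0 _ Dx)].
- exact: integrable_abse.
- apply: aeW => x n Dx; rewrite /= lee_fin normrM; apply: ler_piMr => //.
  by have /andP[? ?] := step_approx_itv c n (X0 _ Dx); rewrite ger0_norm.
move=> _ _; under eq_fun do rewrite iZE.
move=> H; rewrite /Rintegral -(cvg_lim _ H)// lim_cst//.
Qed.

Lemma integrable_norm_le1 d (T : measurableType d) (R : realType)
    (P : probability T R) (f : T -> R) :
  measurable_fun setT f -> (forall x, `|f x| <= 1) ->
  P.-integrable setT (EFin \o f).
Proof.
move=> mf f1; apply: (@le_integrable _ _ _ _ _ _ _ (EFin \o cst 1)) => //.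
- exact/measurable_EFinP.
- by move=> x _ /=; rewrite lee_fin normr1.
- exact: finite_measure_integrable_cst.
Qed.

(** * Mittag-Leffler functions and distributions *)

Section GammaIntegrals.
Variable R : realType.
Implicit Types x v t A : R.
Notation mu := (@lebesgue_measure R).

Lemma measurable_powR_expR x v (D : set R) :
  measurable_fun D (fun t => t `^ x * expR (- (v * t))).
Proof.
apply: measurable_funTS; apply: measurable_funM; first exact: measurable_powR.
by apply: measurableT_comp => //; apply: measurableT_comp => //;
  exact: measurable_funM.
Qed.


Lemma measurable_mul_expR c v (D : set R) :
  measurable_fun D (fun t => c * expR (- (v * t))).
Proof.
apply: measurable_funTS; apply: measurable_funM => //.
by apply: measurableT_comp => //; apply: measurableT_comp => //;
  exact: measurable_funM.
Qed.

Lemma measurable_expR_mul v (D : set R) :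
  measurable_fun D (fun t => expR (- (v * t))).
Proof.
by apply: measurable_funTS; apply: measurableT_comp => //;
  apply: measurableT_comp => //; exact: measurable_funM.
Qed.

Lemma integral_exponential_itv v : 0 < v ->
  (\int[mu]_(t in `]0%R, +oo[) (v * expR (- (v * t)))%:E = 1)%E.
Proof.
move=> v0; have <- := integral_exponential_pdf v0.
rewrite integral_itv_obnd_cbnd; last first.
  by apply/measurable_EFinP; exact: measurable_mul_expR.
rewrite integral_mkcond; apply: eq_integral => t _.
rewrite /exponential_pdf !patchE; case: ifPn => //.
by rewrite mulNr.
Qed.

(** With y = 2 (x + 1), raise t <= y e^{t/y} to the power x: the exponent becomes t x / y <= t / 2.
    Half of the decay of e^{-t} is left for integrability. *)
Lemma powR_le_expR x t : 0 <= x -> 0 <= t ->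
  t `^ x <= (2 * (x + 1)) `^ x * expR (2^-1 * t).
Proof.
move=> x0 t0; set y := 2 * (x + 1); have y0 : 0 < y by rewrite mulr_gt0 ?ltr_pwDr.
have ty : t <= y * expR (t / y).
  rewrite mulrC -ler_pdivrMr//; apply: le_trans (expR_ge1Dx _).
  by rewrite lerDr.
apply: (@le_trans _ _ ((y * expR (t / y)) `^ x)).
  by apply: ge0_ler_powR => //; rewrite nnegrE// mulr_ge0 ?expR_ge0// ltW.
rewrite powRM ?expR_ge0 ?(ltW y0)// ler_wpM2l ?powR_ge0// -expRM ler_expR.
rewrite mulrAC ler_pdivrMr//; suff -> : 2^-1 * t * y = t * x + t by rewrite lerDl.
by rewrite /y; field.
Qed.

Lemma integral_powR_expR_lty x : 0 <= x ->
  (\int[mu]_(t in `]0%R, +oo[) (t `^ x * expR (- (1 * t)))%:E < +oo)%E.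
Proof.
move=> x0.
apply: (@le_lt_trans _ _ (\int[mu]_(t in `]0%R, +oo[)
    (((2 * (x + 1)) `^ x * 2)%:E * (2^-1 * expR (- (2^-1 * t)))%:E))%E).
  apply: ge0_le_integral => //.
  - by move=> t _; rewrite lee_fin mulr_ge0 ?powR_ge0 ?expR_ge0.
  - by apply/measurable_EFinP; exact: measurable_powR_expR.
  - by apply: measurable_funeM; apply/measurable_EFinP; exact: measurable_mul_expR.
  - move=> t; rewrite /= in_itv/= andbT => t0; rewrite -EFinM lee_fin.
    rewrite mulrA mulfK// (_ : - (1 * t) = - (2^-1 * t) - 2^-1 * t); last by field.
    rewrite expRD mulrA ler_wpM2r ?expR_ge0//.
    rewrite expRN ler_pdivrMr ?expR_gt0//.
    by apply: powR_le_expR => //; exact: ltW.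
rewrite ge0_integralZl//.
- by rewrite integral_exponential_itv// mule1 ltry.
- by apply/measurable_EFinP; exact: measurable_mul_expR.
by rewrite lee_fin mulr_ge0 ?powR_ge0.
Qed.

Lemma GammaE x : 0 <= x ->
  ((Gamma (x + 1))%:E = \int[mu]_(t in `]0%R, +oo[) (t `^ x * expR (- (1 * t)))%:E)%E.
Proof.
move=> x0; rewrite /Gamma /Rintegral addrK.
under eq_integral do rewrite -[X in expR (- X)]mul1r.
rewrite fineK// ge0_fin_numE ?integral_powR_expR_lty//.
by apply: integral_ge0 => t _; rewrite lee_fin mulr_ge0 ?powR_ge0 ?expR_ge0.
Qed.

(** Keep only the unit interval from A to A + 1 of the integral. As A is free, Gamma beats any
    prescribed geometric growth, which does the work of Stirling's formula. *)
Lemma Gamma_lower_bound x A : 0 <= x -> 0 < A ->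
  A `^ x * expR (- (A + 1)) <= Gamma (x + 1).
Proof.
move=> x0 A0; rewrite -lee_fin GammaE//.
apply: (@le_trans _ _ (\int[mu]_(t in `]A, (A + 1)%R]) (t `^ x * expR (- (1 * t)))%:E)%E).
  apply: (@le_trans _ _ (\int[mu]_(t in `]A, (A + 1)%R]) (A `^ x * expR (- (A + 1)))%:E)%E).
    rewrite integral_cst//= lebesgue_measure_itv/= lte_fin ltrDl ltr01.
    by rewrite -EFinB addrAC subrr add0r mule1.
  apply: ge0_le_integral => //.
  - by move=> t _; rewrite lee_fin mulr_ge0 ?powR_ge0 ?expR_ge0.
  - by apply/measurable_EFinP; exact: measurable_powR_expR.
  - move=> t; rewrite /= in_itv/= => /andP[At tA]; rewrite lee_fin.
    rewrite ler_pM ?powR_ge0 ?expR_ge0//.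
      by apply: ge0_ler_powR; rewrite ?nnegrE// ltW// (lt_trans A0).
    by rewrite ler_expR lerN2 mul1r.
apply: ge0_subset_integral => //.
- by apply/measurable_EFinP; exact: measurable_powR_expR.
- by move=> t _; rewrite lee_fin mulr_ge0 ?powR_ge0 ?expR_ge0.
- by move=> t; rewrite /= !in_itv/= andbT => /andP[/(lt_trans A0)].
Qed.

Lemma Gamma_gt0 x : 0 <= x -> 0 < Gamma (x + 1).
Proof.
move=> x0; apply: lt_le_trans (@Gamma_lower_bound x 1 x0 ltr01).
by rewrite mulr_gt0 ?expR_gt0 ?powR_gt0.
Qed.

Lemma continuous_within_powR_expR x : 0 <= x ->
  {within `[0, +oo[, continuous (fun t => t `^ x * expR (- (1 * t)))}.
Proof.
move=> x0; apply/continuous_within_itvcyP; split.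
  move=> t; rewrite in_itv/= andbT => t0.
  apply: cvgM.
    have : {for t, continuous (@powR R ^~ x)}; last by [].
    apply: differentiable_continuous; apply/derivable1_diffP.
    by apply: derivable_powR; rewrite in_itv/= t0.
  apply: continuous_comp; last exact: continuous_expR.
  by apply: continuousN; apply: continuousM => //; exact: cst_continuous.
apply: cvgM.
  (* For x = 0 the power is 1 even at t = 0; for x > 0 it vanishes there. The two values at the
     endpoint need separate arguments. *)
  have [->|x1] := eqVneq x 0.
    by rewrite powRr0; under eq_fun do rewrite powRr0; exact: cvg_cst.
  by rewrite powR0//; apply: powR_cvg0; rewrite lt0r x1.
apply: cvg_at_right_filter.
apply: (@continuous_comp _ _ _ (fun t => - (1 * t)) (@expR R)); last exact: continuous_expR.
by apply: continuousN; apply: continuousM => //; exact: cst_continuous.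
Qed.

Lemma integral_powR_expR x v : 0 <= x -> 0 < v ->
  (\int[mu]_(t in `]0%R, +oo[) (t `^ x * expR (- (v * t)))%:E =
   (Gamma (x + 1) / (v `^ x * v))%:E)%E.
Proof.
move=> x0 v0.
have dF : derive1 (fun t : R => v * t) = cst v.
  by apply/funext => t; rewrite derive1E deriveM// derive_cst scaler0 addr0
    derive_id; exact: mulr1.
have := @increasing_ge0_integration_by_substitutiony R (fun t => v * t)
  (fun t => t `^ x * expR (- (1 * t))) 0.
rewrite mulr0 dF => /(_ _ _ _ _ _ _ _ _) H.
have {H} : (\int[mu]_(t in `[0%R, +oo[) (t `^ x * expR (- (1 * t)))%:E =
    \int[mu]_(t in `[0%R, +oo[) ((v `^ x * v)%:E * (t `^ x * expR (- (v * t)))%:E))%E.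
  rewrite H.
  - apply: eq_integral => t; rewrite inE/= in_itv/= andbT => t0.
    rewrite -EFinM; congr EFin.
    transitivity ((v * t) `^ x * expR (- (1 * (v * t))) * v) => //.
    rewrite mul1r powRM ?(ltW v0)//.
    by ring.
  - by move=> s t _ _; rewrite ltr_pM2l.
  - by move=> t _; exact: cst_continuous.
  - exact: is_cvg_cst.
  - exact: is_cvg_cst.
  - split; first by move=> t _; exact: derivableM.
    apply: cvg_at_right_filter.
    by apply: continuousM => //; exact: cst_continuous.
  - exact: gt0_cvgMry.
  - exact: continuous_within_powR_expR.
  - by move=> t _; rewrite mulr_ge0 ?powR_ge0 ?expR_ge0.
rewrite -!integral_itv_obnd_cbnd; last 2 first.
- by apply: measurable_funeM; apply/measurable_EFinP; exact: measurable_powR_expR.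
- by apply/measurable_EFinP; exact: measurable_powR_expR.
rewrite -GammaE// ge0_integralZl//; last 3 first.
- by apply/measurable_EFinP; exact: measurable_powR_expR.
- by move=> t _; rewrite lee_fin mulr_ge0 ?powR_ge0 ?expR_ge0.
- by rewrite lee_fin mulr_ge0 ?powR_ge0 ?ltW.
have c0 : 0 < v `^ x * v by rewrite mulr_gt0 ?powR_gt0.
have : (0 <= \int[mu]_(t in `]0%R, +oo[) (t `^ x * expR (- (v * t)))%:E)%E.
  by apply: integral_ge0 => t _; rewrite lee_fin mulr_ge0 ?powR_ge0 ?expR_ge0.
(* The identity reads Gamma = c * I in the extended reals with c > 0. Dividing by c requires I to be
   finite; I = +oo would contradict the finite left side. *)
case: (\int[mu]_(t in _) _)%E => [r| |]//.
  by move=> _ [->]; rewrite mulrAC divff ?mul1r// gt_eqF.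
by rewrite gt0_muley ?lte_fin.
Qed.

End GammaIntegrals.

Section MittagLefflerSeries.
Variables (R : realType) (nu : R).
Hypothesis nu_gt0 : 0 < nu.
Implicit Types (K z w : R).

Let nuj (j : nat) : 0 <= nu * j%:R. Proof. by rewrite mulr_ge0// ltW. Qed.

Let c_ge0 (j : nat) : 0 <= (Gamma (nu * j%:R + 1))^-1.
Proof. by rewrite invr_ge0 ltW// Gamma_gt0. Qed.

(* Gamma (x + 1) >= A^x e^{-(A+1)}; choosing A^nu = 2(K+1) makes the series
   geometrically dominated. *)
Lemma is_cvg_mittag_leffler_ge0 K : 0 <= K ->
  cvgn (series (fun j => K ^+ j / Gamma (nu * j%:R + 1))).
Proof.
move=> K0; set A := (2 * (K + 1)) `^ (nu^-1).
have K1 : 0 < 2 * (K + 1) by rewrite mulr_gt0// ltr_wpDl.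
have A0 : 0 < A by rewrite powR_gt0.
apply: (@series_le_cvg _ _ (geometric (expR (A + 1)) (K / (2 * (K + 1))))).
- by move=> n; rewrite mulr_ge0 ?exprn_ge0.
- by move=> n; rewrite /geometric/= mulr_ge0 ?expR_ge0 ?exprn_ge0// divr_ge0// ltW.
- move=> n; have := Gamma_lower_bound (nuj n) A0.
  rewrite {1}/A -powRrM mulrA mulVf ?gt_eqF// mul1r.
  rewrite powR_mulrn ?(ltW K1)// expRN => H.
  rewrite /geometric/= ler_pdivrMr ?Gamma_gt0// expr_div_n.
  have E0 := expR_gt0 (A + 1).
  move: H; rewrite ler_pdivrMr// => H.
  rewrite -[leLHS](@divfK _ ((2 * (K + 1)) ^+ n)); last by rewrite expf_neq0// gt_eqF.
  rewrite mulrC [leRHS](_ : _ = (Gamma (nu * n%:R + 1) * expR (A + 1)) *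
    (K ^+ n / (2 * (K + 1)) ^+ n)); last by ring.
  by rewrite ler_wpM2r// divr_ge0 ?exprn_ge0// ltW.
- apply: is_cvg_geometric_series.
  by rewrite ger0_norm ?divr_ge0 ?(ltW K1)// ltr_pdivrMr// mul1r; lra.
Qed.

Let f z : R^nat := fun j => z ^+ j / Gamma (nu * j%:R + 1).

Lemma is_cvg_mittag_leffler z : cvgn (series (f z)).
Proof.
apply: normed_cvg; rewrite (_ : [normed series _]%classic = series (f `|z|)).
  exact: is_cvg_mittag_leffler_ge0.
congr series; apply/funext => j /=.
by rewrite normrM normrX (ger0_norm (c_ge0 j)).
Qed.

(** The crude factor (2K)^j, in place of j K^(j-1), makes the dominating series again a
    Mittag-Leffler series, taken at 2K. *)
Lemma exprB_le K z w j : 1 <= K -> `|z| <= K -> `|w| <= K ->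
  `|z ^+ j - w ^+ j| <= (2 * K) ^+ j * `|z - w|.
Proof.
move=> K1 zK wK; have K0 : 0 <= K by apply: le_trans K1.
elim: j => [|j ih]; first by rewrite !expr0 subrr normr0 mul1r.
rewrite !exprS (_ : _ - _ = z * (z ^+ j - w ^+ j) + w ^+ j * (z - w)); last by ring.
apply: (le_trans (ler_normD _ _)); rewrite !normrM.
have h1 : `|z| * `|z ^+ j - w ^+ j| <= K * ((2 * K) ^+ j * `|z - w|).
  by apply: ler_pM.
have h2 : `|w ^+ j| * `|z - w| <= (K * (2 * K) ^+ j) * `|z - w|.
  rewrite ler_wpM2r// normrX; apply: (@le_trans _ _ (K ^+ j)).
    by rewrite lerXn2r ?nnegrE.
  apply: (@le_trans _ _ ((2 * K) ^+ j)).
    by rewrite lerXn2r ?nnegrE ?mulr_ge0// ler_peMl// ler1n.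
  by rewrite ler_peMl// exprn_ge0// mulr_ge0.
apply: (le_trans (lerD h1 h2)); rewrite le_eqVlt; apply/orP; left; apply/eqP.
by ring.
Qed.

Lemma mittag_leffler_lipschitz K z w : 1 <= K -> `|z| <= K -> `|w| <= K ->
  `|mittag_leffler nu z - mittag_leffler nu w| <=
  mittag_leffler nu (2 * K) * `|z - w|.
Proof.
move=> K1 zK wK; have K0 : 0 <= 2 * K by rewrite mulr_ge0// (le_trans _ K1).
rewrite /mittag_leffler -/(f z) -/(f w) -/(f (2 * K)) -limB;
  try exact: is_cvg_mittag_leffler.
rewrite (_ : series (f z) - series (f w) = series (f z - f w)); last first.
  by apply/funext => n; rewrite /series/= fctE -sumrB.
have dom j : `|(f z - f w) j| <= f (2 * K) j * `|z - w|.
  rewrite fctE /f -mulrBl normrM (ger0_norm (c_ge0 j)) mulrAC ler_wpM2r//.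
  exact: exprB_le.
have serM : series (fun j => f (2 * K) j * `|z - w|) =
    (fun n => series (f (2 * K)) n * `|z - w|).
  by apply/funext => n; rewrite /series/= mulr_suml.
have cvgd : cvgn (series (fun j => f (2 * K) j * `|z - w|)).
  rewrite serM; apply: is_cvgM; [exact: is_cvg_mittag_leffler|exact: is_cvg_cst].
have cvgn1 : cvgn [normed series (f z - f w)]%classic.
  apply: series_le_cvg cvgd => //.
    by move=> n; exact: normr_ge0.
  by move=> n; rewrite mulr_ge0// /f mulr_ge0// exprn_ge0.
apply: (le_trans (lim_series_norm cvgn1)).
apply: (le_trans (lim_series_le cvgn1 cvgd dom)).
by rewrite serM limM; [rewrite lim_cst|exact: is_cvg_mittag_leffler|exact: is_cvg_cst].
Qed.

Lemma continuous_mittag_leffler : continuous (@mittag_leffler R nu).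
Proof.
move=> z; set K := `|z| + 1; set B := mittag_leffler nu (2 * K).
have K1 : 1 <= K by rewrite lerDr.
have B0 : 0 <= B.
  apply: limr_ge; first exact: is_cvg_mittag_leffler.
  apply: nearW => n; apply: sumr_ge0 => j _; rewrite mulr_ge0// exprn_ge0//.
  by rewrite mulr_ge0// (le_trans _ K1).
apply/cvgrPdist_le => e e0; near=> w.
apply: le_trans (@mittag_leffler_lipschitz K z w K1 _ _) _.
- by rewrite lerDl.
- rewrite -[w](subrK z) addrC (le_trans (ler_normD _ _))// lerD2l -normrN opprB.
  near: w; apply: cvgr_dist_le; [exact: cvg_id|exact: ltr01].
- rewrite -/B; apply: (@le_trans _ _ (B * (e / (B + 1)))).
    rewrite ler_wpM2l//; near: w; apply: cvgr_dist_le; first exact: cvg_id.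
    by rewrite divr_gt0// ltr_wpDl.
  rewrite mulrCA ler_piMr ?(ltW e0)// ler_pdivrMr ?mul1r ?lerDl//.
  by rewrite ltr_wpDl.
Unshelve. all: by end_near. Qed.

End MittagLefflerSeries.

(** * Laplace transform of E_nu(-lambda t^nu), term by term *)

Section MittagLefflerLaplace.
Variables (R : realType) (nu lam v : R).
Hypotheses (nu_gt0 : 0 < nu) (lam_gt0 : 0 < lam) (v_gt0 : 0 < v).
Notation mu := (@lebesgue_measure R).

Lemma integrable_powR_expR (x : R) : 0 <= x ->
  mu.-integrable `]0, +oo[ (fun t => (t `^ x * expR (- (v * t)))%:E).
Proof.
move=> x0; apply/integrableP; split.
  by apply/measurable_EFinP; exact: measurable_powR_expR.
under eq_integral do rewrite gee0_abs ?lee_fin ?mulr_ge0 ?powR_ge0 ?expR_ge0//.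
by rewrite integral_powR_expR// ltry.
Qed.

Hypothesis lam_lt : lam < v `^ nu.

Let q := lam / v `^ nu.

Let vnu_gt0 : 0 < v `^ nu. Proof. exact: powR_gt0. Qed.

Let q_ge0 : 0 <= q. Proof. by rewrite divr_ge0// ltW. Qed.

Let q_lt1 : q < 1. Proof. by rewrite ltr_pdivrMr// mul1r. Qed.

Let term (a : R) (j : nat) (t : R) : R :=
  (a * t `^ nu) ^+ j / Gamma (nu * j%:R + 1) * expR (- (v * t)).

Let nuj (j : nat) : 0 <= nu * j%:R. Proof. by rewrite mulr_ge0// ltW. Qed.

Let G_gt0 (j : nat) : 0 < Gamma (nu * j%:R + 1). Proof. exact: Gamma_gt0. Qed.

Let termE a j : (fun t => (term a j t)%:E) = (fun t =>
  (a ^+ j / Gamma (nu * j%:R + 1))%:E * (t `^ (nu * j%:R) * expR (- (v * t)))%:E)%E.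
Proof.
apply/funext => t; rewrite -EFinM /term exprMn powRrM powR_mulrn ?powR_ge0//.
by congr EFin; ring.
Qed.

Let integrable_term a j : mu.-integrable `]0, +oo[ (fun t => (term a j t)%:E).
Proof.
by rewrite termE; apply: integrableZl => //; apply: integrable_powR_expR.
Qed.

Let integral_term a j : (\int[mu]_(t in `]0%R, +oo[) (term a j t)%:E =
  (geometric v^-1 (a / v `^ nu) j)%:E)%E.
Proof.
rewrite termE integralZl//; last exact: integrable_powR_expR.
rewrite integral_powR_expR// -EFinM; congr EFin; rewrite /geometric/=.
rewrite powRrM powR_mulrn ?powR_ge0// expr_div_n.
by field; rewrite !gt_eqF//= exprn_gt0.
Qed.

(** The series with all signs made positive, which dominates every partial sum. It lives in the
    extended reals, so only its integral has to be shown finite: a geometric series of ratio lam /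
    v^nu < 1. *)
Let dom (t : R) := (\sum_(0 <= j <oo) (term lam j t)%:E)%E.

Let term_ge0 (j : nat) t : 0 <= term lam j t.
Proof.
rewrite mulr_ge0 ?expR_ge0// divr_ge0 ?(ltW (G_gt0 _))// exprn_ge0//.
by rewrite mulr_ge0 ?powR_ge0// ltW.
Qed.

Let dom_ge0 t : (0 <= dom t)%E.
Proof. by apply: nneseries_ge0 => j _ _; rewrite lee_fin. Qed.

Let integrable_dom : mu.-integrable `]0, +oo[ dom.
Proof.
apply/integrableP; split.
  apply: ge0_emeasurable_sum => [j t _ _|j _]; first by rewrite lee_fin.
  exact: measurable_int (integrable_term lam j).
under eq_integral do rewrite gee0_abs//.
rewrite integral_nneseries//; last 2 first.
- by move=> j; exact: measurable_int (integrable_term lam j).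
- by move=> j t _; rewrite lee_fin.
under eq_eseriesr do rewrite integral_term.
rewrite (_ : limn _ = (v^-1 / (1 - q))%:E) ?ltry//.
apply: cvg_lim => //; under eq_fun do rewrite sumEFin.
apply: cvg_EFin; first exact: nearW.
by apply: cvg_geometric_series; rewrite ger0_norm.
Qed.

Let H (t : R) := mittag_leffler nu (- lam * t `^ nu).

Let cvg_partial t : series (term (- lam) ^~ t) n @[n --> \oo] -->
  H t * expR (- (v * t)).
Proof.
rewrite (_ : series _ = (fun n =>
    series (fun j => (- lam * t `^ nu) ^+ j / Gamma (nu * j%:R + 1)) n
      * expR (- (v * t)))); last first.
  by apply/funext => n; rewrite /series/= mulr_suml.
by apply: cvgM; [exact: is_cvg_mittag_leffler|exact: cvg_cst].
Qed.

Lemma measurable_mittag_leffler_powR (D : set R) : measurable_fun D H.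
Proof.
apply: measurable_funTS.
apply: (measurableT_comp (continuous_measurable_fun (continuous_mittag_leffler nu_gt0))).
by apply: measurable_funM.
Qed.

(** The Gamma factor of each integral of t^(nu j) e^{-vt} cancels the denominator of the
    coefficient. What remains is the geometric series of ratio - lam / v^nu, and [lam_lt] permits
    the interchange of sum and integral. *)
Lemma mittag_leffler_Laplace :
  mu.-integrable `]0, +oo[ (fun t => (H t * expR (- (v * t)))%:E) /\
  (\int[mu]_(t in `]0%R, +oo[) (H t * expR (- (v * t)))%:E =
   (v `^ nu / (v * (v `^ nu + lam)))%:E)%E.
Proof.
have [] := @dominated_convergence _ _ _ mu `]0, +oo[%classic (measurable_itv _)
  (fun n t => (series (term (- lam) ^~ t) n)%:E)
  (fun t => (H t * expR (- (v * t)))%:E) dom.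
- move=> n; apply/measurable_EFinP; apply: measurable_sum => j.
  by apply/measurable_EFinP; exact: measurable_int (integrable_term _ j).
- apply/measurable_EFinP; apply: measurable_funM.
    exact: measurable_mittag_leffler_powR.
  exact: measurable_expR_mul.
- by apply: aeW => t _; apply: cvg_EFin; [exact: nearW|exact: cvg_partial].
- exact: integrable_dom.
- apply: aeW => t n _; rewrite /=.
  apply: (@le_trans _ _ (\sum_(0 <= j < n) (term lam j t)%:E)%E); last first.
    by apply: nneseries_lim_ge => j _ _; rewrite lee_fin.
  rewrite sumEFin lee_fin; apply: (le_trans (ler_norm_sum _ _ _)).
  apply: ler_sum => j _; rewrite /term !normrM normrX normrM normrN.
  rewrite (gtr0_norm lam_gt0) (ger0_norm (powR_ge0 _ _)) (ger0_norm (expR_ge0 _)).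
  by rewrite ger0_norm// invr_ge0 ltW.
move=> iH _ cv; split => //; move: cv.
rewrite (_ : [sequence _]_n = (fun n => (series (geometric v^-1 (- q)) n)%:E)); last first.
  apply/funext => n /=; rewrite -sumEFin.
  under eq_integral do rewrite -sumEFin.
  rewrite integral_sum//; apply: eq_bigr => j _.
  by rewrite integral_term mulNr.
move=> /(cvg_lim _) <-//; apply: cvg_lim => //.
apply: cvg_EFin; first exact: nearW.
rewrite (_ : _ / _ = v^-1 / (1 - - q)).
  by apply: cvg_geometric_series; rewrite normrN ger0_norm.
by rewrite /q; field; rewrite opprK !gt_eqF//= addr_gt0.
Qed.

End MittagLefflerLaplace.

(** Vanishing tails make the mean of [Z] over any short interval to the right of c equal to 0, while
    right continuity keeps this mean close to [Z c]. The conclusion thus holds at every point and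
    not merely almost everywhere. *)
Lemma right_continuous_tail_eq0 (R : realType) (Z : R -> R) (c : R) :
  0 <= c -> lebesgue_measure.-integrable `]0, +oo[ (EFin \o Z) ->
  (forall b : R, \int[lebesgue_measure]_(t in `]0, +oo[) (Z t * (b < t)%R%:R) = 0) ->
  Z t @[t --> c^'+] --> Z c -> Z c = 0.
Proof.
move=> c0 iZ tail0 rc.
have tail (b : R) : 0 <= b -> \int[lebesgue_measure]_(t in `]b, +oo[) Z t = 0.
  move=> b0; rewrite -[RHS](tail0 b) Rintegral_mkcond [RHS]Rintegral_mkcond.
  apply: eq_Rintegral => t _; rewrite !patchE !mem_setE !in_itv/= !andbT.
  case: (ltP b t) => bt; last by rewrite mulr0 if_same.
  by rewrite mulr1 (le_lt_trans b0 bt).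
have iZS (A : set R) : measurable A -> A `<=` `]0, +oo[ ->
    lebesgue_measure.-integrable A (EFin \o Z).
  by move=> mA sA; exact: integrableS iZ.
apply/eqP; rewrite -normr_le0; apply/ler_addgt0Pr => e e0; rewrite add0r.
move: rc => /cvgrPdist_le/(_ e e0)[/= d d0 near_c].
set b := c + d / 2; have cb : c < b by rewrite ltrDl divr_gt0.
have sub : `]c, b] `<=` (`]0, +oo[ : set R).
  by move=> t; rewrite /= !in_itv/= => /andP[ct _]; rewrite (le_lt_trans c0 ct).
have : \int[lebesgue_measure]_(t in `]c, b]) Z t = 0.
  have U : `]c, +oo[%classic = (`]c, b] `|` `]b, +oo[)%classic :> set R.
    by apply: itv_bndbnd_setU => //; rewrite bnd_simp ltW.
  have := tail c c0; rewrite U Rintegral_setU//.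
  - by rewrite (tail b) ?addr0// (le_trans c0)// ltW.
  - rewrite -U; apply: iZS => // t.
    by rewrite /= !in_itv/= !andbT; exact: le_lt_trans.
  - apply/disj_setPS => t []; rewrite /= !in_itv/= andbT => /andP[_ tb] bt.
    by have := lt_le_trans bt tb; rewrite ltxx.
have mb : lebesgue_measure (`]c, b] : set R) = (d / 2)%:E.
  by rewrite lebesgue_measure_itv/= lte_fin cb -EFinB /b addrAC subrr add0r.
have icst k : lebesgue_measure.-integrable `]c, b] (EFin \o cst (k : R)).
  apply/integrableP; split => //=.
    exact/measurable_EFinP.
  rewrite (@integral_cst _ _ _ _ _ _ (`|k|%:E))//=.
  by rewrite mb -EFinM ltry.
move=> int0; have d2 : 0 < d / 2 by rewrite divr_gt0.
rewrite -(ler_pM2r d2).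
(* The integral of [Z] over the interval is 0, so it may be subtracted for free; the integrand
   [Z c - Z t] is then at most [e] in absolute value. *)
have -> : `|Z c| * (d / 2) = `|\int[lebesgue_measure]_(t in `]c, b]) (Z c - Z t)|.
  rewrite RintegralB//; last 2 first.
  - exact: icst.
  - exact: iZS.
  by rewrite int0 subr0 Rintegral_cst//= mb /= normrM (gtr0_norm d2).
have iB : lebesgue_measure.-integrable `]c, b] (EFin \o (fun t => Z c - Z t)).
  rewrite (_ : _ \o _ = (EFin \o cst (Z c)) \- (EFin \o Z))%E//.
  by apply: integrableB => //; exact: iZS.
apply: (le_trans (le_normr_Rintegral _ iB)) => //.
rewrite (_ : e * (d / 2) = \int[lebesgue_measure]_(t in `]c, b]) cst e t); last first.
  by rewrite Rintegral_cst//= mb.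
apply: le_Rintegral => //.
- exact: (integrable_norm iB).
- move=> t; rewrite /= in_itv/= => /andP[ct tb]; apply: near_c => //=.
  rewrite distrC gtr0_norm ?subr_gt0// ltrBlDl (le_lt_trans tb)// /b ltrD2l.
  by rewrite ltr_pdivrMr// ltr_pMr// ltr1n.
Qed.

Section CdfFromLaplace.
Context (R : realType) d (Omega : measurableType d) (P : probability Omega R).
Variables (X : {RV P >-> R}).
Hypothesis X_ge0 : forall w, 0 <= X w.
Notation mu := (@lebesgue_measure R).

Let S (t : R) : R := fine (ccdf X t).

Let SE t : (S t)%:E = ccdf X t.
Proof. by rewrite fineK// fin_num_measure. Qed.

Let S_ge0 t : 0 <= S t.
Proof. by rewrite fine_ge0. Qed.

Let S_le1 t : S t <= 1.
Proof. by rewrite -lee_fin SE; exact: probability_le1. Qed.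

Let mS (D : set R) : measurable_fun D S.
Proof.
by apply: measurable_funTS; apply: measurableT_comp => //; exact: ccdf_measurable.
Qed.

Let joint (v : R) (z : Omega * R) : \bar R :=
  (exponential_pdf v z.2 * (z.2 < X z.1)%R%:R)%:E.

Let measurable_joint v : measurable_fun setT (joint v).
Proof.
apply/measurable_EFinP; apply: measurable_funM.
  by apply: measurableT_comp => //; exact: measurable_exponential_pdf.
have -> : (fun z : Omega * R => (z.2 < X z.1)%R%:R) =
    (fun z => if (z.2 < X z.1)%R then 1 else 0 : R).
  by apply/funext => z; case: ifP.
apply: measurable_fun_ifT => //; apply: measurable_fun_ltr => //.
exact: measurableT_comp.
Qed.

(** Fubini for the exponential density at t restricted to t < X: integrating over w first yields the
    survival function, integrating over t first yields the exponential distribution function at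
    X. *)
Lemma Laplace_ccdf v : 0 < v ->
  (\int[mu]_(t in `]0%R, +oo[) (v * (S t * expR (- (v * t))))%:E =
   \int[P]_w (1 - expR (- (v * X w)))%:E)%E.
Proof.
move=> v0; transitivity (\int[mu]_t \int[P]_w joint v (w, t))%E.
  rewrite integral_itv_obnd_cbnd; last first.
    apply/measurable_EFinP; apply: measurable_funM => //.
    apply: measurable_funM => //.
    exact: measurable_expR_mul.
  rewrite integral_mkcond; apply: eq_integral => t _.
  have -> : (\int[P]_w joint v (w, t) = (exponential_pdf v t * S t)%:E)%E.
    rewrite EFinM SE /ccdf /distribution /pushforward/=.
    rewrite -[X in (_ * P X)%E]setIT -integral_indic//; last exact: measurable_funPTI.
    rewrite -ge0_integralZl//; last 2 first.
    - by apply/measurable_EFinP; apply: measurable_indic; exact: measurable_funPTI.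
    - by rewrite lee_fin exponential_pdf_ge0// ltW.
    apply: eq_integral => w _; rewrite /joint/= -EFinM indicE; congr (_ * _%:R)%:E.
    by congr nat_of_bool; apply/idP/idP; rewrite inE/= in_itv/= andbT.
  rewrite /exponential_pdf !patchE; case: ifPn => // _; last by rewrite mul0r.
  by rewrite mulNr; congr EFin; ring.
rewrite -(fubini_tonelli (m1 := P) (m2 := mu)) //; last 2 first.
- exact: measurable_joint.
- by move=> z; rewrite /joint lee_fin mulr_ge0// exponential_pdf_ge0// ltW.
apply: eq_integral => w _.
have := X_ge0 w; rewrite le_eqVlt => /predU1P[Xw0|Xw0].
  rewrite -Xw0 mulr0 oppr0 expR0 subrr; apply: integral0_eq => t _.
  rewrite /joint/= -Xw0 /exponential_pdf patchE; case: ifPn; last by rewrite mul0r.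
  by rewrite inE/= in_itv/= andbT => t0; rewrite ltNge t0 mulr0.
rewrite EFinB -mulNr -(exponential_prob_itv0c v Xw0) /exponential_prob.
rewrite -integral_itv_bndo_bndc; last first.
  apply/measurable_EFinP/measurable_funTS; exact: measurable_exponential_pdf.
rewrite [RHS]integral_mkcond; apply: eq_integral => t _; rewrite /joint/= patchE.
rewrite mem_setE in_itv/=; case: (leP 0 t) => t0/=.
  by case: (ltP t (X w)); rewrite ?mulr1 ?mulr0.
by rewrite lt0_exponential_pdf// mul0r.
Qed.

(** The survival function S and H(t) = E_nu(-lam t^nu) have the same Laplace transform wherever that
    of H was computed. Uniqueness is applied with Lebesgue measure on the half-line and the identity
    in the role of X, and right continuity upgrades it to all t. *)
Lemma mittag_leffler_distributed_of_Laplace (nu lam : R) :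
  0 < nu -> 0 < lam ->
  (forall v, 0 < v ->
    (\int[P]_w (expR (- (v * X w)))%:E = (lam / (lam + v `^ nu))%:E)%E) ->
  mittag_leffler_distributed nu lam X.
Proof.
move=> nu0 lam0 LX.
have LS v : 0 < v ->
    mu.-integrable `]0, +oo[ (fun t => (S t * expR (- (v * t)))%:E) /\
    (\int[mu]_(t in `]0%R, +oo[) (S t * expR (- (v * t)))%:E =
     (v `^ nu / (v * (v `^ nu + lam)))%:E)%E.
  move=> v0.
  have mSe : measurable_fun (`]0, +oo[%classic : set R)
      (fun t => (S t * expR (- (v * t)))%:E).
    apply/measurable_EFinP; apply: measurable_funM => //.
    exact: measurable_expR_mul.
  have Se0 t : 0 <= S t * expR (- (v * t)) by rewrite mulr_ge0 ?expR_ge0.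
  have mE : measurable_fun setT (fun w => expR (- (v * X w))).
    by apply: measurableT_comp => //; apply: measurableT_comp => //;
      exact: measurable_funM.
  have iE : P.-integrable setT (EFin \o (fun w => expR (- (v * X w)))).
    apply: integrable_norm_le1 => // w; rewrite ger0_norm ?expR_ge0// expR_le1.
    by rewrite oppr_le0 mulr_ge0// ltW.
  have e : (\int[mu]_(t in `]0%R, +oo[) (S t * expR (- (v * t)))%:E =
     (v `^ nu / (v * (v `^ nu + lam)))%:E)%E.
    have := Laplace_ccdf v0; under eq_integral do rewrite EFinM.
    rewrite ge0_integralZl//; last 2 first.
    - by move=> t _; rewrite lee_fin.
    - by rewrite lee_fin ltW.
    under [in RHS]eq_integral do rewrite EFinB.
    rewrite integralB_EFin//; last exact: finite_measure_integrable_cst.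
    rewrite LX// integral_cst//= probability_setT mule1 -EFinB => h.
    rewrite -[LHS]mul1e -(mulVf (lt0r_neq0 v0)) EFinM -muleA h -EFinM; congr EFin.
    by field; rewrite !gt_eqF//= addr_gt0// powR_gt0.
  split => //; apply/integrableP; split => //.
  by under eq_integral do rewrite gee0_abs ?lee_fin//; rewrite e ltry.
set H := fun t : R => mittag_leffler nu (- lam * t `^ nu).
(* This choice gives v1^nu = lam + 1 > lam, so every v1 + n lies in the range of
   [mittag_leffler_Laplace]. The weight e^{-v1 t} also makes S - H integrable. *)
set v1 := (lam + 1) `^ nu^-1.
have v10 : 0 < v1 by rewrite powR_gt0// addr_gt0.
have v1l n : lam < (v1 + n%:R) `^ nu.
  apply: (@lt_le_trans _ _ (v1 `^ nu)).
    by rewrite /v1 -powRrM mulVf ?gt_eqF// powRr1 ?addr_ge0 ?ltrDl// ltW.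
  by apply: ge0_ler_powR; rewrite ?nnegrE ?addr_ge0 ?lerDl ?(ltW nu0) ?(ltW v10).
pose Z t := (S t - H t) * expR (- (v1 * t)).
have v1n n : 0 < v1 + n%:R by rewrite ltr_pwDl.
have iH n := (mittag_leffler_Laplace nu0 lam0 (v1n n) (v1l n)).1.
have LH n := (mittag_leffler_Laplace nu0 lam0 (v1n n) (v1l n)).2.
have iS n := (LS _ (v1n n)).1.
have ZE n t : Z t * expR (- (n%:R * t)) =
    S t * expR (- ((v1 + n%:R) * t)) - H t * expR (- ((v1 + n%:R) * t)).
  by rewrite /Z -mulrA -expRD -opprD -mulrDl mulrBl.
have iZ : mu.-integrable `]0, +oo[ (EFin \o Z).
  rewrite (_ : _ \o _ = (fun t => (S t * expR (- ((v1 + 0%:R) * t)))%:E) \-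
    (fun t => (H t * expR (- ((v1 + 0%:R) * t)))%:E))%E.
    exact: integrableB.
  by apply/funext => t /=; rewrite -EFinB -ZE mul0r oppr0 expR0 mulr1.
have Z0 (c : R) : 0 <= c -> Z c = 0.
  move=> c0; apply: right_continuous_tail_eq0 => //.
    apply: (@Rintegral_tail_eq0 _ _ _ mu `]0, +oo[%classic Z id) => //.
      by move=> t; rewrite /= in_itv/= andbT => /ltW.
    move=> n; under eq_Rintegral do rewrite ZE.
    rewrite RintegralB//; [|exact: iS|exact: iH].
    by rewrite /Rintegral (LS _ (v1n n)).2 LH subrr.
  apply: cvgM; last first.
    apply: cvg_at_right_filter.
    apply: (@continuous_comp _ _ _ (fun t => - (v1 * t)) (@expR R)).
      by apply: continuousN; apply: continuousM => //; exact: cst_continuous.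
    exact: continuous_expR.
  apply: cvgB.
    by apply: fine_cvg; rewrite SE; exact: ccdf_right_continuous.
  apply: (@cvg_comp _ _ _ (fun t => - lam * t `^ nu) (mittag_leffler nu)); last first.
    exact: continuous_mittag_leffler.
  apply: cvgM; first exact: cvg_cst.
  have : {within `[0, +oo[, continuous (@powR R ^~ nu)}.
    apply/continuous_within_itvcyP; split.
      move=> t; rewrite in_itv/= andbT => t0.
      apply: differentiable_continuous; apply/derivable1_diffP.
      by apply: derivable_powR; rewrite in_itv/= t0.
    by rewrite powR0 ?gt_eqF//; exact: powR_cvg0.
  move/continuous_within_itvcyP => [cont cont0].
  move: c0; rewrite le_eqVlt => /predU1P[<-//|c0].
  by apply: cvg_at_right_filter; apply: cont; rewrite in_itv/= c0.
move=> t t0; have := Z0 t t0 => /eqP; rewrite mulf_eq0 (gt_eqF (expR_gt0 _)) orbF.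
rewrite subr_eq0 => /eqP SH; have := cdf_ccdf_1 X t.
have cf : cdf X t \is a fin_num by rewrite fin_num_measure.
rewrite -SE SH -(fineK cf) -EFinD => -[h]; congr EFin.
by rewrite -h /H addrK.
Qed.

End CdfFromLaplace.

(** * Product rules for expectations *)

(** The class of test functions: integrable for every probability, closed under products, and
    containing both the indicators and e^{-aX} for a, X >= 0. *)
Definition unit_fun d (T : measurableType d) (R : realType) (f : T -> R) : Prop :=
  measurable_fun setT f /\ forall x, 0 <= f x <= 1.

Section UnitFun.
Context d (T : measurableType d) (R : realType).
Implicit Types f g : T -> R.

Lemma unit_fun_norm f x : unit_fun f -> `|f x| <= 1.
Proof. by move=> [_ /(_ x)/andP[? ?]]; rewrite ger0_norm. Qed.

Lemma unit_fun_integrable (P : probability T R) f :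
  unit_fun f -> P.-integrable setT (EFin \o f).
Proof.
by move=> uf; apply: integrable_norm_le1 => [|x]; [case: uf|exact: unit_fun_norm].
Qed.

Lemma unit_fun_bool (b : bool) : unit_fun (fun _ : T => b%:R : R).
Proof.
by split; [exact: measurable_cst|case: b => _; rewrite ?ler01 ?lexx].
Qed.

Lemma unit_fun1 : unit_fun (fun _ : T => 1 : R).
Proof. exact: (unit_fun_bool true). Qed.

Lemma unit_fun_mul f g : unit_fun f -> unit_fun g -> unit_fun (fun x => f x * g x).
Proof.
move=> [mf f01] [mg g01]; split; first exact: measurable_funM.
by move=> x; have /andP[? ?] := f01 x; have /andP[? ?] := g01 x;
  rewrite mulr_ge0//= mulr_ile1.
Qed.

Lemma unit_fun_prod (I : Type) (s : seq I) (F : I -> T -> R) :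
  (forall i, unit_fun (F i)) -> unit_fun (fun x => \prod_(i <- s) F i x).
Proof.
move=> uF; elim: s => [|i s ih].
  by under eq_fun do rewrite big_nil; exact: unit_fun1.
by under eq_fun do rewrite big_cons; exact: unit_fun_mul.
Qed.

Lemma unit_fun_indic (B : set T) : measurable B -> unit_fun (\1_B : T -> R).
Proof.
move=> mB; split; first exact: measurable_indic.
by move=> x; rewrite indicE; case: (_ \in _); rewrite ?ler01 ?lexx.
Qed.

Lemma unit_fun_expR f : measurable_fun setT f -> (forall x, 0 <= f x) ->
  unit_fun (fun x => expR (- f x)).
Proof.
move=> mf f0; split; first by apply: measurableT_comp => //; exact: measurableT_comp.
by move=> x; rewrite expR_ge0/= expR_le1 oppr_le0.
Qed.

Lemma Rintegral_unit_itv (P : probability T R) f :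
  unit_fun f -> 0 <= \int[P]_w f w <= 1.
Proof.
move=> uf; rewrite Rintegral_ge0/=; last by move=> x _; have /andP[] := uf.2 x.
apply: (@le_trans _ _ (\int[P]_w cst 1 w)).
  apply: le_Rintegral => //; first exact: unit_fun_integrable.
    exact: (unit_fun_integrable _ unit_fun1).
  by move=> x _; have /andP[] := uf.2 x.
have e : fine (P setT) <= 1 by rewrite probability_setT.
by rewrite Rintegral_cst// mul1r.
Qed.

Lemma Rintegral_indic (P : probability T R) (B : set T) : measurable B ->
  \int[P]_w \1_B w = fine (P B).
Proof. by move=> mB; rewrite /Rintegral integral_indic// setIT. Qed.

End UnitFun.

Lemma unit_fun_comp d (T : measurableType d) d' (T' : measurableType d')
    (R : realType) (f : T' -> R) (X : T -> T') :
  unit_fun f -> measurable_fun setT X -> unit_fun (f \o X).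
Proof. by move=> [mf f01] mX; split; [exact: measurableT_comp|move=> x; exact: f01]. Qed.

Section Layers.
Variable R : realType.

Lemma sum_ltn_minn (N t : nat) : (\sum_(i < N) (i < t) = minn N t)%N.
Proof.
elim: N => [|N ih]; first by rewrite big_ord0 min0n.
by rewrite big_ord_recr/= ih; case: (ltnP N t) => h; rewrite /minn;
  case: ltnP; case: ltnP; lia.
Qed.

(* [layers N y] is floor((N+1) y) / (N+1) for y in [0, 1], written as a
   combination of indicators. *)
Definition layers (N : nat) (y : R) : R :=
  N.+1%:R^-1 * \sum_(i < N.+1) (i.+1%:R <= N.+1%:R * y)%R%:R.

Lemma layers_le (N : nat) (y : R) : 0 <= y <= 1 ->
  `|y - layers N y| <= N.+1%:R^-1.
Proof.
move=> /andP[y0 y1]; set M := N.+1%:R * y.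
have M0 : 0 <= M by rewrite mulr_ge0.
have -> : layers N y = N.+1%:R^-1 * (Num.truncn M)%:R.
  congr (_ * _); have tN : (Num.truncn M <= N.+1)%N.
    by rewrite -ltnS truncn_lt_nat// (le_lt_trans (ler_piMr _ y1))// ltr_nat.
  rewrite -(minn_idPr tN) -sum_ltn_minn natr_sum; apply: eq_bigr => i _.
  by rewrite -truncn_ge_nat.
have /andP[t1 t2] := truncn_itv M0.
have -> : y = N.+1%:R^-1 * M by rewrite mulKf.
rewrite -mulrBr ger0_norm; last by rewrite mulr_ge0 ?subr_ge0.
by rewrite ler_piMr// lerBlDr addrC natr1 ltW.
Qed.

Lemma cvg_layers (y : R) : 0 <= y <= 1 -> layers N y @[N --> \oo] --> y.
Proof.
move=> y01; apply/cvgrPdist_le => e e0.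
have := @cvg_harmonic R => /cvgrPdist_le/(_ e e0); apply: filterS => N.
rewrite sub0r normrN ger0_norm ?invr_ge0//.
exact: le_trans (layers_le N y01).
Qed.

End Layers.

Section Orthogonality.
Context d (T : measurableType d) (R : realType) (P : probability T R).
Variable Z : T -> R.
Hypothesis iZ : P.-integrable setT (EFin \o Z).

Let Rintegral_preimage (A : set T) : measurable A ->
  \int[P]_(w in A) Z w = \int[P]_w (Z w * \1_A w).
Proof.
move=> mA; rewrite Rintegral_mkcond; apply: eq_Rintegral => w _.
by rewrite patchE indicE; case: ifPn => _; rewrite ?mulr1 ?mulr0.
Qed.

Lemma orthogonal_unit_fun d' (T' : measurableType d') (X : T -> T') :
  measurable_fun setT X ->
  (forall B, measurable B -> \int[P]_w (Z w * \1_B (X w)) = 0) ->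
  forall f : T' -> R, unit_fun f -> \int[P]_w (Z w * f (X w)) = 0.
Proof.
move=> mX ZB f uf; have [mf f01] := uf.
pose B N i : set T' := [set x | i.+1%:R <= N.+1%:R * f x].
have mB N i : measurable (B N i).
  rewrite -[B N i]setTI; apply: measurable_fun_le => //.
  exact: measurable_funM.
have iB N i : P.-integrable setT (EFin \o (fun w => Z w * \1_(B N i) (X w))).
  apply: integrable_mul_le1 => //.
    by apply: measurableT_comp => //; exact: measurable_indic.
  by move=> w _; exact: (unit_fun_norm (X w) (unit_fun_indic R (mB N i))).
have mL N : measurable_fun setT (fun w => layers N (f (X w))).
  apply: measurable_funM => //; apply: measurable_sum => i.
  rewrite (_ : (fun _ => _) = \1_(B N i) \o X).
    by apply: measurableT_comp => //; exact: measurable_indic.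
  by apply/funext => w /=; rewrite indicE mem_setE.
have ZL N : (\int[P]_w (Z w * layers N (f (X w)))%:E = 0)%E.
  under eq_integral => w _.
    rewrite (_ : _%:E = N.+1%:R^-1%:E *
        \sum_(i < N.+1) (Z w * \1_(B N i) (X w))%:E)%E; last first.
      rewrite sumEFin -EFinM mulrCA mulr_sumr; congr (_ * _)%:E.
      by apply: eq_bigr => i _; rewrite indicE mem_setE.
    over.
  rewrite integralZl//; last first.
    by apply: integrable_sum => //= i _; exact: iB.
  rewrite integral_sum//; last by move=> i; exact: iB.
  rewrite big1 ?mule0// => i _.
  rewrite -[LHS]fineK ?integrable_fin_num//; last exact: iB.
  by congr EFin; exact: ZB.
(* The bound is 2 |Z| because [layers] differs from a value in [0, 1] by at most 1 / (N + 1) <=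
   1. *)
have [] := @dominated_convergence _ _ _ P setT measurableT
  (fun N w => (Z w * layers N (f (X w)))%:E)
  (fun w => (Z w * f (X w))%:E) (fun w => (2 * `|Z w|)%:E).
- move=> N; apply/measurable_EFinP; apply: measurable_funM => //.
  exact/measurable_EFinP/(measurable_int _ iZ).
- apply/measurable_EFinP; apply: measurable_funM => //.
    exact/measurable_EFinP/(measurable_int _ iZ).
  exact: measurableT_comp.
- apply: aeW => w _; apply: cvg_EFin; first exact: nearW.
  by apply: cvgM; [exact: cvg_cst|exact: cvg_layers].
- rewrite (_ : (fun _ => _) = (fun w => 2%:E * `|(Z w)%:E|)%E) //.
  by apply: integrableZl => //; exact: integrable_abse.
- apply: aeW => w N _; rewrite /= lee_fin normrM mulrC ler_wpM2r//.
  have := layers_le N (f01 (X w)); have /andP[f0 f1] := f01 (X w).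
  have : N.+1%:R^-1 <= 1 :> R by rewrite invf_le1// ler1n.
  move=> h1 h2; rewrite -[layers _ _](subKr (f (X w))).
  apply: (le_trans (ler_normB _ _)); rewrite (ger0_norm f0).
  by apply: lerD => //; exact: le_trans h1.
move=> _ _; under eq_fun do rewrite ZL.
by move=> H; rewrite /Rintegral -(cvg_lim _ H)// lim_cst.
Qed.

(** The half-lines ]c, +oo[ form a pi-system generating the Borel sets, and for them the claim is
    [Rintegral_tail_eq0]. Dynkin's theorem covers all Borel sets, then [orthogonal_unit_fun] all
    test functions. *)
Lemma orthogonal_Laplace (X : T -> R) :
  measurable_fun setT X -> (forall w, 0 <= X w) ->
  (forall n : nat, \int[P]_w (Z w * expR (- (n%:R * X w))) = 0) ->
  forall f : R -> R, unit_fun f -> \int[P]_w (Z w * f (X w)) = 0.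
Proof.
move=> mX X0 ZL; apply: orthogonal_unit_fun => // B mB.
have mXB (A : set R) : measurable A -> measurable (X @^-1` A).
  by move=> mA; rewrite -[_ @^-1` _]setTI; exact: mX.
have iZS A : measurable A -> P.-integrable A (EFin \o Z).
  by move=> mA; exact: integrableS iZ.
suff : (\int[P]_(w in X @^-1` B) (Z w)%:E = 0)%E.
  move=> h; have := Rintegral_preimage (mXB _ mB); rewrite {1}/Rintegral h => /= ->.
  by apply: eq_Rintegral => w _; rewrite !indicE.
(* The exponent n = 0 says that [Z] has total integral 0; the whole space and the complements need
   this. *)
have Z0 : (\int[P]_w (Z w)%:E = 0)%E.
  rewrite -[LHS]fineK ?integrable_fin_num//; congr EFin; rewrite -[RHS](ZL 0%N).
  by apply: eq_Rintegral => w _; rewrite mul0r oppr0 expR0 mulr1.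
have {}mB : (@RGenOInfty.G R).-sigma.-measurable B by rewrite -RGenOInfty.measurableE.
move: B mB; apply: (@dynkin_induction _ _ (@RGenOInfty.G R)
    (fun B => (\int[P]_(w in X @^-1` B) (Z w)%:E = 0)%E)).
- exact: RGenOInfty.measurableE.
- move=> _ _ [x ->] [y ->]; exists (Num.max x y).
  apply/seteqP; split => z; rewrite /= !in_itv/= !andbT gt_max; first by case=> -> ->.
  by move=> /andP[].
- by rewrite preimage_setT.
- move=> _ [c ->]; have mc : measurable (X @^-1` `]c, +oo[) by exact: mXB.
  rewrite -[LHS]fineK; last by apply: integrable_fin_num => //; exact: iZS.
  congr EFin; rewrite -/(Rintegral P _ Z) Rintegral_preimage//.
  rewrite -[RHS](@Rintegral_tail_eq0 _ _ _ P setT Z X measurableT iZ mX _ ZL c)//.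
  apply: eq_Rintegral => w _; rewrite indicE; congr (_ * _%:R).
  by congr nat_of_bool; apply/idP/idP; rewrite inE/= in_itv/= andbT.
- move=> S mS ZS; have := Z0; rewrite -(setUv (X @^-1` S)).
  rewrite integral_setU//.
  + by rewrite ZS add0e preimage_setC.
  + exact: mXB.
  + by apply: measurableC; exact: mXB.
  + by rewrite setUv; exact/measurable_EFinP/measurable_EFinP/(measurable_int _ iZ).
  + exact/disj_setPCl.
- move=> F mF tF ZF; rewrite preimage_bigcup integral_bigcup//.
  + by rewrite eseries0// => k _ _; rewrite ZF.
  + apply/trivIsetP => i j _ _ ij; rewrite -preimage_setI.
    by move/trivIsetP: tF => /(_ i j Logic.I Logic.I ij) ->; rewrite preimage_set0.
  + by move=> k; exact: mXB.
  + by apply: iZS; apply: bigcupT_measurable => k; exact: mXB.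
Qed.

End Orthogonality.

(** Truncating at 0 makes the exponential a test function on the whole line without changing it on
    nonnegative values. *)
Definition exp_pos (R : realType) (a x : R) : R := expR (- (a * Num.max x 0)).

Lemma unit_exp_pos (R : realType) (a : R) : 0 <= a -> unit_fun (exp_pos a).
Proof.
move=> a0; apply: unit_fun_expR => [|x].
  by apply: measurable_funM => //; apply: measurable_maxr.
by rewrite mulr_ge0// le_max lexx orbT.
Qed.

Section ProductExpectation.
Context d (Omega : measurableType d) (R : realType) (P : probability Omega R).

(** A product rule for W and g is orthogonality of g to the centred W; this turns the orthogonality
    lemmas into factorisation lemmas. *)
Lemma Rintegral_center (W g : Omega -> R) : unit_fun W -> unit_fun g ->
  \int[P]_w ((W w - \int[P]_w W w) * g w) =
  \int[P]_w (W w * g w) - (\int[P]_w W w) * (\int[P]_w g w).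
Proof.
move=> uW ug; under eq_Rintegral do rewrite mulrBl.
rewrite RintegralB//.
- by rewrite RintegralZl//; exact: unit_fun_integrable.
- exact: unit_fun_integrable (unit_fun_mul uW ug).
- by apply: (@integrableZl _ _ _ _ _ _ _ (EFin \o g)) => //; exact: unit_fun_integrable.
Qed.

Lemma integrable_center (W : Omega -> R) : unit_fun W ->
  P.-integrable setT (EFin \o (fun w => W w - \int[P]_w W w)).
Proof.
move=> uW; apply: integrable_norm_le1 => [|w].
  by apply: measurable_funB => //; case: uW.
have /andP[W0 W1] := uW.2 w; have /andP[E0 E1] := Rintegral_unit_itv P uW.
by rewrite ler_norml; apply/andP; split; lra.
Qed.

Lemma expectation_mul_unit_fun d' (T' : measurableType d') (X : Omega -> T')
    (W : Omega -> R) : measurable_fun setT X -> unit_fun W ->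
  (forall B, measurable B -> \int[P]_w (W w * \1_B (X w)) =
    (\int[P]_w W w) * (\int[P]_w \1_B (X w))) ->
  forall f : T' -> R, unit_fun f ->
  \int[P]_w (W w * f (X w)) = (\int[P]_w W w) * (\int[P]_w f (X w)).
Proof.
move=> mX uW H f uf; apply/eqP; rewrite -subr_eq0; apply/eqP.
rewrite -(Rintegral_center uW (unit_fun_comp uf mX)).
apply: (orthogonal_unit_fun (integrable_center uW) mX) => //.
move=> B mB; rewrite (Rintegral_center uW (unit_fun_comp (unit_fun_indic R mB) mX)).
by rewrite H// subrr.
Qed.

Lemma expectation_mul_Laplace (X W : Omega -> R) :
  measurable_fun setT X -> (forall w, 0 <= X w) -> unit_fun W ->
  (forall n : nat, \int[P]_w (W w * expR (- (n%:R * X w))) =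
    (\int[P]_w W w) * (\int[P]_w expR (- (n%:R * X w)))) ->
  forall f : R -> R, unit_fun f ->
  \int[P]_w (W w * f (X w)) = (\int[P]_w W w) * (\int[P]_w f (X w)).
Proof.
move=> mX X0 uW H f uf; apply/eqP; rewrite -subr_eq0; apply/eqP.
rewrite -(Rintegral_center uW (unit_fun_comp uf mX)).
apply: (orthogonal_Laplace (integrable_center uW) mX) => //.
move=> n; rewrite Rintegral_center//; last first.
  by apply: unit_fun_expR => [|w]; [exact: measurable_funM|rewrite mulr_ge0].
by rewrite H subrr.
Qed.

Variables (I : eqType) (X : I -> Omega -> R).
Hypothesis mX : forall i, measurable_fun setT (X i).

(* The product rule for test functions from [C] is extended to all test
   functions by replacing one factor at a time. *)
Lemma product_rule_extend (C : set (R -> R)) :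
  (forall g, C g -> unit_fun g) ->
  (forall i (W : Omega -> R), unit_fun W ->
    (forall g, C g -> \int[P]_w (W w * g (X i w)) =
      (\int[P]_w W w) * (\int[P]_w g (X i w))) ->
    forall f : R -> R, unit_fun f -> \int[P]_w (W w * f (X i w)) =
      (\int[P]_w W w) * (\int[P]_w f (X i w))) ->
  (forall (s : seq I) (g : I -> R -> R), uniq s ->
    (forall i, i \in s -> C (g i)) ->
    \int[P]_w (\prod_(i <- s) g i (X i w)) =
    \prod_(i <- s) \int[P]_w g i (X i w)) ->
  forall (s : seq I) (f : I -> R -> R), uniq s ->
    (forall i, unit_fun (f i)) ->
    \int[P]_w (\prod_(i <- s) f i (X i w)) =
    \prod_(i <- s) \int[P]_w f i (X i w).
Proof.
move=> CU ext prodC.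
(* Factors over [s1] are arbitrary, those over [s2] still belong to [C]. The induction removes the
   head of [s1], and the hypothesis is used with that head moved to [s2]. *)
suff key (s1 s2 : seq I) (f : I -> R -> R) : uniq (s1 ++ s2) ->
    (forall i, unit_fun (f i)) -> (forall i, i \in s2 -> C (f i)) ->
    \int[P]_w (\prod_(i <- s1 ++ s2) f i (X i w)) =
    \prod_(i <- s1 ++ s2) \int[P]_w f i (X i w).
  by move=> s f us uf; have := @key s [::] f; rewrite cats0; exact.
elim: s1 s2 f => [|i s1 ih] s2 f; first by move=> us _; exact: prodC.
rewrite cat_cons => /andP[iNs us] uf Cf.
have prod_mid (F : I -> R) :
    \prod_(j <- s1 ++ i :: s2) F j = (\prod_(j <- s1 ++ s2) F j) * F i.
  by rewrite !big_cat big_cons/= mulrA mulrAC.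
pose W w := \prod_(j <- s1 ++ s2) f j (X j w).
have uW : unit_fun W by apply: unit_fun_prod => j; exact: unit_fun_comp.
have EW : \int[P]_w W w = \prod_(j <- s1 ++ s2) \int[P]_w f j (X j w).
  exact: ih.
under eq_Rintegral do rewrite big_cons mulrC -/(W _).
rewrite big_cons mulrC -EW; apply: ext => // g Cg.
(* With [g] from [C] in place of [f i], the index [i] may join [s2], so the induction hypothesis
   gives exactly the rule for [C] that [ext] asks for. *)
pose f' j := if j == i then g else f j.
have f'E j : j \in s1 ++ s2 -> f' j = f j.
  by move=> js; rewrite /f'; case: eqP => // ji; rewrite -ji js in iNs.
have f'i : f' i = g by rewrite /f' eqxx.
have Ef' : \prod_(j <- s1 ++ s2) (\int[P]_w f' j (X j w)) = \int[P]_w W w.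
  by rewrite EW; apply: eq_big_seq => j js; rewrite f'E.
have : \int[P]_w (\prod_(j <- s1 ++ i :: s2) f' j (X j w)) =
       \prod_(j <- s1 ++ i :: s2) \int[P]_w f' j (X j w).
  apply: ih.
  - by rewrite uniq_catC/= mem_cat orbC -mem_cat iNs uniq_catC.
  - by move=> j; rewrite /f'; case: eqP => // _; exact: CU.
  - by move=> j; rewrite inE /f'; case: eqP => //= _; exact: Cf.
rewrite prod_mid Ef' f'i => <-.
apply: eq_Rintegral => w _; rewrite prod_mid f'i; congr (_ * _).
by apply: eq_big_seq => j js; rewrite f'E.
Qed.

Lemma Rintegral_prod_indic (s : seq I) (B : I -> set R) :
  (forall i, measurable (B i)) ->
  (\int[P]_w (\prod_(i <- s) \1_(B i) (X i w)))%:E =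
  P (\big[setI/setT]_(i <- s) (X i @^-1` B i)).
Proof.
move=> mB; have mXB i : measurable (X i @^-1` B i).
  by rewrite -[_ @^-1` _]setTI; exact: mX.
have mS : measurable (\big[setI/setT]_(i <- s) (X i @^-1` B i)).
  by apply: big_ind => //; exact: measurableI.
rewrite -[RHS]fineK ?fin_num_measure// -Rintegral_indic//; congr EFin.
apply: eq_Rintegral => w _; elim: s {mS} => [|i s ih].
  by rewrite !big_nil indicE mem_set.
by rewrite !big_cons indicI ih !indicE.
Qed.

Lemma Rintegral_indic_comp i (B : set R) : measurable B ->
  (\int[P]_w \1_B (X i w))%:E = P (X i @^-1` B).
Proof.
move=> mB; have := @Rintegral_prod_indic [:: i] (fun=> B) (fun=> mB).
by rewrite big_seq1 => <-; congr EFin; apply: eq_Rintegral => w _; rewrite big_seq1.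
Qed.

Lemma mutually_independentP : mutually_independent P X <->
  (forall (s : seq I) (f : I -> R -> R), uniq s ->
    (forall i, unit_fun (f i)) ->
    \int[P]_w (\prod_(i <- s) f i (X i w)) =
    \prod_(i <- s) \int[P]_w f i (X i w)).
Proof.
split=> [indX|H s B us mB]; last first.
  rewrite -Rintegral_prod_indic// (H s (fun i => \1_(B i)))//;
    last by move=> i; exact: unit_fun_indic.
  rewrite -prodEFin; apply: eq_bigr => i _; exact: Rintegral_indic_comp.
apply: (@product_rule_extend [set g | exists2 B, measurable B & g = \1_B]).
- by move=> _ [B mB ->]; exact: unit_fun_indic.
- move=> i W uW WC f uf; apply: expectation_mul_unit_fun => // B mB.
  by apply: WC; exists B.
- move=> s g us Cg.
  (* Independence quantifies over total families of sets, whereas [g] is an indicator only on [s];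
     elsewhere [setT] is a harmless default. *)
  have /choice[B HB] : forall i, exists B, measurable B /\ (i \in s -> g i = \1_B).
    move=> i; case: (boolP (i \in s)) => [/Cg[B mB ->]|_]; first by exists B.
    by exists setT.
  have mB i : measurable (B i) by case: (HB i).
  have gE i : i \in s -> g i = \1_(B i) by case: (HB i).
  apply: EFin_inj; transitivity (P (\big[setI/setT]_(i <- s) (X i @^-1` B i))).
    rewrite -Rintegral_prod_indic//; congr EFin; apply: eq_Rintegral => w _.
    by apply: eq_big_seq => i /gE ->.
  rewrite indX// -prodEFin; apply: eq_big_seq => i /gE ->.
  by rewrite Rintegral_indic_comp.
Qed.

(** Here the class to be extended consists of e^{-nx} with n a natural number; that these determine
    a law is [expectation_mul_Laplace]. *)
Lemma mutually_independent_of_Laplace : (forall i w, 0 <= X i w) ->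
  (forall (s : seq I) (a : I -> R), uniq s -> (forall i, 0 <= a i) ->
    \int[P]_w (\prod_(i <- s) expR (- (a i * X i w))) =
    \prod_(i <- s) \int[P]_w expR (- (a i * X i w))) ->
  mutually_independent P X.
Proof.
move=> X0 LX; apply/mutually_independentP.
pose e (n : nat) := @exp_pos R n%:R.
have eX n i w : e n (X i w) = expR (- (n%:R * X i w)).
  by rewrite /e /exp_pos max_l.
apply: (@product_rule_extend (range e)).
- by move=> _ [n _ <-]; exact: unit_exp_pos.
- move=> i W uW WC f uf; apply: expectation_mul_Laplace => // n.
  transitivity (\int[P]_w (W w * e n (X i w))).
    by apply: eq_Rintegral => w _; rewrite eX.
  rewrite WC; last by exists n.
  by congr (_ * _); apply: eq_Rintegral => w _; rewrite eX.
- move=> s g us Cg.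
  have /choice[n gE] : forall i, exists n, i \in s -> g i = e n.
    move=> i; case: (boolP (i \in s)) => [/Cg[n _ <-]|_]; first by exists n.
    by exists 0%N.
  transitivity (\int[P]_w (\prod_(i <- s) expR (- ((n i)%:R * X i w)))).
    apply: eq_Rintegral => w _; apply: eq_big_seq => i /gE ->; exact: eX.
  rewrite LX//; apply: eq_big_seq => i /gE ->.
  by apply: eq_Rintegral => w _; rewrite eX.
Qed.

End ProductExpectation.

(** * Transition probabilities of the queue *)

Section Esum.
Context (R : realType) (T : choiceType).

Lemma sum_le_esum (A : set T) (s : seq T) (f : T -> \bar R) :
  uniq s -> (forall y, y \in s -> A y) -> (\sum_(y <- s) f y <= \esum_(y in A) f y)%E.
Proof.
move=> us sA; apply: esum_ge; exists [set` s].
  by split; [exact: finite_seq|move=> y /sA].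
by rewrite fsbig_seq.
Qed.


End Esum.

Section TransitionBounds.
Context (R : realType) (S : countType) (rate : S -> S -> R) (p : R -> S -> S -> R).
Hypothesis tp : transition_function rate p.

Let p_ge0 := transition_ge0 tp.

(** Keeping finitely many intermediate states gives lower bounds only. That is enough: upper bounds
    will follow from the total mass 1. *)
Lemma Chapman_Kolmogorov_ge (s : seq S) u t x y : uniq s -> 0 <= u -> 0 <= t ->
  \sum_(z <- s) p u x z * p t z y <= p (u + t) x y.
Proof.
move=> us u0 t0; rewrite -lee_fin -(transition_Chapman_Kolmogorov tp)// -sumEFin.
exact: sum_le_esum.
Qed.

Lemma transition_le1 t x y : 0 <= t -> p t x y <= 1.
Proof.
move=> t0; rewrite -lee_fin -(transition_sum1 tp x t0).
have := @sum_le_esum R S setT [:: y] (fun y => (p t x y)%:E) isT (fun _ _ => Logic.I).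
by rewrite big_seq1.
Qed.

Lemma cvg_div_succ (t : R) (f : R -> R) (l : R) : 0 < t ->
  f h @[h --> 0^'+] --> l -> f (t / n.+1%:R) @[n --> \oo] --> l.
Proof.
move=> t0 /cvg_at_rightP; apply; split; first by move=> n; rewrite divr_gt0.
rewrite -(mulr0 t); apply: cvgM; [exact: cvg_cst|exact: cvg_harmonic].
Qed.

Lemma transition_diag_expr d n x : 0 <= d -> p d x x ^+ n <= p (n%:R * d) x x.
Proof.
move=> d0; elim: n => [|n ih].
  by rewrite mul0r (transition_start tp) eqxx expr0.
rewrite exprSr -natr1 mulrDl mul1r.
apply: le_trans (@Chapman_Kolmogorov_ge [:: x] _ _ _ _ isT (mulr_ge0 (ler0n _ _) d0) d0).
by rewrite big_seq1 ler_wpM2r// p_ge0.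
Qed.

(** Cut t into n + 1 pieces u and stay in x throughout: p u x x ^ (n+1) >= 1 - (n+1)(1 - p u x x) by
    Bernoulli, and the right side tends to 1 - q t, q being the exit rate. A derivative at 0 becomes
    a bound for all t. *)
Lemma transition_diag_ge t x : 0 <= t -> 1 - exit_rate rate x * t <= p t x x.
Proof.
rewrite le_eqVlt => /predU1P[<-|t0].
  by rewrite mulr0 subr0 (transition_start tp) eqxx.
pose u n : R := t / n.+1%:R.
have u0 n : 0 <= u n by rewrite divr_ge0// ltW.
have cu : 1 - t * ((1 - p (u n) x x) / u n) @[n --> \oo] -->
    1 - t * exit_rate rate x.
  apply: cvgB; first exact: cvg_cst.
  apply: cvgM; first exact: cvg_cst.
  exact: (@cvg_div_succ t (fun h => (1 - p h x x) / h) _ t0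
    (@transition_exit_rate _ _ _ _ tp x)).
rewrite mulrC -(cvg_lim _ cu)//; apply: limr_le; first by apply/cvg_ex; eexists; exact: cu.
apply: nearW => n.
have -> : t = n.+1%:R * u n by rewrite mulrC divfK.
apply: le_trans (transition_diag_expr n.+1 x (u0 n)).
have := @Bernoulli_ineq R (1 - p (u n) x x) n.+1.
rewrite subr_ge0 transition_le1// lerBlDr lerDl p_ge0// subKr => /(_ isT).
apply: le_trans; rewrite lerD2l lerN2 le_eqVlt; apply/orP; left; apply/eqP.
by field; rewrite /u mulf_neq0 ?invr_eq0// ?gt_eqF.
Qed.

(** Cut t into n + 1 pieces and jump from x to y in exactly one of them, staying put before and
    after. The induction on the number j of pieces splits off the last one: the jump happens there,
    or it has happened already. [L] controls the leaving of both states. *)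
Lemma transition_offdiag_ge t x y L : 0 <= t -> x != y ->
  exit_rate rate x <= L -> exit_rate rate y <= L -> 0 <= L -> L * t <= 1 ->
  rate x y * t * (1 - L * t) <= p t x y.
Proof.
move=> t0 xy xL yL L0 Lt; move: (t0); rewrite le_eqVlt => /predU1P[<-|tp0].
  by rewrite mulr0 mul0r p_ge0.
pose u n : R := t / n.+1%:R.
have u0 n : 0 <= u n by rewrite divr_ge0// ltW.
have key n j : (j <= n.+1)%N ->
    j%:R * p (u n) x y * (1 - L * (j%:R * u n)) <= p (j%:R * u n) x y.
  elim: j => [|j ih] jn; first by rewrite mul0r mul0r p_ge0// mul0r.
  have ju : 0 <= j%:R * u n by rewrite mulr_ge0.
  have jt : L * (j%:R * u n + u n) <= 1.
    apply: le_trans Lt; rewrite ler_wpM2l// -[X in _ + X]mul1r -mulrDl natr1 /u.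
    by rewrite mulrCA ler_piMr ?(ltW tp0)// ler_pdivrMr// mul1r ler_nat.
  rewrite -natr1 !mulrDl mul1r.
  apply: le_trans (@Chapman_Kolmogorov_ge [:: x; y] _ _ _ _ _ ju (u0 n)); last first.
    by rewrite /= inE xy.
  rewrite big_cons big_seq1.
  have dx : 1 - L * (j%:R * u n) <= p (j%:R * u n) x x.
    apply: le_trans (transition_diag_ge x ju).
    by rewrite lerD2l lerN2 ler_wpM2r.
  have dy : 1 - L * u n <= p (u n) y y.
    apply: le_trans (transition_diag_ge y (u0 n)).
    by rewrite lerD2l lerN2 ler_wpM2r.
  have r0 : 0 <= p (u n) x y by exact: p_ge0.
  have {}ih := ih (ltnW jn).
  have Lu : 0 <= L * u n by rewrite mulr_ge0.
  have Lju : 0 <= L * (j%:R * u n) by rewrite mulr_ge0.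
  have h1 : (1 - L * (j%:R * u n)) * p (u n) x y <=
      p (j%:R * u n) x x * p (u n) x y by rewrite ler_wpM2r.
  have h2 : j%:R * p (u n) x y * (1 - L * (j%:R * u n)) * (1 - L * u n) <=
      p (j%:R * u n) x y * p (u n) y y.
    apply: ler_pM => //; last by move: jt; rewrite mulrDr; lra.
    by rewrite !mulr_ge0//; move: jt; rewrite mulrDr; lra.
  apply: le_trans (lerD h1 h2).
  move: jt Lu Lju r0; rewrite mulrDr.
  set a := L * (j%:R * u n); set b := L * u n; set r := p (u n) x y => jt b0 a0 r0.
  have h3 : 0 <= j%:R * r * (a * b) by rewrite !mulr_ge0.
  have h4 : 0 <= r * b by rewrite mulr_ge0.
  by move: h3 h4; nra.
have cu : p (u n) x y / u n * (t * (1 - L * t)) @[n --> \oo] -->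
    rate x y * (t * (1 - L * t)).
  apply: cvgM; last exact: cvg_cst.
  exact: (@cvg_div_succ t (fun h => p h x y / h) _ tp0 (transition_rate tp xy)).
rewrite -mulrA -(cvg_lim _ cu)//; apply: limr_le; first by apply/cvg_ex; eexists; exact: cu.
apply: nearW => n; have := key n n.+1 (leqnn _).
have -> : n.+1%:R * u n = t by rewrite mulrC divfK.
apply: le_trans; rewrite mulrA ler_wpM2r ?subr_ge0//.
rewrite /u invf_div mulrCA mulrA divfK ?gt_eqF//.
Qed.

End TransitionBounds.

Lemma esum_indic_le (R : realType) (T : choiceType) (A : set T) (c : R)
    (Q : pred T) : 0 <= c -> (forall y z, Q y -> Q z -> y = z) ->
  (\esum_(y in A) (c * (Q y)%:R)%:E <= c%:E)%E.
Proof.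
move=> c0 Q1; have f0 y : (0 <= (c * (Q y)%:R)%:E)%E by rewrite lee_fin mulr_ge0.
have [[z Qz]|nQ] := pselect (exists z, Q z); last first.
  rewrite esum1 ?lee_fin// => y _; case: (boolP (Q y)) => [Qy|_]; last by rewrite mulr0.
  by case: nQ; exists y.
rewrite (esumID [set z])// [X in (_ + X)%E]esum1 ?adde0; last first.
  move=> y [_ /= yz]; case: (boolP (Q y)) => [Qy|_]; last by rewrite mulr0.
  by case: yz; exact: Q1.
rewrite esum_mkcondl esum_set1; last by case: ifP.
by case: ifP; rewrite ?Qz ?mulr1 ?lee_fin.
Qed.

Section QueueTransitions.
Context (R : realType) (lambda mu : R) (k : nat).
Hypotheses (lambda_gt0 : 0 < lambda) (mu_gt0 : 0 < mu) (k_ge1 : (1 <= k)%N).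

Let kmu : R := k%:R * mu.
Let L : R := lambda + kmu.

Let kmu_ge0 : 0 <= kmu. Proof. by rewrite mulr_ge0// ltW. Qed.

Implicit Types x y : queue_state k.

Definition arrival_target (v : nat * nat) : nat * nat :=
  if v.1 == 0%N then (1, k)%N else (v.1.+1, v.2).

Definition service_target (v : nat * nat) : nat * nat :=
  if (2 <= v.2)%N then (v.1, v.2.-1)
  else if (2 <= v.1)%N then (v.1.-1, k) else (0, 0)%N.

Lemma queue_rateE x y : queue_rate lambda mu x y =
  lambda * (val y == arrival_target (val x))%:R +
  kmu * ((val x).1 != 0%N)%:R * (val y == service_target (val x))%:R.
Proof.
rewrite /queue_rate /arrival_target /service_target.
case: (val x) => [[|n] s] //=; first by rewrite mulr0 mul0r addr0.
by rewrite mulr1.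
Qed.

Lemma arrival_targetP x : exists2 y : queue_state k, val y = arrival_target (val x) &
  (number_in_system x < number_in_system y)%N.
Proof.
have vP : queue_state_pred k (arrival_target (val x)).
  have := valP x; rewrite /queue_state_pred /arrival_target.
  case: (val x) => [[|n] s] /=; first by rewrite k_ge1 leqnn.
  by [].
exists (exist (fun v => queue_state_pred k v) _ vP) => //.
rewrite /number_in_system/= /arrival_target.
by case: (val x) => [[|n] s].
Qed.

Lemma service_targetP x : (val x).1 != 0%N ->
  exists2 y : queue_state k, val y = service_target (val x) &
  [/\ (number_in_system y <= number_in_system x)%N, x != y &
   arrival_target (val x) != val y].
Proof.
move=> x0; have vP : queue_state_pred k (service_target (val x)).
  have := valP x; rewrite /queue_state_pred /service_target.
  case: (val x) x0 => [[|n] s] //= _; move=> /andP[s1 sk].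
  case: ifP => s2 /=; first by lia.
  by case: ifP => n2 /=; rewrite ?k_ge1 ?leqnn; lia.
have H (v : nat * nat) : queue_state_pred k v -> v.1 != 0%N ->
    [/\ ((service_target v).1 <= v.1)%N, v != service_target v &
     arrival_target v != service_target v].
  rewrite /queue_state_pred /service_target /arrival_target.
  case: v => [[|n] s] //= => /andP[s1 sk] _; case: ifP => s2 /=.
    by split; rewrite ?xpair_eqE; lia.
  by case: ifP => n2 /=; split; rewrite ?xpair_eqE; lia.
exists (exist (fun v => queue_state_pred k v) _ vP) => //.
exact: (H _ (valP x) x0).
Qed.

(** An upper bound suffices, as exit rates enter only through lower bounds on transition
    probabilities. In the empty system it has to be lambda alone, since no downward move is there to
    compensate for more. *)
Lemma exit_rate_queue_le x :
  exit_rate (@queue_rate R lambda mu k) x <= lambda + kmu * ((val x).1 != 0%N)%:R.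
Proof.
have k0 : 0 <= kmu * ((val x).1 != 0%N)%:R by rewrite mulr_ge0.
have e0 y : (0 <= (queue_rate lambda mu x y)%:E)%E.
  by rewrite queue_rateE lee_fin addr_ge0// mulr_ge0// ltW.
have : (\esum_(y in [set~ x]) (queue_rate lambda mu x y)%:E <=
    (lambda + kmu * ((val x).1 != 0%N)%:R)%:E)%E.
  under eq_esum do rewrite queue_rateE EFinD.
  rewrite esumD; last 2 first.
  - by move=> y _; rewrite lee_fin mulr_ge0// ltW.
  - by move=> y _; rewrite lee_fin mulr_ge0.
  rewrite EFinD; apply: leeD; apply: esum_indic_le => //; first exact: ltW.
  - by move=> y z /eqP yx /eqP zx; apply: val_inj; rewrite yx.
  - by move=> y z /eqP yx /eqP zx; apply: val_inj; rewrite yx.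
rewrite /exit_rate; have := @esum_ge0 R _ [set~ x]
  (fun y => (queue_rate lambda mu x y)%:E) (fun y _ => e0 y).
by case: (esum _ _) => [r| |]//=; rewrite lee_fin.
Qed.

Variable p : R -> queue_state k -> queue_state k -> R.
Hypothesis tp : transition_function (@queue_rate R lambda mu k) p.

(* The supermultiplicativity of p makes the first-order expansion uniform in
   the state. *)
Lemma upward_probability h x : 0 <= h -> L * h <= 1 ->
  ((lambda * h - (L * h) ^+ 2)%:E <=
    \esum_(y in [set y : queue_state k | (number_in_system x < number_in_system y)%N])
      (p h x y)%:E <= (lambda * h + (L * h) ^+ 2)%:E)%E.
Proof.
move=> h0 Lh; have L0 : 0 <= L by rewrite addr_ge0// ltW.
have p0 y : (0 <= (p h x y)%:E)%E by rewrite lee_fin (transition_ge0 tp).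
have qL y : exit_rate (@queue_rate R lambda mu k) y <= L.
  apply: (le_trans (exit_rate_queue_le y)); rewrite /L lerD2l.
  by rewrite ler_piMr//; case: (_ != _).
have lamL : lambda <= L by rewrite lerDl.
have Lh0 : 0 <= L * h by rewrite mulr_ge0.
apply/andP; split.
  have [y vy Ny] := arrival_targetP x.
  have xy : x != y by apply/eqP => e; rewrite e ltnn in Ny.
  have := transition_offdiag_ge tp h0 xy (qL x) (qL y) L0 Lh.
  rewrite queue_rateE vy eqxx mulr1 => lo.
  apply: (@le_trans _ _ (p h x y)%:E); last first.
    have := @sum_le_esum R _
      [set y : queue_state k | (number_in_system x < number_in_system y)%N]
      [:: y] (fun y => (p h x y)%:E) isT.
    by rewrite big_seq1; apply=> z; rewrite inE => /eqP ->.
  rewrite lee_fin; apply: le_trans lo.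
  set c := kmu * _ * _; have c0 : 0 <= c by rewrite mulr_ge0// mulr_ge0.
  have : lambda * h * (1 - L * h) <= (lambda + c) * h * (1 - L * h).
    by rewrite ler_wpM2r ?subr_ge0// ler_wpM2r// lerDl.
  apply: le_trans; rewrite mulrBr mulr1 lerD2l lerN2 expr2.
  by rewrite ler_wpM2r// ler_wpM2r.
(* Upper bound by complement: the upward mass is 1 - V, and V is bounded below by the mass of one or
   two states that are not up. *)
have := transition_sum1 tp x h0.
rewrite (@esumID R _
  [set y : queue_state k | (number_in_system x < number_in_system y)%N] setT)//.
rewrite !setTI.
set U := esum _ _; set V := esum _ _ => UV.
have U0 : (0 <= U)%E by exact: esum_ge0.
have V0 : (0 <= V)%E by exact: esum_ge0.
move: UV U0 V0; case eU: U => [u| |]//; case eV: V => [v| |]//.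
move=> [uv] _ _; rewrite lee_fin.
have -> : u = 1 - v by rewrite -uv addrK.
(* In the empty system staying already has mass 1 - lambda h. Otherwise the service target
   contributes kmu h (1 - L h), which restores the kmu h lost from staying up to (L h)^2. *)
have [x0|x0] := eqVneq (val x).1 0%N.
  have : (\sum_(y <- [:: x]) (p h x y)%:E <= V)%E.
    by apply: sum_le_esum => // y; rewrite inE => /eqP -> /=; rewrite ltnn.
  rewrite eV big_seq1 lee_fin.
  have := transition_diag_ge tp x h0; have := exit_rate_queue_le x.
  rewrite x0 eqxx mulr0 addr0 => /(ler_wpM2r h0).
  have := sqr_ge0 (L * h); lra.
have [y vy [Ny xy uy]] := service_targetP x0.
have : (\sum_(y <- [:: x; y]) (p h x y)%:E <= V)%E.
  apply: sum_le_esum; first by rewrite /= inE xy.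
  by move=> z; rewrite !inE => /orP[] /eqP -> /=; apply/negP; rewrite -leqNgt.
rewrite eV big_cons big_seq1 -EFinD lee_fin.
have := transition_offdiag_ge tp h0 xy (qL x) (qL y) L0 Lh.
rewrite queue_rateE vy eqxx x0 mulr1 -vy eq_sym (negbTE uy) mulr0 add0r mulr1.
have := transition_diag_ge tp x h0; have /(ler_wpM2r h0) := exit_rate_queue_le x.
rewrite x0 mulr1 => h1 h2 h3 h4; rewrite mulrDl in h1.
have h5 : kmu * h * (L * h) <= (L * h) ^+ 2.
  by rewrite expr2 ler_wpM2r// ler_wpM2r// lerDr ltW.
move: h3; rewrite mulrBr mulr1 => h3; lra.
Qed.

End QueueTransitions.

(** * Arrival patterns on a grid *)

Lemma ge0_esumZl (R : realType) (T : choiceType) (A : set T) (c : R)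
    (f : T -> \bar R) : 0 <= c -> (forall y, (0 <= f y)%E) ->
  (\esum_(y in A) (c%:E * f y) = c%:E * \esum_(y in A) f y)%E.
Proof.
have le_scale (k : R) (g : T -> \bar R) : 0 <= k -> (forall y, (0 <= g y)%E) ->
    (\esum_(y in A) (k%:E * g y) <= k%:E * \esum_(y in A) g y)%E.
  move=> k0 g0; apply: ge_ereal_sup => _ [X [finX XA] <-].
  rewrite -ge0_mule_fsumr//.
  by apply: lee_wpmul2l => //; apply: esum_ge; exists X.
move=> c0 f0; apply/eqP; rewrite eq_le le_scale//=.
have [->|cn] := eqVneq c 0.
  by rewrite mul0e; apply: esum_ge0 => y _; rewrite mul0e.
have cf0 y : (0 <= c%:E * f y)%E by rewrite mule_ge0.
have ci0 : 0 <= c^-1 by rewrite invr_ge0.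
have := le_scale c^-1 (fun y => c%:E * f y)%E ci0 cf0.
move=> /(lee_wpmul2l (c0 : (0 <= c%:E)%E)).
rewrite muleA -EFinM divff// mul1e; apply: le_trans.
rewrite lee_wpmul2l//; apply: le_esum => y _.
by rewrite muleA -EFinM mulVf// mul1e.
Qed.

(** Numbering the fibers by [pickle] reduces this to countable additivity over the integers; codes
    of no element give empty sets. *)
Lemma measure_esum_fiber d (T : measurableType d) (R : realType)
    (P : {measure set T -> \bar R}) (C : countType) (f : T -> C) (A : set T) :
  measurable A -> (forall c, measurable (f @^-1` [set c])) ->
  P A = \esum_(c in [set: C]) P (A `&` f @^-1` [set c]).
Proof.
move=> mA mf; pose F n := A `&` [set w | pickle (f w) = n].
have FE c : F (pickle c) = A `&` f @^-1` [set c].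
  by apply/seteqP; split => w [Aw] /= e; split=> //=; [exact: (pcan_inj pickleK)|rewrite e].
have mF n : measurable (F n).
  have [[c <-]|nc] := pselect (exists c : C, pickle c = n).
    by rewrite FE; exact: measurableI.
  rewrite (_ : F n = set0)//; apply/seteqP; split => // w [_ /= e].
  by apply: nc; exists (f w).
have -> : P A = P (\bigcup_n F n).
  congr (P _); apply/seteqP; split => [w Aw|w [n _ []]//].
  by exists (pickle (f w)).
rewrite measure_bigcup//; last first.
  apply/trivIsetP => i j _ _ ij; apply/seteqP; split => // w [[_ /= ei] [_ /= ej]].
  by move: ij; rewrite -ei -ej eqxx.
transitivity (\esum_(n in [set: nat]) P (F n)).
  by rewrite nneseries_esum// set_mem_set.
rewrite (esumID (range (@pickle C)))//.
rewrite [X in (_ + X)%E]esum1 ?adde0; last first.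
  move=> n [_ /= nr]; rewrite (_ : F n = set0) ?measure0//.
  apply/seteqP; split => // w [_ /= e]; apply: nr.
  by exists (f w).
rewrite setTI esum_image; last by move=> c e _ _; exact: (pcan_inj pickleK).
by apply: eq_esum => c _; rewrite FE.
Qed.

Section MarkovPatterns.
Context d (Omega : measurableType d) (R : realType) (P : probability Omega R).
Context (S : countType) (X : nat -> Omega -> S) (N : S -> nat)
  (trans : S -> S -> R).
Hypotheses (mX : forall i x, measurable (X i @^-1` [set x]))
  (trans_ge0 : forall x y, 0 <= trans x y)
  (markovX : forall n (x : nat -> S),
    (P (\bigcap_(i in `I_n.+2) (X i @^-1` [set x i])) =
     P (\bigcap_(i in `I_n.+1) (X i @^-1` [set x i])) *
     (trans (x n) (x n.+1))%:E)%E).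

(** Only the two ends of a cell are compared, so several arrivals, or an arrival offset by a
    departure, may be miscounted. In probability this costs O(h^2), and along a path it disappears
    once the mesh is small. *)
Definition jump (j : nat) (w : Omega) : bool := (N (X j w) < N (X j.+1 w))%N.

Definition pattern (n : nat) (w : Omega) : seq bool := mkseq (jump ^~ w) n.

Definition pattern_event (u : seq bool) : set Omega :=
  [set w | pattern (size u) w = u].

Let path n (w : Omega) : n.+1.-tuple S := [tuple X i w | i < n.+1].

(** The Markov rule wants a sequence of states indexed by all integers: the recorded path up to time
    n, then the candidate y for time n + 1. *)
Let tuple_path n (xs : n.+1.-tuple S) (y : S) (i : nat) : S :=
  if (i <= n)%N then tnth xs (inord i) else y.

Let path_fiber n xs y : path n @^-1` [set xs] =
  \bigcap_(i in `I_n.+1) (X i @^-1` [set tuple_path xs y i]).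
Proof.
apply/seteqP; split => w /=.
  move=> <- i /=; rewrite ltnS /tuple_path => ilen; rewrite ilen tnth_mktuple.
  by rewrite inordK.
move=> h; apply/eq_from_tnth => i; rewrite tnth_mktuple.
have := h i (ltn_ord i); rewrite /= /tuple_path -ltnS ltn_ord => ->.
by rewrite inord_val.
Qed.

Let measurable_path n xs : measurable (path n @^-1` [set xs]).
Proof.
by rewrite (path_fiber xs (tnth xs ord0)); apply: bigcap_measurable => //; exists 0%N.
Qed.

Lemma measurable_preimage_countable i (B : set S) : measurable (X i @^-1` B).
Proof.
rewrite (_ : _ @^-1` _ = \bigcup_(n in [set n | exists2 x, B x & pickle x = n])
   [set w | pickle (X i w) = n]).
  apply: bigcup_measurable => n [x Bx <-].
  rewrite (_ : [set _ | _] = X i @^-1` [set x])//.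
  by apply/seteqP; split => w /=; [exact: (pcan_inj pickleK)|move=> ->].
apply/seteqP; split => [w /= Bw|w [n [x Bx <-]] /= /(pcan_inj pickleK) ->//].
by exists (pickle (X i w)) => //; exists (X i w).
Qed.

Lemma measurable_jump j : measurable [set w | jump j w].
Proof.
rewrite (_ : [set _ | _] = \bigcup_n ((X j @^-1` [set x | N x = n]) `&`
   (X j.+1 @^-1` [set x | (n < N x)%N]))).
  by apply: bigcupT_measurable => n; apply: measurableI;
    exact: measurable_preimage_countable.
apply/seteqP; split => [w /= jw|w [n _ [/= <-]]//].
by exists (N (X j w)).
Qed.

Lemma pattern_event_rcons u b : pattern_event (rcons u b) =
  pattern_event u `&` [set w | jump (size u) w = b].
Proof.
rewrite /pattern_event size_rcons; apply/seteqP; split => w /=.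
  by rewrite /pattern mkseqS => /rcons_inj[].
by rewrite /pattern mkseqS => -[-> ->].
Qed.

Lemma pattern_event_nil : pattern_event [::] = setT.
Proof. by apply/seteqP; split. Qed.

Lemma measurable_pattern_event u : measurable (pattern_event u).
Proof.
elim/last_ind: u => [|u b ih]; first by rewrite pattern_event_nil.
rewrite pattern_event_rcons; apply: measurableI => //.
case: b; first exact: measurable_jump.
rewrite (_ : [set _ | _] = ~` [set w | jump (size u) w]).
  by apply: measurableC; exact: measurable_jump.
by apply/seteqP; split => w /=; [move=> ->|move/negP/negbTE].
Qed.

Variables (a b : R).
Hypothesis up_bounds : forall x,
  (a%:E <= \esum_(y in [set y | (N x < N y)%N]) (trans x y)%:E <= b%:E)%E.

(** On a fiber the state at time n is known, so the Markov rule applies to each value y of the next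
    state; summing over the higher y gives the claim. *)
Let fiber_jump n xs :
  (P (path n @^-1` [set xs] `&` [set w | jump n w]) =
   P (path n @^-1` [set xs]) *
   \esum_(y in [set y | (N (tnth xs ord_max) < N y)%N]) (trans (tnth xs ord_max) y)%:E)%E.
Proof.
set A := path n @^-1` [set xs]; set xn := tnth xs ord_max.
have mA : measurable A by exact: measurable_path.
rewrite (measure_esum_fiber P (f := X n.+1)) //; last first.
  by apply: measurableI => //; exact: measurable_jump.
rewrite -[P A]fineK ?fin_num_measure// -ge0_esumZl ?fine_ge0//; last first.
  by move=> y; rewrite lee_fin.
rewrite [RHS]esum_mkcond; apply: eq_esum => y _.
have -> : (y \in [set y | (N xn < N y)%N]) = (N xn < N y)%N.
  by apply/idP/idP; rewrite inE.
have Xn w : A w -> X n w = xn.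
  by move=> Aw; rewrite /xn -[xs](Aw : path n w = xs) tnth_mktuple.
case: ifPn => Ny; last first.
  rewrite (_ : _ `&` _ = set0) ?measure0//; apply/seteqP; split => // w.
  by move=> [[/Xn Xw]]; rewrite /= /jump Xw => /[swap] ->; rewrite (negbTE Ny).
rewrite fineK ?fin_num_measure//.
have := markovX n (tuple_path xs y).
rewrite -path_fiber -/A {2 3}/tuple_path leqnn ltnn.
rewrite (_ : inord n = ord_max); last by apply: val_inj; rewrite /= inordK.
rewrite -/xn => <-; congr (P _); apply/seteqP; split => w.
  move=> [[Aw _] /= Xy] i /=; rewrite ltnS leq_eqVlt => /predU1P[->|].
    by rewrite /tuple_path ltnn.
  by move: Aw; rewrite /A (path_fiber xs y) => /(_ i).
move=> h; have Aw : A w.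
  by rewrite /A (path_fiber xs y) => i /= ?; apply: h => /=; exact: ltnW.
have /= Xy := h n.+1 (ltnSn _); rewrite /tuple_path ltnn in Xy.
by split => //; split => //; rewrite /= /jump (Xn _ Aw) Xy.
Qed.

(** A pattern does not determine the current state. It is a disjoint union of path fibers, however
    ([cp] reads the pattern off a path), and on each fiber the up-probability lies between [a] and
    [b], uniformly in the state. *)
Lemma pattern_event_bounds u : 0 <= a -> 0 <= b ->
  (a%:E * P (pattern_event u) <= P (pattern_event (rcons u true)) <=
   b%:E * P (pattern_event u))%E.
Proof.
move=> a0 b0; set n := size u.
pose cp (xs : n.+1.-tuple S) :=
  mkseq (fun j => N (tnth xs (inord j)) < N (tnth xs (inord j.+1)))%N n.
have patternA xs w : path n w = xs -> pattern n w = cp xs.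
  move=> <-; apply/eq_in_map => j; rewrite mem_iota add0n => /andP[_ jn].
  by rewrite /jump !tnth_mktuple !inordK// ltnS ltnW.
have fiberE xs : let A := path n @^-1` [set xs] in
    P (pattern_event u `&` A) = (if cp xs == u then P A else 0%E) /\
    P (pattern_event (rcons u true) `&` A) =
      (if cp xs == u then P (A `&` [set w | jump n w]) else 0%E).
  move=> A; case: eqP => [cu|cu]; last first.
    split; rewrite (_ : _ `&` _ = set0) ?measure0//; apply/seteqP; split => // w.
      by move=> [/= e Aw]; apply: cu; rewrite -(patternA _ _ Aw).
    by rewrite pattern_event_rcons => -[[/= e _] Aw]; apply: cu; rewrite -(patternA _ _ Aw).
  split; congr (P _); rewrite ?pattern_event_rcons; apply/seteqP; split => w.
  - by case.
  - by move=> Aw; split => //; rewrite /pattern_event/= (patternA _ _ Aw).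
  - by move=> [[_ jw] Aw].
  - by move=> [Aw jw]; split => //; split => //; rewrite /pattern_event/= (patternA _ _ Aw).
have key xs : let A := path n @^-1` [set xs] in
    (a%:E * P (pattern_event u `&` A) <= P (pattern_event (rcons u true) `&` A) <=
     b%:E * P (pattern_event u `&` A))%E.
  have [e1 e2] := fiberE xs; rewrite /= e1 e2; case: ifP => _; rewrite ?mule0 ?lexx//.
  have /andP[up1 up2] := up_bounds (tnth xs ord_max).
  rewrite fiber_jump [X in (X <= _ <= _)%E]muleC [X in (_ <= _ <= X)%E]muleC.
  by rewrite !lee_wpmul2l.
have mE v := measurable_pattern_event v.
rewrite (measure_esum_fiber P (mE u) (@measurable_path n)).
rewrite (measure_esum_fiber P (mE (rcons u true)) (@measurable_path n)).
rewrite -!ge0_esumZl//; apply/andP; split; apply: le_esum => xs _;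
  by have /andP[] := key xs.
Qed.

End MarkovPatterns.

(** * Sums over binary words and the discounted martingale *)

Section SumBits.
Variable R : realType.
Implicit Types f g m : seq bool -> R.

(** The recursion peels off the last bit, that is the latest cell, so that an induction on n
    conditions on the past. *)
Fixpoint sumbits (n : nat) (f : seq bool -> R) : R :=
  if n is n'.+1 then sumbits n' (fun u => f (rcons u true) + f (rcons u false))
  else f [::].

Lemma ler_sumbits n f g : (forall u, size u = n -> f u <= g u) ->
  sumbits n f <= sumbits n g.
Proof.
elim: n f g => [|n ih] f g fg /=; first exact: fg.
by apply: ih => u su; apply: lerD; apply: fg; rewrite size_rcons su.
Qed.

Lemma eq_sumbits n f g : (forall u, size u = n -> f u = g u) ->
  sumbits n f = sumbits n g.
Proof.
by move=> fg; apply/eqP; rewrite eq_le !ler_sumbits// => u su; rewrite fg.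
Qed.

Lemma sumbitsD n f g : sumbits n (fun u => f u + g u) = sumbits n f + sumbits n g.
Proof.
elim: n f g => [//|n ih] f g /=; rewrite -ih.
by apply: eq_sumbits => u _; rewrite addrACA.
Qed.

Lemma sumbitsZ n (c : R) f : sumbits n (fun u => c * f u) = c * sumbits n f.
Proof.
by elim: n f => [//|n ih] f /=; rewrite -ih; apply: eq_sumbits => u _; rewrite mulrDr.
Qed.

Lemma ler_norm_sumbits n f : `|sumbits n f| <= sumbits n (fun u => `|f u|).
Proof.
elim: n f => [//|n ih] f /=; apply: (le_trans (ih _)).
by apply: ler_sumbits => u _; exact: ler_normD.
Qed.

Lemma sumbits_additive n m : (forall u, m (rcons u true) + m (rcons u false) = m u) ->
  sumbits n m = m [::].
Proof.
by move=> mD; elim: n => [//|n ih] /=; rewrite -ih; apply: eq_sumbits.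
Qed.

End SumBits.

Section BitRecursion.
Context (R : realType) (m : seq bool -> R) (al ep : R).
Hypotheses (m_ge0 : forall u, 0 <= m u) (m_nil : m [::] = 1)
  (mD : forall u, m (rcons u true) + m (rcons u false) = m u)
  (m_true : forall u, `|m (rcons u true) - al * m u| <= ep * m u).

Notation cnt := (count id).

Lemma cnt_rcons u b : cnt (rcons u b) = (cnt u + b)%N.
Proof. by rewrite -cats1 count_cat/= addn0. Qed.

(** The count for cell j includes cell j itself ([take j.+1]): a cell with an arrival is charged to
    the next interarrival time. *)
Definition weight (f : nat -> nat -> R) (u : seq bool) : R :=
  \prod_(j < size u) f (cnt (take j.+1 u)) j.

Lemma weight_rcons f u b :
  weight f (rcons u b) = weight f u * f (cnt u + b)%N (size u).
Proof.
rewrite /weight size_rcons big_ord_recr/=; congr (_ * _).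
  apply: eq_bigr => j _; congr f; congr cnt.
  by rewrite -cats1 takel_cat.
by rewrite take_oversize ?size_rcons// cnt_rcons.
Qed.

Lemma weight_ge0 f u : (forall c j, 0 <= f c j) -> 0 <= weight f u.
Proof. by move=> f0; apply: prodr_ge0. Qed.

Lemma weight_le1 f u : (forall c j, 0 <= f c j <= 1) -> weight f u <= 1.
Proof. by move=> f01; apply: prodr_ile1 => j _. Qed.

(** This is the expectation of 2^(- number of arrivals). Each cell multiplies it by at most 1 - (al
    - ep) / 2, because an arrival of conditional probability at least al - ep halves it. *)
Lemma sumbits_half n : 0 <= al - ep <= 1 ->
  sumbits n (fun u => m u * 2^-1 ^+ cnt u) <= (1 - (al - ep) / 2) ^+ n.
Proof.
move=> /andP[d0 d1]; elim: n => [|n ih] /=.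
  by rewrite m_nil mul1r !expr0.
rewrite exprS; apply: le_trans (ler_wpM2l _ ih); last by lra.
rewrite -sumbitsZ; apply: ler_sumbits => u _.
rewrite !cnt_rcons addn0 addn1 exprS.
have h : (al - ep) * m u <= m (rcons u true).
  by have := m_true u; rewrite ler_norml => /andP[+ _]; lra.
set e := _ ^+ _; have e0 : 0 <= e by rewrite exprn_ge0.
have -> : m (rcons u false) = m u - m (rcons u true) by rewrite -(mD u) addrAC subrr add0r.
rewrite [leLHS](_ : _ = (m u - m (rcons u true) / 2) * e); last by field.
by rewrite mulrA ler_wpM2r//; lra.
Qed.

Variables (lam h A : R) (a psi : nat -> R).
Hypotheses (lam_ge0 : 0 <= lam) (h_ge0 : 0 <= h) (alE : al = lam * h)
  (a_itv : forall c, 0 <= a c <= A) (psi_itv : forall c, 0 <= psi c <= 1)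
  (psiS : forall c, lam * psi c.+1 = (lam + a c) * psi c).

Let disc (c _ : nat) : R := expR (- (h * a c)).

Lemma expR_quadratic (x : R) : 0 <= x -> 1 - x <= expR (- x) <= 1 - x + x ^+ 2.
Proof.
move=> x0; rewrite expR_ge1Dx/= expRN.
have x1 : 0 < 1 + x by rewrite ltr_wpDr.
apply: (@le_trans _ _ (1 + x)^-1).
  by rewrite lef_pV2 ?posrE ?expR_gt0// expR_ge1Dx.
rewrite -div1r ler_pdivrMr// (_ : _ * _ = 1 + x ^+ 3); last by ring.
by rewrite lerDl exprn_ge0.
Qed.

Let C := lam * A + A ^+ 2.

(** By [psiS] the first-order part lam h (psi(c+1) - psi(c)) - h a(c) psi(c) vanishes. Left over are
    lam h * h A from discounting in the jump term, (h A)^2 from expanding the exponential, and [ep]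
    from the deviation [rho]; the first two make up C h^2. *)
Let one_step c rho : `|rho| <= ep ->
  `|(al + rho) * (disc c.+1 0 * psi c.+1) + (1 - (al + rho)) * (disc c 0 * psi c)
     - psi c| <= C * h ^+ 2 + ep.
Proof.
move=> rho_ep; have ha i : 0 <= h * a i <= h * A.
  by have /andP[? ?] := a_itv i; rewrite mulr_ge0//= ler_wpM2l.
have E i : [/\ 1 - h * a i <= disc i 0, disc i 0 <= 1 - h * a i + (h * a i) ^+ 2,
    0 <= disc i 0 & disc i 0 <= 1].
  have /andP[h0 _] := ha i; have /andP[? ?] := expR_quadratic h0.
  by split=> //; rewrite ?expR_ge0// expR_le1 oppr_le0.
rewrite alE; move: (E c) (E c.+1) (ha c) (ha c.+1) (psi_itv c) (psi_itv c.+1) (psiS c).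
set e := disc c 0; set e' := disc c.+1 0; set p := psi c; set p' := psi c.+1.
set x := h * a c; set x' := h * a c.+1.
move=> [e1 e2 e3 e4] [f1 f2 f3 f4] /andP[x0 xA] /andP[x0' xA'] /andP[p0 p1] /andP[q0 q1] ps.
have -> : (lam * h + rho) * (e' * p') + (1 - (lam * h + rho)) * (e * p) - p =
    lam * h * ((1 - e) * p - (1 - e') * p') + (e - 1 + x) * p + rho * (e' * p' - e * p).
  have : lam * h * p' = lam * h * p + x * p.
    by rewrite mulrAC ps /x; ring.
  move=> H; rewrite [LHS](_ : _ = lam * h * p' - lam * h * p - x * p +
    (lam * h * ((1 - e) * p - (1 - e') * p') + (e - 1 + x) * p +
     rho * (e' * p' - e * p))); last by ring.
  by rewrite H; ring.
have hA0 : 0 <= h * A by apply: le_trans xA.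
have b1 : `|lam * h * ((1 - e) * p - (1 - e') * p')| <= lam * h * (h * A).
  rewrite normrM (ger0_norm (mulr_ge0 lam_ge0 h_ge0)) ler_wpM2l// ?mulr_ge0//.
  have g1 : 0 <= (1 - e) * p <= h * A.
    rewrite mulr_ge0 ?subr_ge0//=; apply: (@le_trans _ _ (1 - e)); last by lra.
    by rewrite ler_piMr// subr_ge0.
  have g2 : 0 <= (1 - e') * p' <= h * A.
    rewrite mulr_ge0 ?subr_ge0//=; apply: (@le_trans _ _ (1 - e')); last by lra.
    by rewrite ler_piMr// subr_ge0.
  by rewrite ler_norml; move: g1 g2 => /andP[? ?] /andP[? ?]; apply/andP; split; lra.
have b2 : `|(e - 1 + x) * p| <= (h * A) ^+ 2.
  have k0 : 0 <= e - 1 + x by lra.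
  rewrite normrM (ger0_norm k0) (ger0_norm p0).
  apply: (@le_trans _ _ (e - 1 + x)); first by rewrite ler_piMr.
  apply: (@le_trans _ _ (x ^+ 2)); first by lra.
  by rewrite lerXn2r// nnegrE.
have b3 : `|rho * (e' * p' - e * p)| <= ep.
  rewrite normrM; apply: le_trans rho_ep; rewrite ler_piMr//.
  have g1 : 0 <= e' * p' <= 1 by rewrite mulr_ge0//= mulr_ile1.
  have g2 : 0 <= e * p <= 1 by rewrite mulr_ge0//= mulr_ile1.
  by rewrite ler_norml; move: g1 g2 => /andP[? ?] /andP[? ?]; apply/andP; split; lra.
apply: (le_trans (ler_normD _ _)).
apply: (@le_trans _ _ (lam * h * (h * A) + (h * A) ^+ 2 + ep)).
  by apply: lerD => //; apply: (le_trans (ler_normD _ _)); exact: lerD.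
by rewrite lerD2r /C le_eqVlt; apply/orP; left; apply/eqP; ring.
Qed.

(* [psiS] says that the discounted [psi] is a martingale for the Poisson
   process, whence an error of second order in [h] at each step. *)
Lemma sumbits_weight_psi n :
  `|sumbits n (fun u => m u * (weight disc u * psi (cnt u))) - psi 0| <=
  n%:R * (C * h ^+ 2 + ep).
Proof.
have disc_itv c j : 0 <= disc c j <= 1.
  have /andP[? ?] := a_itv c.
  by rewrite /disc expR_ge0 expR_le1 oppr_le0 mulr_ge0.
elim: n => [|n ih] /=.
  by rewrite m_nil mul1r /weight big_ord0 mul1r subrr normr0 mul0r.
rewrite -natr1 mulrDl mul1r.
set G := sumbits n (fun u => _ + _); set G' := sumbits n _ in ih.
rewrite (_ : G - psi 0 = (G' - psi 0) + (G - G')); last by ring.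
apply: (le_trans (ler_normD _ _)); apply: lerD => //.
rewrite /G /G' -[- sumbits _ _]mulN1r -sumbitsZ -sumbitsD.
apply: (le_trans (ler_norm_sumbits _ _)).
have S1 : sumbits n m = 1 by rewrite (sumbits_additive n mD).
rewrite -[leRHS]mulr1 -[X in _ <= _ * X]S1 -sumbitsZ.
apply: ler_sumbits => u _; rewrite !weight_rcons !cnt_rcons addn0 addn1.
(* A word of mass 0 has successors of mass 0 and contributes nothing. For the others [rho] is the
   deviation of the conditional up-probability from [al]. *)
have [mu0|mu0] := eqVneq (m u) 0.
  have mt : m (rcons u true) = 0.
    by have := m_true u; rewrite mu0 !mulr0 subr0 normr_le0 => /eqP.
  have mf : m (rcons u false) = 0 by have := mD u; rewrite mt mu0 add0r.
  by rewrite mt mf mu0 !mul0r mulr0 mulr0 !addr0 normr0.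
have mu1 : 0 < m u by rewrite lt0r mu0 m_ge0.
pose rho := (m (rcons u true) - al * m u) / m u.
have rho_ep : `|rho| <= ep.
  by rewrite normrM normfV (gtr0_norm mu1) ler_pdivrMr.
have mt : m (rcons u true) = (al + rho) * m u by rewrite /rho; field.
have mf : m (rcons u false) = (1 - (al + rho)) * m u.
  by rewrite mulrBl mul1r -mt -(mD u) addrAC subrr add0r.
have := one_step (cnt u) rho_ep; set X := (X in `|X| <= _) => X_le.
rewrite [X in `|X| <= _](_ : _ = weight disc u * (m u * X)); last first.
  rewrite mt mf /X /disc; ring.
rewrite normrM ger0_norm; last by apply: weight_ge0 => c j; case/andP: (disc_itv c j).
apply: (@le_trans _ _ `|m u * X|).
  by rewrite ler_piMl//; exact: weight_le1.
by rewrite normrM (gtr0_norm mu1) mulrC ler_wpM2r// ltW.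
Qed.

End BitRecursion.

(** * The subordinator along an arrival pattern *)

Section PatternExpectation.
Context d (Omega : measurableType d) (R : realType) (P : probability Omega R).
Context (S : countType) (X : nat -> Omega -> S) (N : S -> nat).
Hypothesis mX : forall i x, measurable (X i @^-1` [set x]).

Notation pat := (pattern X N).
Notation E_ := (pattern_event X N).

Lemma sumbits_pattern_event n (f : seq bool -> R) w :
  sumbits n (fun u => \1_(E_ u) w * f u) = f (pat n w).
Proof.
elim: n f => [|n ih] f /=.
  by rewrite pattern_event_nil indicE in_setT mul1r.
have ij b : \1_[set w | jump X N n w = b] w = (jump X N n w == b)%:R :> R.
  by rewrite indicE; congr (_%:R); congr nat_of_bool; apply/idP/eqP; rewrite inE.
transitivity (sumbits n (fun u => \1_(E_ u) w * f (rcons u (jump X N n w)))).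
  apply: eq_sumbits => u su; rewrite !pattern_event_rcons !indicI su /= !ij.
  by case: (jump X N n w) => /=; rewrite !(mulr0, mulr1, mul0r, addr0, add0r).
by rewrite (ih (fun u => f (rcons u _))) /pattern mkseqS.
Qed.

Lemma measurable_sumbits n (f : seq bool -> Omega -> R) :
  (forall u, measurable_fun setT (f u)) ->
  measurable_fun setT (fun w => sumbits n (f ^~ w)).
Proof.
by elim: n f => [|n ih] f mf /=; [exact: mf|apply: ih => u; exact: measurable_funD].
Qed.

Lemma Rintegral_sumbits n (f : seq bool -> Omega -> R) :
  (forall u, P.-integrable setT (EFin \o f u)) ->
  \int[P]_w sumbits n (f ^~ w) = sumbits n (fun u => \int[P]_w f u w).
Proof.
elim: n f => [//|n ih] f mf /=; rewrite ih.
  by apply: eq_sumbits => u _; rewrite RintegralD.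
move=> u; rewrite (_ : _ \o _ = (EFin \o f (rcons u true)) \+
  (EFin \o f (rcons u false)))%E//; exact: integrableD.
Qed.

(** Trades the random word for a finite sum over fixed words. In the application a fixed word leaves
    a function of the subordinator alone, to which independence applies. *)
Lemma Rintegral_pattern n (F : seq bool -> Omega -> R) :
  (forall u, unit_fun (F u)) ->
  \int[P]_w F (pat n w) w = sumbits n (fun u => \int[P]_w (\1_(E_ u) w * F u w)).
Proof.
move=> uF; rewrite -Rintegral_sumbits; last first.
  move=> u; apply: unit_fun_integrable; apply: unit_fun_mul => //.
  by apply: unit_fun_indic; exact: measurable_pattern_event.
by apply: eq_Rintegral => w _; rewrite sumbits_pattern_event.
Qed.

Lemma unit_fun_pattern n (F : seq bool -> Omega -> R) :
  (forall u, unit_fun (F u)) -> unit_fun (fun w => F (pat n w) w).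
Proof.
move=> uF; split; last by move=> w; exact: (uF _).2.
rewrite (_ : (fun w => _) = (fun w => sumbits n (fun u => \1_(E_ u) w * F u w))).
  2: by apply/funext => w; rewrite (sumbits_pattern_event n (F ^~ w)).
apply: measurable_sumbits => u; apply: measurable_funM; last by case: (uF u).
by apply: measurable_indic; exact: measurable_pattern_event.
Qed.

End PatternExpectation.

Section Increments.
Context d (Omega : measurableType d) (R : realType) (P : probability Omega R).
Context (nu : R) (sigma : R -> {RV P >-> R}).
Hypotheses (nu_gt0 : 0 < nu) (sigma_stable : stable_subordinator nu sigma).

(** Paths are nondecreasing only almost surely; the truncation makes the increments nonnegative
    everywhere. *)
Definition incr (h : R) (j : nat) (w : Omega) : R :=
  Num.max (sigma (j.+1%:R * h) w - sigma (j%:R * h) w) 0.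

Lemma incr_ge0 h j w : 0 <= incr h j w.
Proof. by rewrite /incr le_max lexx orbT. Qed.

Lemma eq_distribution_Rintegral (Y1 Y2 : Omega -> R) (f : R -> R) :
  measurable_fun setT Y1 -> measurable_fun setT Y2 ->
  (forall B, measurable B -> P (Y1 @^-1` B) = P (Y2 @^-1` B)) ->
  unit_fun f -> \int[P]_w f (Y1 w) = \int[P]_w f (Y2 w).
Proof.
move=> m1 m2 Y12 uf; rewrite /Rintegral; congr fine.
have mf : measurable_fun setT (EFin \o f).
  by apply/measurable_EFinP; case: uf.
have f0 : {in setT, forall y, (0 <= (EFin \o f) y)%E}.
  by move=> y _; rewrite lee_fin; have /andP[] := uf.2 y.
transitivity (\int[pushforward P Y1]_y (EFin \o f) y)%E.
  by rewrite ge0_integral_pushforward.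
transitivity (\int[pushforward P Y2]_y (EFin \o f) y)%E.
  by apply: eq_measure_integral => B mB _; exact: Y12.
by rewrite ge0_integral_pushforward.
Qed.

Lemma Laplace_incr h j (a : R) : 0 <= h -> 0 <= a ->
  \int[P]_w expR (- (a * incr h j w)) = expR (- (h * a `^ nu)).
Proof.
move=> h0 a0; transitivity (\int[P]_w exp_pos a (sigma h w)).
  apply: (@eq_distribution_Rintegral
    (fun w => sigma (j.+1%:R * h) w - sigma (j%:R * h) w) (sigma h) (exp_pos a)) => //.
  - exact: measurable_funB.
  - move=> B mB; rewrite (subordinator_stationary_increments sigma_stable)//.
    + by rewrite -mulrBl -natrB// subSnn mul1r.
    + by rewrite mulr_ge0.
    + by rewrite ler_wpM2r// ler_nat.
  - exact: unit_exp_pos.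
(* The transform of the subordinator is given for positive arguments only. At a = 0 both sides are
   1, as 0^nu = 0. *)
have [->|an0] := eqVneq a 0.
  rewrite powR0 ?gt_eqF// mulr0 oppr0 expR0 /exp_pos.
  under eq_Rintegral do rewrite mul0r oppr0 expR0.
  have e : fine (P setT) = 1 by rewrite probability_setT.
  by rewrite Rintegral_cst// mul1r.
have ap : 0 < a by rewrite lt0r an0.
apply: EFin_inj; rewrite -mulNr -(subordinator_Laplace sigma_stable h0 ap).
rewrite fineK; last first.
  by apply: integrable_fin_num => //; apply: unit_fun_integrable;
    apply: unit_fun_comp => //; exact: unit_exp_pos.
rewrite unlock; apply: ae_eq_integral => //.
- apply/measurable_EFinP; apply: measurableT_comp => //.
  by case: (unit_exp_pos a0).
- apply/measurable_EFinP; apply: measurableT_comp => //.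
  exact: measurable_funM.
(* Almost surely sigma h >= sigma 0 = 0, hence the truncation inside [exp_pos] has no effect. *)
have := subordinator_start sigma_stable; have := subordinator_paths sigma_stable.
apply: filterS2 => w [mono _] s0 _.
by rewrite /exp_pos max_l ?mulNr// -s0; apply: mono.
Qed.

End Increments.

Section FixedGrid.
Context (R : realType) d (Omega : measurableType d) (P : probability Omega R).
Context (lambda mu nu : R) (k : nat).
Context (Q : R -> Omega -> queue_state k) (sigma : R -> {RV P >-> R}).
Hypotheses (lambda_gt0 : 0 < lambda) (mu_gt0 : 0 < mu) (k_ge1 : (1 <= k)%N)
  (nu_gt0 : 0 < nu) (Q_markov : markov_chain P (@queue_rate R lambda mu k) Q)
  (sigma_stable : stable_subordinator nu sigma)
  (Q_sigma_indep : independent_processes P Q sigma).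

Let L : R := lambda + k%:R * mu.

Variable h : R.
Hypotheses (h_gt0 : 0 < h) (Lh_le1 : L * h <= 1) (Lh_sqr : (L * h) ^+ 2 <= lambda * h).

Definition grid (h : R) (j : nat) (w : Omega) : queue_state k := Q (j%:R * h) w.

Notation N := (@number_in_system k).
Notation pat := (pattern (grid h) N).
Notation E_ := (pattern_event (grid h) N).
Notation cnt := (count id).

Let jh_ge0 (j : nat) : 0 <= j%:R * h. Proof. by rewrite mulr_ge0// ltW. Qed.

Lemma measurable_grid i x : measurable (grid h i @^-1` [set x]).
Proof. by case: Q_markov => mQ _ _; exact: mQ. Qed.

Let m u : R := fine (P (E_ u)).

Let mE u : measurable (E_ u).
Proof. exact: measurable_pattern_event measurable_grid _. Qed.

Let mEe u : (m u)%:E = P (E_ u). Proof. by rewrite fineK// fin_num_measure. Qed.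

Let m_ge0 u : 0 <= m u. Proof. by rewrite fine_ge0. Qed.

Let m_nil : m [::] = 1.
Proof. by rewrite /m pattern_event_nil probability_setT. Qed.

Let mD u : m (rcons u true) + m (rcons u false) = m u.
Proof.
apply: EFin_inj; rewrite EFinD !mEe -measureU//.
  congr (P _); rewrite !pattern_event_rcons -setIUr.
  rewrite (_ : _ `|` _ = setT) ?setIT//.
  by apply/seteqP; split => // w _; case E: (jump (grid h) N (size u) w); [left|right].
rewrite !pattern_event_rcons; apply/seteqP; split => // w [[_ /= ->] []].
by [].
Qed.

Let m_true u : `|m (rcons u true) - lambda * h * m u| <= (L * h) ^+ 2 * m u.
Proof.
case: Q_markov => mQ _ [p tp MK].
have h0 := ltW h_gt0.
have MX n (x : nat -> queue_state k) :
    (P (\bigcap_(i in `I_n.+2) (grid h i @^-1` [set x i])) =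
     P (\bigcap_(i in `I_n.+1) (grid h i @^-1` [set x i])) *
     (p h (x n) (x n.+1))%:E)%E.
  have := MK n (fun i => i%:R * h) x; rewrite mul0r lexx => /(_ isT).
  rewrite -mulrBl -natrB// subSnn mul1r; apply => i _.
  by rewrite ltr_pM2r// ltr_nat.
have := pattern_event_bounds measurable_grid (fun x y => transition_ge0 tp x y h0)
  MX (fun x => upward_probability lambda_gt0 mu_gt0 k_ge1 tp x h0 Lh_le1) u.
have L0 : 0 <= lambda * h by rewrite mulr_ge0// ltW.
move=> /(_ _ _)/andP[]; rewrite ?subr_ge0 ?addr_ge0 ?sqr_ge0//.
rewrite -!mEe -!EFinM !lee_fin -/L => lo hi.
by rewrite ler_norml; apply/andP; split; move: lo hi; rewrite mulrBl mulrDl; lra.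
Qed.

Lemma measurable_few_jumps n c : measurable [set w | (cnt (pat n w) <= c)%N].
Proof.
pose F (u : seq bool) (w : Omega) : R := (cnt u <= c)%N%:R.
have uF u : unit_fun (F u) by exact: unit_fun_bool.
have := (unit_fun_pattern N measurable_grid n uF).1 measurableT [set 1]
  (measurable_set1 _).
rewrite setTI; congr (measurable _); apply/seteqP; split => w /=; rewrite /F.
  by case: (_ <= _)%N => //= /eqP; rewrite eq_sym oner_eq0.
by move=> ->.
Qed.

(** Markov's inequality: the indicator of at most c arrivals is bounded by 2^c times 2^(- number of
    arrivals), whose expectation [sumbits_half] controls. *)
Lemma few_jumps_probability n c :
  fine (P [set w | (cnt (pat n w) <= c)%N]) <=
  2 ^+ c * (1 - (lambda * h - (L * h) ^+ 2) / 2) ^+ n.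
Proof.
pose F (u : seq bool) (w : Omega) : R := (cnt u <= c)%N%:R.
have uF u : unit_fun (F u) by exact: unit_fun_bool.
have -> : fine (P [set w | (cnt (pat n w) <= c)%N]) = \int[P]_w F (pat n w) w.
  rewrite -Rintegral_indic; last exact: measurable_few_jumps.
  by apply: eq_Rintegral => w _; rewrite indicE mem_setE.
rewrite (Rintegral_pattern P N measurable_grid n uF).
have -> : sumbits n (fun u => \int[P]_w (\1_(E_ u) w * F u w)) =
    sumbits n (fun u => m u * (cnt u <= c)%N%:R).
  apply: eq_sumbits => u _; rewrite /F RintegralZr//.
    by rewrite Rintegral_indic.
  by apply: unit_fun_integrable; exact: unit_fun_indic.
apply: (@le_trans _ _ (sumbits n (fun u => 2 ^+ c * (m u * 2^-1 ^+ cnt u)))).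
  apply: ler_sumbits => u _; rewrite mulrCA ler_wpM2l//.
  case: (leqP (cnt u) c) => [uc|_]; last by rewrite mulr_ge0.
  by rewrite exprVn ler_pdivlMr ?exprn_gt0// mul1r ler_weXn2l// ler1n.
rewrite sumbitsZ ler_wpM2l//.
apply: (sumbits_half m_nil mD m_true n).
rewrite subr_ge0 Lh_sqr/=; apply: le_trans Lh_le1.
have : lambda * h <= L * h by rewrite ler_wpM2r ?(ltW h_gt0)// lerDl mulr_ge0// ltW.
by have := sqr_ge0 (L * h); lra.
Qed.

Definition increment_weight (h : R) (v : nat -> R) (u : seq bool) (w : Omega) : R :=
  weight (fun c j => expR (- (v c * incr sigma h j w))) u.

Let measurable_incr j : measurable_fun setT (incr sigma h j).
Proof. by apply: measurable_maxr => //; exact: measurable_funB. Qed.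

Lemma unit_fun_increment_weight v u : (forall c, 0 <= v c) ->
  unit_fun (increment_weight h v u).
Proof.
move=> v0; apply: unit_fun_prod => j; apply: unit_fun_expR.
  exact: measurable_funM.
by move=> w; rewrite mulr_ge0// incr_ge0.
Qed.

Lemma Rintegral_increment_weight v u : (forall c, 0 <= v c) ->
  \int[P]_w increment_weight h v u w =
  weight (fun c _ => expR (- (h * v c `^ nu))) u.
Proof.
move=> v0; have tmono i : (i < size u)%N -> i%:R * h <= i.+1%:R * h.
  by move=> _; rewrite ler_wpM2r ?ler_nat// ltW.
have := subordinator_independent_increments sigma_stable
  (t := fun i => i%:R * h) (jh_ge0 0) tmono.
move=> /mutually_independentP indX.
pose f (i : 'I_(size u)) := exp_pos (v (cnt (take i.+1 u))).
have uf i : unit_fun (f i) by exact: unit_exp_pos.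
have := indX _ (index_enum _) f (index_enum_uniq _) uf.
move=> H; rewrite /increment_weight /weight.
transitivity (\prod_(i < size u) \int[P]_w
    f i (sigma (i.+1%:R * h) w - sigma (i%:R * h) w)).
  by rewrite -H//; move=> i; exact: measurable_funB.
apply: eq_bigr => i _; exact: (Laplace_incr nu_gt0 sigma_stable i (ltW h_gt0) (v0 _)).
Qed.

(** Independence is stated for events of the two generated sigma-algebras. The pattern event lies in
    the first one, and the weight is a test function for the second, so the rule extends from
    indicators to the weight. *)
Lemma pattern_event_increment_indep v u : (forall c, 0 <= v c) ->
  \int[P]_w (\1_(E_ u) w * increment_weight h v u w) =
  m u * \int[P]_w increment_weight h v u w.
Proof.
move=> v0.
pose GQ := [set A | exists t B,
  [/\ 0 <= t, [set: set (queue_state k)] B & A = Q t @^-1` B]].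
pose Gs := [set A | exists (t : R) (B : set R),
  [/\ 0 <= t, measurable B & A = sigma t @^-1` B]].
(* Measurability of pattern events was proved over an arbitrary measurable space; here that space is
   Omega with the sigma-algebra of Q alone. *)
have EQ : <<s GQ >> (E_ u).
  apply: (@measurable_pattern_event _ (g_sigma_algebraType GQ)) => i x.
  by apply: sub_sigma_algebra; exists (i%:R * h), [set x].
have Gs_meas A : <<s Gs >> A -> measurable A.
  apply: smallest_sub; first exact: sigma_algebra_measurable.
  by move=> _ [t [B [t0 mB ->]]]; rewrite -[_ @^-1` _]setTI; exact: measurable_funP.
(* The identity, seen as a random element of Omega with the coarser sigma-algebra of sigma, plays
   the role of X in [expectation_mul_unit_fun]. *)
have mid : measurable_fun setT (id : Omega -> g_sigma_algebraType Gs).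
  by move=> _ B mB; rewrite setTI; exact: Gs_meas.
have ms t : 0 <= t -> measurable_fun setT (sigma t : g_sigma_algebraType Gs -> R).
  move=> t0 _ B mB; rewrite setTI; apply: sub_sigma_algebra.
  by exists t, B.
have uZ : unit_fun (increment_weight h v u : g_sigma_algebraType Gs -> R).
  apply: unit_fun_prod => j; apply: unit_fun_expR.
    apply: measurable_funM => //; apply: measurable_maxr => //.
    by apply: measurable_funB; exact: ms.
  by move=> w; rewrite mulr_ge0// incr_ge0.
have -> : m u = \int[P]_w \1_(E_ u) w by rewrite Rintegral_indic.
apply: (expectation_mul_unit_fun mid (unit_fun_indic R (mE u)) _ uZ) => B mB.
have mB' : measurable (B : set Omega) by exact: Gs_meas.
have EB : P (E_ u `&` B) = (P (E_ u) * P B)%E by exact: Q_sigma_indep.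
have -> : \int[P]_w (\1_(E_ u) w * \1_B w) = fine (P (E_ u `&` B)).
  rewrite -Rintegral_indic; last exact: measurableI.
  by apply: eq_Rintegral => w _; rewrite indicI.
rewrite EB fineM ?fin_num_measure//; congr (_ * _); first by rewrite Rintegral_indic.
exact/esym/Rintegral_indic.
Qed.

(** Independence replaces the weight of each fixed word by its expectation, a product of exp(- h
    v_c^nu); the martingale estimate with a(c) = v_c^nu then concludes. *)
Lemma Laplace_grid (v psi : nat -> R) (A : R) n :
  (forall c, 0 <= v c) -> (forall c, v c `^ nu <= A) ->
  (forall c, 0 <= psi c <= 1) ->
  (forall c, lambda * psi c.+1 = (lambda + v c `^ nu) * psi c) ->
  `|\int[P]_w (increment_weight h v (pat n w) w * psi (cnt (pat n w))) - psi 0%N| <=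
  n%:R * ((lambda * A + A ^+ 2) * h ^+ 2 + (L * h) ^+ 2).
Proof.
move=> v0 vA psi01 psiS.
pose F u w := increment_weight h v u w * psi (cnt u).
have uF u : unit_fun (F u).
  apply: unit_fun_mul; first exact: unit_fun_increment_weight.
  by split; [exact: measurable_cst|move=> w; exact: psi01].
rewrite (Rintegral_pattern P N measurable_grid n uF).
rewrite (@eq_sumbits _ _ _ (fun u => m u *
    (weight (fun c _ => expR (- (h * v c `^ nu))) u * psi (cnt u)))); last first.
  move=> u _; rewrite -(Rintegral_increment_weight u v0) mulrA.
  rewrite -pattern_event_increment_indep// -RintegralZr//; last first.
    by apply: unit_fun_integrable; apply: unit_fun_mul;
      [exact: unit_fun_indic|exact: unit_fun_increment_weight].
  by apply: eq_Rintegral => w _; rewrite /F mulrA.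
apply: (sumbits_weight_psi m_ge0 m_nil mD m_true (ltW lambda_gt0) (ltW h_gt0) erefl) => //.
by move=> c; rewrite powR_ge0 vA.
Qed.

End FixedGrid.

(** * Sample paths *)

Section StepPartition.
Context (R : realType) (S : Type) (f : R -> S).
Hypothesis f_cadlag : cadlag_discrete f.

(** The cap t + 1 bounds the set, so its supremum is meaningful even for an eventually constant
    path. Partition points therefore need not be jumps. *)
Let const_until (t : R) : set R :=
  [set s | t < s <= t + 1 /\ forall u, t <= u < s -> f u = f t].

Let next t := sup (const_until t).

Let has_sup_const_until t : 0 <= t -> has_sup (const_until t).
Proof.
move=> t0; split; last by exists (t + 1) => s [/andP[]].
have [d /= d0 H] := f_cadlag.1 t t0.
exists (t + Num.min (d / 2) 1); split.
  by rewrite ltrDl lt_min ltr01 divr_gt0//= lerD2l ge_min lexx orbT.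
move=> u /andP[tu us]; move: tu; rewrite le_eqVlt => /predU1P[->//|tu].
apply: H => //=; rewrite ltr0_norm ?subr_lt0// opprB ltrBlDl.
apply: lt_trans us _; rewrite ltrD2l gt_min ltr_pdivrMr// ltr_pMr// ltr1n//.
Qed.

Let next_gt t : 0 <= t -> t < next t.
Proof.
move=> t0; have hs := has_sup_const_until t0; have [[s sE] _] := hs.
have [/andP[ts _] _] := sE; apply: (lt_le_trans ts).
by apply: sup_upper_bound.
Qed.

Let next_const t u : 0 <= t -> t <= u < next t -> f u = f t.
Proof.
move=> t0 /andP[tu un]; have hs := has_sup_const_until t0.
have e0 : 0 < next t - u by rewrite subr_gt0.
have [s [_ Hs]] := sup_adherent e0 hs.
by rewrite opprB addrCA subrr addr0 => us; apply: Hs; rewrite tu.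
Qed.

Let next_ge t s : 0 <= t -> t < s -> s <= t + 1 ->
  (forall u, t <= u < s -> f u = f t) -> s <= next t.
Proof.
move=> t0 ts st H; apply: sup_upper_bound; first exact: has_sup_const_until.
by split => //; rewrite ts.
Qed.

(** If the points stayed bounded they would accumulate at some b. The path is constant just before
    b, so the step taken from a point close to b would reach b, a contradiction. *)
Lemma step_partition : exists r : nat -> R,
  [/\ r 0%N = 0, forall i, r i < r i.+1, forall x, exists i, x < r i &
      forall i t, r i <= t < r i.+1 -> f t = f (r i)].
Proof.
pose r := fix r n := if n is n'.+1 then next (r n') else 0 : R.
have r0 n : 0 <= r n.
  by elim: n => [//|n ih] /=; apply: (le_trans ih); exact/ltW/next_gt.
have rS n : r n < r n.+1 by exact: next_gt.
exists r; split => //; last by move=> i t; exact: next_const.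
apply: contrapT => nunb.
have [x xub] : exists x, forall i, r i <= x.
  apply: contrapT => H; apply: nunb => x; apply: contrapT => H2; apply: H.
  by exists x => i; rewrite leNgt; apply/negP => xi; apply: H2; exists i.
have hs : has_sup (range r).
  by split; [exists (r 0%N), 0%N|exists x => _ [i _ <-]].
pose b := sup (range r).
have rb i : r i < b.
  by apply: (lt_le_trans (rS i)); apply: sup_upper_bound => //; exists i.+1.
have b0 : 0 < b by apply: (le_lt_trans (r0 0%N)).
have [y [/= d d0 H]] := f_cadlag.2 b b0.
(* Closer than [d], to be where the path is constant; closer than 1, so that the cap in
   [const_until] does not interfere. *)
have e0 : 0 < Num.min d 1 by rewrite lt_min d0 ltr01.
have [_ [i _ <-]] := sup_adherent e0 hs; rewrite -/b => bi.
have bid : b - r i < d.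
  rewrite ltrBlDr -ltrBlDl; apply: le_lt_trans bi.
  by rewrite lerD2l lerN2 ge_min lexx.
have bi1 : b - r i < 1.
  rewrite ltrBlDr -ltrBlDl; apply: le_lt_trans bi.
  by rewrite lerD2l lerN2 ge_min lexx orbT.
have near_b u : r i <= u -> u < b -> f u = y.
  move=> iu ub; apply: H => //=; rewrite gtr0_norm ?subr_gt0//.
  by apply: le_lt_trans bid; rewrite lerD2l lerN2.
have : b <= next (r i).
  apply: next_ge => //; first by rewrite -lerBlDl ltW.
  by move=> u /andP[iu ub]; rewrite !near_b.
by rewrite leNgt (rb i.+1).
Qed.

End StepPartition.

Section Partition.
Context (R : realType) (r : nat -> R).
Hypotheses (r_start : r 0%N = 0) (rS : forall i, r i < r i.+1)
  (r_unbounded : forall x, exists i, x < r i).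

Lemma partition_mono i j : (i <= j)%N -> r i <= r j.
Proof.
elim: j => [|j ih]; first by rewrite leqn0 => /eqP ->.
by rewrite leq_eqVlt => /predU1P[->//|]; rewrite ltnS => /ih h; exact/ltW/(le_lt_trans h).
Qed.

Lemma partition_smono i j : (i < j)%N -> r i < r j.
Proof. by move=> ij; apply: (lt_le_trans (rS i)); exact: partition_mono. Qed.

Lemma partition_ge0 i : 0 <= r i.
Proof. by rewrite -r_start partition_mono. Qed.

Lemma partition_index t : 0 <= t -> exists i, r i <= t < r i.+1.
Proof.
move=> t0; have ex : exists i, t < r i by exact: r_unbounded.
case: (ex_minnP ex) => -[|i] ti mini; first by rewrite r_start ltNge t0 in ti.
by exists i; rewrite ti andbT leNgt; apply/negP => /mini; rewrite ltnn.
Qed.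

Lemma partition_index_le s t i j : r i <= s < r i.+1 -> r j <= t < r j.+1 ->
  s <= t -> (i <= j)%N.
Proof.
move=> /andP[is_ si] /andP[jt tj] st; rewrite leqNgt; apply/negP => ji.
have := partition_mono ji; rewrite leNgt => /negP; apply.
by rewrite (le_lt_trans is_)// (le_lt_trans st).
Qed.

Lemma upward_jump_step (g : R -> nat) (x : nat -> nat) :
  (forall i t, r i <= t < r i.+1 -> g t = x i) ->
  forall t, upward_jump g t <-> exists2 i, t = r i.+1 & (x i < x i.+1)%N.
Proof.
move=> gx t; have left_lim i s : r i < s -> s <= r i.+1 ->
    \forall u \near s^'-, g u = x i.
  move=> is_ si; exists (s - r i) => /=; first by rewrite subr_gt0.
  move=> u /=; rewrite ltr_norml => /andP[_ su us]; apply: gx.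
  by rewrite (lt_le_trans us si) andbT; lra.
split=> [[t0 [m near_m mg]]|[i -> xi]]; last first.
  split; first by rewrite (le_lt_trans (partition_ge0 i)).
  exists (x i); first exact: left_lim.
  by rewrite (gx i.+1)// lexx rS.
have [i /andP[it ti]] := partition_index (ltW t0).
have gt : g t = x i by apply: gx; rewrite it.
have unique_lim y : (\forall u \near t^'-, g u = y) -> m = y.
  move=> near_y; have [u []] := @filter_ex _ (t^'-) _ _ (filterI near_m near_y).
  by move=> -> ->.
move: it; rewrite le_eqVlt => /predU1P[it|it]; last first.
  have := unique_lim (x i) (left_lim i t it (ltW ti)).
  by move=> mx; move: mg; rewrite gt mx ltnn.
case: i it ti gt => [|i] it ti gt; first by move: t0; rewrite -it r_start ltxx.
exists i; first by [].
rewrite -(unique_lim (x i)); first by rewrite -gt.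
by apply: left_lim; rewrite -it.
Qed.

End Partition.

(** * The time change along one path *)

Section TimeChangedPath.
Context (R : realType) (sg : R -> R) (r : nat -> R).
Hypotheses (sg_start : sg 0 = 0)
  (sg_smono : forall s t, 0 <= s -> s < t -> sg s < sg t)
  (sg_unbounded : forall x, exists2 s, 0 <= s & x < sg s).
Hypotheses (r_start : r 0%N = 0) (rS : forall i, r i < r i.+1)
  (r_unbounded : forall x, exists i, x < r i).

Let sg_mono s t : 0 <= s -> s <= t -> sg s <= sg t.
Proof.
by move=> s0; rewrite le_eqVlt => /predU1P[->//|st]; exact/ltW/sg_smono.
Qed.

(* The left limit of [sg] at [t > 0], and [sg 0 = 0] at [t = 0]. *)
Definition left_value (t : R) : R := sup (sg @` [set s | s = 0 \/ 0 <= s < t]).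

Let has_sup_left t : 0 <= t -> has_sup (sg @` [set s | s = 0 \/ 0 <= s < t]).
Proof.
move=> t0; split; first by exists (sg 0), 0 => //; left.
exists (sg t) => _ [s [->|/andP[s0 st]] <-]; first exact: sg_mono.
by apply: sg_mono => //; exact: ltW.
Qed.

Lemma left_value0 : left_value 0 = 0.
Proof.
rewrite /left_value (_ : _ @` _ = [set 0]) ?sup1//.
apply/seteqP; split => [_ [s [->|/andP[s0 s1]] <-]|_ ->]; first by rewrite sg_start.
  by move: s1; rewrite ltNge s0.
by exists 0; [left|exact: sg_start].
Qed.

Lemma left_value_ge s t : 0 <= s -> s < t -> sg s <= left_value t.
Proof.
move=> s0 st; apply: sup_upper_bound.
  by apply: has_sup_left; exact: le_trans (ltW st).
by exists s => //; right; rewrite s0.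
Qed.

Lemma left_value_le t : 0 <= t -> left_value t <= sg t.
Proof.
move=> t0; apply: ge_sup; first by case: (has_sup_left t0).
move=> _ [s [->|/andP[s0 st]] <-]; first exact: sg_mono.
by apply: sg_mono => //; exact: ltW.
Qed.

Lemma left_value_gt t x : 0 < t -> x < left_value t ->
  exists2 s, 0 <= s < t & x < sg s.
Proof.
move=> t0 xt; have e0 : 0 < left_value t - x by rewrite subr_gt0.
have [_ [s sE <-]] := sup_adherent e0 (has_sup_left (ltW t0)).
rewrite -/(left_value t) opprB addrCA subrr addr0 => xs; exists s => //.
by case: sE => [->|//]; rewrite lexx.
Qed.

Let rho i := left_value (r i).

Let r_ge0 i : 0 <= r i. Proof. exact: partition_ge0. Qed.

Lemma left_value_start : rho 0%N = 0.
Proof. by rewrite /rho r_start left_value0. Qed.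

Lemma left_valueS i : rho i < rho i.+1.
Proof.
apply: (le_lt_trans (left_value_le (r_ge0 i))).
have m1 : r i < (r i + r i.+1) / 2 by have := rS i; lra.
have m2 : (r i + r i.+1) / 2 < r i.+1 by have := rS i; lra.
apply: (@lt_le_trans _ _ (sg ((r i + r i.+1) / 2))); first exact: sg_smono.
by apply: left_value_ge => //; rewrite (le_trans (r_ge0 i))// ltW.
Qed.

Lemma left_value_unbounded x : exists i, x < rho i.
Proof.
have [s s0 xs] := sg_unbounded x; have [i si] := r_unbounded s.
by exists i; apply: (lt_le_trans xs); exact: left_value_ge.
Qed.

(** No s < r i has sg s > t, since sg s <= rho i <= t; and some s < r i.+1 does, since t lies below
    the left limit there. The time-changed path is thus a step function on the points rho with the
    same successive values. *)
Lemma inverse_itv t i : rho i <= t < rho i.+1 ->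
  r i <= inf [set s | 0 <= s /\ t < sg s] < r i.+1.
Proof.
move=> /andP[it ti]; have t0 : 0 <= t.
  rewrite (le_trans _ it)// -left_value_start.
  exact: (partition_mono left_valueS).
have [s /andP[s0 si] ts] := left_value_gt (le_lt_trans (r_ge0 i) (rS i)) ti.
have lb0 : lbound [set s | 0 <= s /\ t < sg s] (r i).
  move=> u [u0 tu]; rewrite leNgt; apply/negP => ui.
  by have := le_lt_trans (left_value_ge u0 ui) (le_lt_trans it tu); rewrite ltxx.
apply/andP; split; first by apply: lb_le_inf => //; exists s.
by apply: le_lt_trans si; apply: ge_inf => //; exists (r i).
Qed.

End TimeChangedPath.

Section UpCount.
Variable x : nat -> nat.
Hypothesis ups_unbounded : forall c, exists i, (c < \sum_(j < i) (x j < x j.+1))%N.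

Definition up_count (i : nat) : nat := \sum_(j < i) (x j < x j.+1).

Lemma up_countS i : up_count i.+1 = (up_count i + (x i < x i.+1))%N.
Proof. by rewrite /up_count big_ord_recr. Qed.

Lemma up_count_mono i j : (i <= j)%N -> (up_count i <= up_count j)%N.
Proof.
elim: j => [|j ih]; first by rewrite leqn0 => /eqP ->.
rewrite leq_eqVlt => /predU1P[->//|]; rewrite ltnS => /ih h.
by rewrite up_countS (leq_trans h)// leq_addr.
Qed.

(** The least index whose count exceeds n is a successor, and its predecessor is the upward step
    preceded by exactly n others. *)
Lemma up_enum : exists e : nat -> nat,
  forall n, (x (e n) < x (e n).+1)%N /\ up_count (e n) = n.
Proof.
have H n : exists i, (x i < x i.+1)%N /\ up_count i = n.
  case: (ex_minnP (ups_unbounded n)) => -[|i] ni mini; first by rewrite big_ord0 in ni.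
  have ci : (up_count i <= n)%N.
    by rewrite leqNgt; apply/negP => /mini; rewrite ltnn.
  exists i; move: ni; rewrite -/(up_count i.+1) up_countS.
  case: (x i < x i.+1)%N => /= ni; last by move: ni; rewrite addn0 ltnNge ci.
  by split=> //; apply/eqP; rewrite eqn_leq ci -ltnS -[X in (_ < X)%N]addn1.
by have [e He] := choice H; exists e.
Qed.

Lemma up_enum_unique i j : (x i < x i.+1)%N -> (x j < x j.+1)%N ->
  up_count i = up_count j -> i = j.
Proof.
wlog : i j / (i < j)%N => [H|ij] xi xj e.
  by case: (ltngtP i j) => // ij; [exact: H|symmetry; exact: H].
by have := up_count_mono ij; rewrite up_countS xi e addn1 ltnn.
Qed.

End UpCount.

(** * Arrivals and increments of one path read off a grid *)

Definition grid_count (R : realType) (f : R -> nat) (h : R) (j : nat) : nat :=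
  \sum_(i < j) (f (i%:R * h)%R < f (i.+1%:R * h)%R)%N.

Section GridCount.
Context (R : realType) (f : R -> nat) (r : nat -> R).
Hypotheses (r_start : r 0%N = 0) (rS : forall i, r i < r i.+1)
  (r_unbounded : forall x, exists i, x < r i)
  (f_const : forall i t, r i <= t < r i.+1 -> f t = f (r i)).

Let x i := f (r i).

Lemma up_count_lt a b : (a <= b)%N -> (x a < x b)%N ->
  (up_count x a < up_count x b)%N.
Proof.
elim: b => [|b ih]; first by rewrite leqn0 => /eqP ->; rewrite ltnn.
rewrite leq_eqVlt => /predU1P[->|]; first by rewrite ltnn.
rewrite ltnS up_countS => ab xab; case: (ltnP (x b) (x b.+1)) => xb.
  by rewrite addn1 ltnS up_count_mono.
by rewrite addn0; apply: ih => //; exact: leq_trans xb.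
Qed.

(** Valid for every mesh: a net increase over a cell requires an upward step inside it. Unbounded
    counts on one fixed grid therefore force infinitely many arrivals. *)
Lemma grid_count_le h j i : 0 <= h -> r i <= j%:R * h < r i.+1 ->
  (grid_count f h j <= up_count x i)%N.
Proof.
move=> h0; elim: j i => [|j ih] i ji; first by rewrite /grid_count big_ord0.
have jh0 : 0 <= j%:R * h by rewrite mulr_ge0.
have [i' i'j] := partition_index r_start r_unbounded jh0.
have ii' : (i' <= i)%N.
  apply: (partition_index_le rS i'j ji).
  by rewrite ler_wpM2r// ler_nat.
rewrite /grid_count big_ord_recr/= -/(grid_count f h j) (f_const i'j) (f_const ji).
have := ih _ i'j; rewrite -/(x i') -/(x i).
case: (ltnP (x i') (x i)) => [xi|_] h1.
  by rewrite addn1 (leq_ltn_trans h1)// up_count_lt.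
by rewrite addn0 (leq_trans h1)// up_count_mono.
Qed.

(** With the mesh below all relevant gaps, a cell crosses at most one partition point, so no arrival
    is missed or cancelled. *)
Lemma grid_count_eq h K : 0 < h -> (forall i, (i < K)%N -> h < r i.+1 - r i) ->
  forall j i, (i < K)%N -> r i <= j%:R * h < r i.+1 ->
  grid_count f h j = up_count x i.
Proof.
move=> h0 hK; elim=> [|j ih] i iK ji.
  rewrite /grid_count big_ord0; move: ji; rewrite mul0r => /andP[ri _].
  case: i ri {iK} => [|i] ri; first by rewrite /up_count big_ord0.
  have := partition_smono rS (ltn0Sn i); rewrite r_start.
  by rewrite ltNge ri.
have jh0 : 0 <= j%:R * h by rewrite mulr_ge0// ltW.
have [i' i'j] := partition_index r_start r_unbounded jh0.
have jj : j.+1%:R * h = j%:R * h + h by rewrite -natr1 mulrDl mul1r.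
have ii' : (i' <= i)%N.
  by apply: (partition_index_le rS i'j ji); rewrite jj lerDl ltW.
have i'i : (i <= i'.+1)%N.
  rewrite leqNgt; apply/negP => i'i.
  have := partition_mono rS i'i; have := hK i'.+1 (ltn_trans i'i iK).
  have /andP[] := ji; have /andP[] := i'j; rewrite jj; lra.
rewrite /grid_count big_ord_recr/= -/(grid_count f h j) (f_const i'j) (f_const ji).
rewrite (ih i')//; last exact: leq_ltn_trans iK.
rewrite -/(x i') -/(x i).
have [->|ni] := eqVneq i i'; first by rewrite ltnn addn0.
have -> : i = i'.+1 by apply/eqP; rewrite eqn_leq i'i ltn_neqAle eq_sym ni ii'.
by rewrite up_countS.
Qed.

End GridCount.

Definition grid_increment (R : realType) (f : R -> nat) (sg : R -> R) (h : R)
    (M n : nat) : R :=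
  \sum_(j < M) (grid_count f h j.+1 == n)%:R *
    Num.max (sg (j.+1%:R * h) - sg (j%:R * h)) 0.

Section GridIncrements.
Context (R : realType) (f : R -> nat) (sg : R -> R).
Hypotheses (f_cadlag : cadlag_discrete f) (sg_start : sg 0 = 0)
  (sg_smono : forall s t, 0 <= s -> s < t -> sg s < sg t)
  (sg_unbounded : forall x, exists2 s, 0 <= s & x < sg s).

Let sg_mono s t : 0 <= s -> s <= t -> sg s <= sg t.
Proof.
by move=> s0; rewrite le_eqVlt => /predU1P[->//|st]; exact/ltW/sg_smono.
Qed.

Lemma grid_count_mono h i j : (i <= j)%N -> (grid_count f h i <= grid_count f h j)%N.
Proof.
elim: j => [|j ih]; first by rewrite leqn0 => /eqP ->.
rewrite leq_eqVlt => /predU1P[->//|]; rewrite ltnS => /ih h1.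
by rewrite /grid_count big_ord_recr/= (leq_trans h1)// leq_addr.
Qed.

(** Counts are monotone in the cell, so the selected cells form an initial segment and the sum
    telescopes to one value of [sg]; [grid_increment] is a difference of two such sums. *)
Definition grid_cumul h M n : R :=
  \sum_(j < M) (grid_count f h j.+1 <= n)%N%:R *
    Num.max (sg (j.+1%:R * h) - sg (j%:R * h)) 0.

Lemma grid_increment_cumul h M n : grid_increment f sg h M n =
  grid_cumul h M n - (if n is n'.+1 then grid_cumul h M n' else 0).
Proof.
case: n => [|n].
  by rewrite subr0; apply: eq_bigr => j _; rewrite leqn0.
rewrite -sumrB; apply: eq_bigr => j _; rewrite -mulrBl; congr (_ * _).
rewrite (leq_eqVlt _ n.+1) ltnS; have [->|_] /= := eqVneq (grid_count f h j.+1) n.+1.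
  by rewrite ltnn subr0.
by rewrite subrr.
Qed.

Lemma telescope_prefix h M j0 : 0 <= h ->
  \sum_(j < M) (j < j0)%N%:R * Num.max (sg (j.+1%:R * h) - sg (j%:R * h)) 0 =
  sg ((minn M j0)%:R * h).
Proof.
move=> h0; elim: M => [|M ih].
  by rewrite big_ord0 min0n mul0r sg_start.
rewrite big_ord_recr/= ih; case: (ltnP M j0) => Mj.
  rewrite mul1r (minn_idPl Mj) max_l ?subrKC//.
  by rewrite subr_ge0 sg_mono ?mulr_ge0// ler_wpM2r// ler_nat.
by rewrite mul0r addr0 (minn_idPr (leqW Mj)).
Qed.

Variable r : nat -> R.
Hypotheses (r_start : r 0%N = 0) (rS : forall i, r i < r i.+1)
  (r_unbounded : forall x, exists i, x < r i)
  (f_const : forall i t, r i <= t < r i.+1 -> f t = f (r i)).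

Let x i := f (r i).

Lemma gap_exists K : exists2 g, 0 < g & forall i, (i < K)%N -> g < r i.+1 - r i.
Proof.
elim: K => [|K [g g0 gK]]; first by exists 1.
exists (Num.min g ((r K.+1 - r K) / 2)).
  by rewrite lt_min g0/= divr_gt0// subr_gt0.
move=> i; rewrite ltnS leq_eqVlt => /predU1P[->|iK]; rewrite gt_min.
  by apply/orP; right; have := rS K; lra.
by rewrite gK.
Qed.

(** [j0] is the cell that contains the arrival: j0 h < r e.+1 <= (j0 + 1) h. The gap condition
    reaches i = e + 1 so that this cell ends before r e.+2, where the count is still exact. *)
Lemma grid_prefix h e : 0 < h -> (forall i, (i < e.+2)%N -> h < r i.+1 - r i) ->
  (x e < x e.+1)%N ->
  exists2 j0 : nat, r e.+1 - h <= j0%:R * h < r e.+1 &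
    forall j, (grid_count f h j.+1 <= up_count x e)%N = (j < j0)%N.
Proof.
move=> h0 hK xe; set tau := r e.+1.
have tau0 : 0 < tau by rewrite (le_lt_trans (partition_ge0 r_start rS e)).
have jh0 (j : nat) : 0 <= j%:R * h by rewrite mulr_ge0// ltW.
have ex : exists j : nat, tau <= j.+1%:R * h.
  exists (Num.truncn (tau / h)); rewrite -ler_pdivrMr//.
  have th : 0 <= tau / h by rewrite divr_ge0// ltW.
  by have /andP[_ /ltW] := truncn_itv th.
case: (ex_minnP ex) => j0 j0tau minj.
have j0lt : j0%:R * h < tau.
  case: j0 minj {j0tau} => [|j0] minj; first by rewrite mul0r.
  by rewrite ltNge; apply/negP => /minj; rewrite ltnn.
have jj (j : nat) : j.+1%:R * h = j%:R * h + h by rewrite -natr1 mulrDl mul1r.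
exists j0; first by rewrite j0lt andbT lerBlDr -jj.
move=> j; case: (ltnP j j0) => jj0.
  have jtau : j.+1%:R * h < tau.
    by rewrite ltNge; apply/negP => /minj; rewrite leqNgt jj0.
  have [i ij] := partition_index r_start r_unbounded (jh0 j.+1).
  have ie : (i <= e)%N.
    rewrite leqNgt; apply/negP => ei; have /andP[+ _] := ij.
    by rewrite leNgt (lt_le_trans jtau)//; exact: partition_mono.
  rewrite (grid_count_eq r_start rS r_unbounded f_const h0 hK _ ij).
    by rewrite up_count_mono.
  by rewrite (leq_ltn_trans ie)// ltnS leqW.
apply/negbTE; rewrite -ltnNge.
apply: (@leq_trans (grid_count f h j0.+1)); last exact: grid_count_mono.
have ij : r e.+1 <= j0.+1%:R * h < r e.+2.
  by rewrite j0tau/= jj; have := hK e.+1 (ltnSn _); rewrite -/tau; lra.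
by rewrite (grid_count_eq r_start rS r_unbounded f_const h0 hK _ ij)// up_countS -/x xe addn1.
Qed.

Variables (h : nat -> R) (M : nat -> nat).
Hypotheses (h_gt0 : forall m, 0 < h m) (h_cvg : h m @[m --> \oo] --> 0)
  (Mh_cvg : forall y : R, \forall m \near \oo, y <= (M m)%:R * h m).

Let h_small (y : R) : 0 < y -> \forall m \near \oo, h m < y.
Proof.
move=> y0; move/cvgrPdist_lt: h_cvg => /(_ y y0); apply: filterS => m.
by rewrite sub0r normrN gtr0_norm.
Qed.

(** The sum equals sg (j0 h) with r e.+1 - h <= j0 h < r e.+1. Approaching the arrival strictly from
    below, it tends to the left limit. *)
Lemma cvg_grid_cumul e : (x e < x e.+1)%N ->
  grid_cumul (h m) (M m) (up_count x e) @[m --> \oo] --> left_value sg (r e.+1).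
Proof.
move=> xe; have [g g0 gK] := gap_exists e.+2.
have tau0 : 0 < r e.+1 by rewrite (le_lt_trans (partition_ge0 r_start rS e)).
apply/cvgrPdist_le => eps eps0.
have : left_value sg (r e.+1) - eps < left_value sg (r e.+1) by rewrite ltrBlDr ltrDl.
move=> /(left_value_gt sg_smono tau0)[s /andP[s0 stau] sge].
have ds : 0 < r e.+1 - s by rewrite subr_gt0.
near=> m.
have [j0 /andP[j0l j0u] j0E] : exists2 j0 : nat, r e.+1 - h m <= j0%:R * h m < r e.+1 &
    forall j, (grid_count f (h m) j.+1 <= up_count x e)%N = (j < j0)%N.
  apply: grid_prefix => // i ie; apply: lt_trans (gK _ ie).
  by near: m; exact: h_small.
have -> : grid_cumul (h m) (M m) (up_count x e) = sg (j0%:R * h m).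
  rewrite /grid_cumul; under eq_bigr do rewrite j0E.
  rewrite telescope_prefix ?(ltW (h_gt0 m))// (minn_idPr _)//.
  have : r e.+1 <= (M m)%:R * h m by near: m; exact: Mh_cvg.
  by move=> /(lt_le_trans j0u); rewrite ltr_pM2r// ltr_nat => /ltnW.
have hs : h m < r e.+1 - s by near: m; exact: h_small.
have s1 : sg s <= sg (j0%:R * h m) by apply: sg_mono => //; lra.
have s2 : sg (j0%:R * h m) <= left_value sg (r e.+1).
  by apply: left_value_ge => //; rewrite mulr_ge0// ltW.
by rewrite ger0_norm; lra.
Unshelve. all: by end_near. Qed.

Lemma grid_count_large e : (x e < x e.+1)%N ->
  \forall m \near \oo, (up_count x e < grid_count f (h m) (M m))%N.
Proof.
move=> xe; have [g g0 gK] := gap_exists e.+2.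
near=> m.
have [j0 /andP[j0l j0u] j0E] : exists2 j0 : nat, r e.+1 - h m <= j0%:R * h m < r e.+1 &
    forall j, (grid_count f (h m) j.+1 <= up_count x e)%N = (j < j0)%N.
  apply: grid_prefix => // i ie; apply: lt_trans (gK _ ie).
  by near: m; exact: h_small.
have : r e.+1 <= (M m)%:R * h m by near: m; exact: Mh_cvg.
move=> /(lt_le_trans j0u); rewrite ltr_pM2r// ltr_nat => j0M.
have M0 := leq_ltn_trans (leq0n _) j0M.
by rewrite ltnNge -(prednK M0) j0E -leqNgt -ltnS prednK.
Unshelve. all: by end_near. Qed.

End GridIncrements.

(** The deterministic core: its hypotheses on the path are those to be shown almost sure. The times
    are tau n = sg at (r (e n).+1) from the left, [e n] being the n-th upward step counted from 0.
    The last conclusion will make the terminal factor psi equal to 1. *)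
Lemma interarrival_times_path (R : realType) (f : R -> nat) (sg : R -> R)
    (h : nat -> R) (M : nat -> nat) :
  cadlag_discrete f -> sg 0 = 0 ->
  (forall s t, 0 <= s -> s < t -> sg s < sg t) ->
  (forall x, exists2 s, 0 <= s & x < sg s) ->
  (exists2 h0, 0 < h0 & forall c, exists n, (c < grid_count f h0 n)%N) ->
  (forall m, 0 < h m) -> h m @[m --> \oo] --> 0 ->
  (forall y : R, \forall m \near \oo, y <= (M m)%:R * h m) ->
  exists T : nat -> R,
    [/\ interarrival_times (fun t => f (inf [set s | 0 <= s /\ t < sg s])) T,
        forall n, grid_increment f sg (h m) (M m) n @[m --> \oo] --> T n
      & forall n, \forall m \near \oo, (n < grid_count f (h m) (M m))%N].
Proof.
move=> f_cadlag sg0 sg_smono sg_unb [h0 h00 inf_up] h_gt0 h_cvg Mh.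
have [r [r0 rS r_unb f_const]] := step_partition f_cadlag.
pose x i := f (r i).
have ups c : exists i, (c < \sum_(j < i) (x j < x j.+1))%N.
  have [n cn] := inf_up c.
  have nh0 : 0 <= n%:R * h0 by rewrite mulr_ge0// ltW.
  have [i ni] := partition_index r0 r_unb nh0.
  by exists i; apply: (leq_trans cn); exact: (grid_count_le r0 rS r_unb f_const (ltW h00) ni).
have [e He] := up_enum ups.
pose rho i := left_value sg (r i).
pose tau n := rho (e n).+1.
pose T n := tau n - (if n is n'.+1 then tau n' else 0).
have rho0 : rho 0%N = 0 by exact: left_value_start.
have rhoS i : rho i < rho i.+1 by exact: left_valueS.
have rho_unb y : exists i, y < rho i by exact: left_value_unbounded.
have eS n : (e n < e n.+1)%N.
  rewrite ltnNge; apply/negP => /(up_count_mono x).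
  by rewrite (He n).2 (He n.+1).2 ltnn.
have sumT n : \sum_(i < n.+1) T i = tau n.
  elim: n => [|n ih]; first by rewrite big_ord_recr big_ord0/= add0r /T subr0.
  by rewrite big_ord_recr/= ih /T addrC subrK.
exists T; split.
- split.
    move=> [|n]; rewrite /T ?subr0.
      by apply: le_lt_trans (rhoS _); exact: (partition_ge0 rho0 rhoS).
    by rewrite subr_gt0; apply: (partition_smono rhoS); rewrite ltnS.
  move=> t; rewrite (upward_jump_step rho0 rhoS rho_unb (x := x)); last first.
    move=> i {}t it; apply: f_const.
    exact: (inverse_itv sg0 sg_smono r0 rS it).
  split=> [[i -> xi]|[n ->]].
    exists (up_count x i); rewrite sumT /tau.
    by rewrite (up_enum_unique xi (He (up_count x i)).1)// (He _).2.
  by exists (e n); [rewrite sumT|case: (He n)].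
- move=> n; have cv k : grid_cumul f sg (h m) (M m) k @[m --> \oo] --> tau k.
    have := cvg_grid_cumul sg0 sg_smono r0 rS r_unb f_const h_gt0 h_cvg Mh (He k).1.
    by rewrite (He k).2.
  under eq_fun do rewrite grid_increment_cumul.
  by case: n => [|n]; apply: cvgB => //; exact: cvg_cst.
- move=> n.
  have := grid_count_large r0 rS r_unb f_const h_gt0 h_cvg Mh (He n).1.
  by rewrite (He n).2.
Qed.

(** * Paths of the subordinator and interarrival times *)

Section AlmostSure.
Context d (Omega : measurableType d) (R : realType) (P : probability Omega R).

Lemma ae_exists_notin (B : nat -> set Omega) (u : nat -> R) :
  (forall n, measurable (B n)) -> (forall n, fine (P (B n)) <= u n) ->
  u n @[n --> \oo] --> 0 -> {ae P, forall w, exists n, ~ B n w}.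
Proof.
move=> mB Bu u0; exists (\bigcap_n B n); split.
- exact: bigcapT_measurable.
- apply/eqP; rewrite eq_le measure_ge0 andbT.
  have mC : measurable (\bigcap_n B n) by exact: bigcapT_measurable.
  rewrite -[leLHS]fineK ?fin_num_measure// lee_fin.
  rewrite -(cvg_lim _ u0)//; apply: limr_ge; first by apply/cvg_ex; exists 0.
  apply: nearW => n; apply: le_trans (Bu n).
  apply: fine_le; rewrite ?fin_num_measure//.
  by apply: le_measure; rewrite ?inE// => w; exact.
- by move=> w /= nB n _; apply: contrapT => Bn; apply: nB; exists n.
Qed.

(** Chernoff bound: e^{a (K - Y)} >= 1 on the event. *)
Lemma Laplace_tail_bound (Y : Omega -> R) (a K : R) :
  measurable_fun setT Y -> (forall w, 0 <= Y w) -> 0 <= a ->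
  fine (P [set w | Y w <= K]) <= expR (a * K) * \int[P]_w expR (- (a * Y w)).
Proof.
move=> mY Y0 a0.
have mS : measurable [set w | Y w <= K].
  by rewrite -[[set w | _]]setTI; apply: measurable_fun_le.
have uE : unit_fun (fun w => expR (- (a * Y w))).
  by apply: unit_fun_expR => [|w]; [exact: measurable_funM|rewrite mulr_ge0].
rewrite -Rintegral_indic// -RintegralZl//; last exact: unit_fun_integrable.
apply: le_Rintegral => //.
- by apply: unit_fun_integrable; exact: unit_fun_indic.
- by apply: (@integrableZl _ _ _ _ _ _ _ (EFin \o _)) => //; exact: unit_fun_integrable.
- move=> w _; rewrite indicE; case: (boolP (w \in _)) => [|_].
    2: by rewrite mulr_ge0 ?expR_ge0.
  rewrite inE/= => YK; rewrite -expRD -mulrBr -[1%:R]expR0 ler_expR.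
  by rewrite mulr_ge0// subr_ge0.
Qed.

End AlmostSure.

Section SubordinatorPaths.
Context d (Omega : measurableType d) (R : realType) (P : probability Omega R).
Context (nu : R) (sigma : R -> {RV P >-> R}).
Hypotheses (nu_gt0 : 0 < nu) (sigma_stable : stable_subordinator nu sigma).

Let measurable_incr h j : measurable_fun setT (incr sigma h j).
Proof. by apply: measurable_maxr => //; exact: measurable_funB. Qed.

Let measurable_incr_le h j K : measurable [set w | incr sigma h j w <= K].
Proof. by rewrite -[[set w | _]]setTI; apply: measurable_fun_le. Qed.

Lemma ae_incr_gt0 h j : 0 < h -> {ae P, forall w, 0 < incr sigma h j w}.
Proof.
move=> h0.
have : {ae P, forall w, exists n : nat, ~ (incr sigma h j w <= 0)}.
  apply: (@ae_exists_notin _ _ _ P (fun=> [set w | incr sigma h j w <= 0])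
      (fun n => expR (- h) ^+ n)) => // [n|].
    (* The argument a = n^(1/nu) makes the transform of the increment exactly e^{-hn}, which tends
       to 0. *)
    have a0 : 0 <= n%:R `^ nu^-1 :> R by exact: powR_ge0.
    have := Laplace_tail_bound P 0 (measurable_incr h j) (incr_ge0 sigma h j) a0.
    rewrite mulr0 expR0 mul1r (Laplace_incr nu_gt0 sigma_stable j (ltW h0) a0).
    by rewrite -powRrM mulVf ?gt_eqF// powRr1// -mulNr expRM_natr.
  by apply: cvg_expr; rewrite ger0_norm ?expR_ge0// expR_lt1 oppr_lt0.
by apply: filterS => w [n /negP]; rewrite -ltNge.
Qed.

(** The countably many cells of the grids of mesh 1 / (n + 1) suffice: once twice the mesh is less
    than t - s, a whole cell fits between s and t, and its increment is positive. *)
Lemma ae_subordinator_strict :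
  {ae P, forall w, forall s t, 0 <= s -> s < t -> sigma s w < sigma t w}.
Proof.
have : {ae P, forall w, forall n j : nat, 0 < incr sigma n.+1%:R^-1 j w}.
  by apply: ae_foralln => n; apply: ae_foralln => j; apply: ae_incr_gt0; rewrite invr_gt0.
apply: filterS2 (subordinator_paths sigma_stable) => w [mono _] incr_pos s t s0 st.
have ts : 0 < t - s by rewrite subr_gt0.
pose n := Num.truncn (2 / (t - s)).
have n2 : 2 / (t - s) < n.+1%:R.
  have q0 : 0 <= 2 / (t - s) by rewrite divr_ge0// ltW.
  by have /andP[] := truncn_itv q0.
pose h : R := n.+1%:R^-1; have h0 : 0 < h by rewrite invr_gt0.
have h2 : 2 * h < t - s.
  by rewrite ltr_pdivrMr// mulrC -ltr_pdivrMr.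
pose j := (Num.truncn (s / h)).+1.
have sh0 : 0 <= s / h by rewrite divr_ge0// ltW.
have /andP[j1 j2] := truncn_itv sh0.
have sj : s <= j%:R * h by rewrite -ler_pdivrMr// ltW.
have jt : j.+1%:R * h <= t.
  move: j1; rewrite ler_pdivlMr// => j1.
  rewrite /j -natr1 -(natr1 (Num.truncn _)) !mulrDl !mul1r; move: h2; lra.
apply: (le_lt_trans (mono s (j%:R * h) s0 sj)).
have j0 : 0 <= j.+1%:R * h by rewrite mulr_ge0// ltW.
apply: lt_le_trans (mono _ _ j0 jt).
have := incr_pos n j; rewrite /incr lt_max ltxx orbF subr_gt0.
by [].
Qed.

(** The tail bound at a = 1 shows that an increment of length n stays below K with probability at
    most e^{K - n}. *)
Lemma ae_subordinator_unbounded :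
  {ae P, forall w, forall x, exists2 s, 0 <= s & x < sigma s w}.
Proof.
have : {ae P, forall w, forall K : nat, exists n : nat, ~ (incr sigma n%:R 0 w <= K%:R)}.
  apply: ae_foralln => K.
  apply: (@ae_exists_notin _ _ _ P (fun n => [set w | incr sigma n%:R 0 w <= K%:R])
      (fun n => expR K%:R * expR (- n%:R))) => // [n|].
    have := Laplace_tail_bound P K%:R (measurable_incr n%:R 0)
      (incr_ge0 sigma n%:R 0) (@ler01 R).
    by rewrite mul1r (Laplace_incr nu_gt0 sigma_stable 0 (ler0n R n) ler01) powR1 mulr1.
  by rewrite -(mulr0 (expR K%:R)); apply: cvgM; [exact: cvg_cst|exact: cvgn_expR].
apply: filterS2 (subordinator_start sigma_stable) => w s0 H x.
have [n /negP] := H (Num.truncn (Num.max x 0)).+1; rewrite -ltNge => xn.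
exists n%:R => //; move: xn; rewrite /incr mul0r mul1r s0 subr0 lt_max => /orP[xn|].
  apply: le_lt_trans xn; apply: (@le_trans _ _ (Num.max x 0)); first by rewrite le_max lexx.
  have m0 : 0 <= Num.max x 0 by rewrite le_max lexx orbT.
  by have /andP[_ /ltW] := truncn_itv m0.
by rewrite ltNge ler0n.
Qed.

End SubordinatorPaths.

Definition random_variable_of d (Omega : measurableType d) (R : realType)
    (P : probability Omega R) (f : Omega -> R)
    (mf : measurable_fun setT f) : {RV P >-> R} :=
  HB.pack f (isMeasurableFun.Build _ _ _ _ f mf).

(** * Refining the mesh: the joint law of the interarrival times *)

Section Interarrivals.
Context (R : realType) d (Omega : measurableType d) (P : probability Omega R).
Context (lambda mu nu : R) (k : nat).
Context (Q : R -> Omega -> queue_state k) (sigma : R -> {RV P >-> R}).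
Hypotheses (lambda_gt0 : 0 < lambda) (mu_gt0 : 0 < mu) (k_ge1 : (1 <= k)%N)
  (nu_gt0 : 0 < nu) (Q_markov : markov_chain P (@queue_rate R lambda mu k) Q)
  (sigma_stable : stable_subordinator nu sigma)
  (Q_sigma_indep : independent_processes P Q sigma).

Let L : R := lambda + k%:R * mu.
(** Chosen so that L^2 delta = lambda / 2: the error (L h)^2 is then at most half of lambda h for h
    <= delta, and L delta <= 1/2. *)
Let delta : R := lambda / (2 * L ^+ 2).

Notation N := (@number_in_system k).
Notation cnt := (count id).

Let L_gt0 : 0 < L. Proof. by rewrite ltr_wpDr// mulr_ge0// ltW. Qed.

Let delta_gt0 : 0 < delta.
Proof. by rewrite divr_gt0// mulr_gt0// exprn_gt0. Qed.

Let L_delta : L * delta <= 2^-1.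
Proof.
have -> : L * delta = (lambda / L) * 2^-1.
  by rewrite /delta; field; rewrite gt_eqF.
rewrite ler_piMl// ler_pdivrMr// mul1r lerDl mulr_ge0// ltW//.
Qed.

Let L_delta_sqr : (L * delta) ^+ 2 <= lambda * delta / 2.
Proof.
rewrite le_eqVlt; apply/orP; left; apply/eqP; rewrite /delta; field.
by rewrite gt_eqF.
Qed.

Let small h : 0 < h -> h <= delta -> L * h <= 1 /\ (L * h) ^+ 2 <= lambda * h.
Proof.
move=> h0 hd; have Lh : L * h <= L * delta by rewrite ler_wpM2l// ltW.
split; first by apply: (le_trans Lh); apply: (le_trans L_delta); rewrite invf_le1// ler1n.
rewrite expr2; apply: (@le_trans _ _ (L * delta * (L * h))).
  by rewrite ler_wpM2r// mulr_ge0// ltW.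
have -> : L * delta * (L * h) = (L ^+ 2 * delta) * h by ring.
rewrite ler_wpM2r ?(ltW h0)//.
have -> : L ^+ 2 * delta = lambda / 2 by rewrite /delta; field; rewrite gt_eqF.
by rewrite ler_pdivrMr// ler_pMr// ler1n.
Qed.

(* The total time [horizon m * mesh m] tends to infinity, while the total
   error, of order [horizon m * mesh m ^+ 2], tends to 0. *)
Definition mesh (m : nat) : R := delta / m.+1%:R ^+ 2.
Definition horizon (m : nat) : nat := (m.+1 ^ 3)%N.

Let mesh_gt0 m : 0 < mesh m.
Proof. by rewrite divr_gt0// exprn_gt0. Qed.

Let mesh_le m : mesh m <= delta.
Proof.
rewrite ler_pdivrMr ?exprn_gt0// ler_peMr ?(ltW delta_gt0)// exprn_ege1//.
by rewrite ler1n.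
Qed.

Let mesh_le_harmonic m : mesh m <= delta * harmonic m.
Proof.
rewrite /mesh ler_wpM2l ?(ltW delta_gt0)// /harmonic/= lef_pV2 ?posrE ?exprn_gt0//.
by rewrite expr2 ler_peMr// ler1n.
Qed.

Let cvg_mesh : mesh m @[m --> \oo] --> 0.
Proof.
apply: (@squeeze_cvgr _ _ _ _ (cst 0) (fun m => delta * harmonic m)).
- by apply: nearW => m; rewrite (ltW (mesh_gt0 m)) mesh_le_harmonic.
- exact: cvg_cst.
- by rewrite -(mulr0 delta); apply: cvgM; [exact: cvg_cst|exact: cvg_harmonic].
Qed.

Let horizon_meshE m : (horizon m)%:R * mesh m = delta * m.+1%:R.
Proof.
by rewrite /horizon /mesh natrX; field; rewrite addrC natr1 pnatr_eq0.
Qed.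

Let horizon_mesh_large (y : R) : \forall m \near \oo, y <= (horizon m)%:R * mesh m.
Proof.
have [y0|y0] := ltP y 0.
  by apply: nearW => m; rewrite (le_trans (ltW y0))// mulr_ge0// ltW.
exists (Num.truncn (y / delta)) => // m /= nm; rewrite horizon_meshE mulrC -ler_pdivrMr//.
have q0 : 0 <= y / delta by rewrite divr_ge0// ltW.
by have /andP[_ /ltW h] := truncn_itv q0; rewrite (le_trans h)// ler_nat ltnS.
Qed.

Let horizon_mesh_sqr (c : R) : (horizon m)%:R * (c * mesh m ^+ 2) @[m --> \oo] --> 0.
Proof.
rewrite (_ : (fun _ => _) = (fun m => (c * delta ^+ 2) * harmonic m)).
  by rewrite -(mulr0 (c * delta ^+ 2)); apply: cvgM; [exact: cvg_cst|exact: cvg_harmonic].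
apply/funext => m.
rewrite [LHS](_ : _ = c * ((horizon m)%:R * mesh m) * mesh m); last by ring.
rewrite horizon_meshE /mesh /harmonic/=.
by field; rewrite addrC natr1 pnatr_eq0.
Qed.

Notation pat h := (pattern (grid Q h) N).
Let arrivals (w : Omega) (t : R) : nat := N (Q t w).

Let cnt_pattern h n w : cnt (pat h n w) = grid_count (arrivals w) h n.
Proof.
elim: n => [|n ih]; first by rewrite /grid_count big_ord0.
by rewrite /pattern mkseqS cnt_rcons -/(pat h n w) ih /grid_count big_ord_recr.
Qed.

Let take_pattern h n j w : (j <= n)%N -> take j (pat h n w) = pat h j w.
Proof. by move=> jn; rewrite /pattern /mkseq -map_take take_iota (minn_idPl jn). Qed.

Let approx (m n : nat) (w : Omega) : R :=
  grid_increment (arrivals w) (fun s => sigma s w) (mesh m) (horizon m) n.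

Let measurable_incr h j : measurable_fun setT (incr sigma h j).
Proof. by apply: measurable_maxr => //; exact: measurable_funB. Qed.

Let measurable_approx m n : measurable_fun setT (approx m n).
Proof.
apply: measurable_sum => j; apply: measurable_funM; last exact: measurable_incr.
pose F (u : seq bool) (w : Omega) : R := (cnt u == n)%:R.
have uF u : unit_fun (F u) by exact: unit_fun_bool.
rewrite (_ : (fun _ => _) = (fun w => F (pat (mesh m) j.+1 w) w)).
  exact: (unit_fun_pattern N (measurable_grid Q_markov (mesh_gt0 m)) j.+1 uF).1.
by apply/funext => w; rewrite /F cnt_pattern.
Qed.

(* The limsup is taken for measurability: almost surely it is a limit. *)
Let T_fun (n : nat) (w : Omega) : R :=
  Num.max (fine (limn_esup (fun m => (approx m n w)%:E))) 0.

Let measurable_T n : measurable_fun setT (T_fun n).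
Proof.
apply: measurable_maxr => //; apply: measurableT_comp => //.
apply: measurable_fun_limn_esup => m; apply/measurable_EFinP.
exact: measurable_approx.
Qed.

Definition interarrival (n : nat) : {RV P >-> R} :=
  random_variable_of P (measurable_T n).

Let good (w : Omega) : Prop :=
  [/\ interarrival_times (fun t => number_in_system (fractional_queue Q sigma t w))
        (fun n => interarrival n w),
      forall n, approx m n w @[m --> \oo] --> interarrival n w
    & forall n, \forall m \near \oo, (n < cnt (pat (mesh m) (horizon m) w))%N].

Let ae_infinitely_many :
  {ae P, forall w, forall c, exists n, (c < grid_count (arrivals w) delta n)%N}.
Proof.
have [Ld Lds] := small delta_gt0 (lexx _).
apply: ae_foralln => c.
have mB n := measurable_few_jumps Q_markov delta_gt0 n c.
pose q := 1 - (lambda * delta - (L * delta) ^+ 2) / 2.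
have q01 : `|q| < 1.
  have l0 : 0 < lambda * delta by rewrite mulr_gt0.
  have l1 : lambda * delta <= L * delta.
    by rewrite ler_wpM2r ?(ltW delta_gt0)// lerDl mulr_ge0// ltW.
  have s0 := sqr_ge0 (L * delta).
  rewrite ltr_norml /q; apply/andP; split; move: L_delta_sqr; lra.
have : {ae P, forall w, exists n, ~ [set w | (cnt (pat delta n w) <= c)%N] w}.
  apply: (@ae_exists_notin _ _ _ P (fun n => [set w | (cnt (pat delta n w) <= c)%N])
    (fun n => 2 ^+ c * q ^+ n)) => // [n|].
    exact: (few_jumps_probability lambda_gt0 mu_gt0 k_ge1 Q_markov delta_gt0 Ld Lds).
  by rewrite -(mulr0 (2 ^+ c)); apply: cvgM; [exact: cvg_cst|exact: cvg_expr].
by apply: filterS => w [n /negP]; rewrite -ltnNge cnt_pattern => cn; exists n.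
Qed.

Let ae_good : {ae P, forall w, good w}.
Proof.
have ae_cadlag : {ae P, forall w, cadlag_discrete (Q ^~ w)} by case: Q_markov.
near=> w.
have cad : cadlag_discrete (Q ^~ w) by near: w.
have s0 : sigma 0 w = 0 by near: w; exact: subordinator_start sigma_stable.
have smono : forall s t, 0 <= s -> s < t -> sigma s w < sigma t w.
  by near: w; exact: ae_subordinator_strict nu_gt0 sigma_stable.
have sunb : forall x, exists2 s, 0 <= s & x < sigma s w.
  by near: w; exact: ae_subordinator_unbounded nu_gt0 sigma_stable.
have inf_up : forall c, exists n, (c < grid_count (arrivals w) delta n)%N.
  by near: w; exact: ae_infinitely_many.
have acad : cadlag_discrete (arrivals w).
  split=> t t0.
    by have := cad.1 t t0; apply: filterS => s e; rewrite /arrivals e.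
  have [y ny] := cad.2 t t0; exists (N y).
  by apply: filterS ny => s e; rewrite /arrivals e.
have [T0 [iT cT large]] := interarrival_times_path acad s0 smono sunb
  (ex_intro2 _ _ delta delta_gt0 inf_up) mesh_gt0 cvg_mesh horizon_mesh_large.
have TE n : interarrival n w = T0 n.
  rewrite /interarrival/= /T_fun.
  have cE : (approx m n w)%:E @[m --> \oo] --> (T0 n)%:E.
    by apply: cvg_EFin; [exact: nearW|exact: cT].
  have [_ -> ] := cvg_limn_einf_sup cE.
  by rewrite /= max_l// ltW//; case: iT.
split.
- rewrite (_ : (fun n => interarrival n w) = T0); first exact: iT.
  by apply/funext => n; exact: TE.
- by move=> n; rewrite TE; exact: cT.
- by move=> n; have := large n; apply: filterS => m; rewrite cnt_pattern.
Unshelve. all: by end_near. Qed.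

Let arrival_factor (a : R) : R := lambda / (lambda + a `^ nu).

Let arrival_factor_itv a : 0 <= arrival_factor a <= 1.
Proof.
have h := powR_ge0 a nu.
have l0 : 0 < lambda + a `^ nu by rewrite ltr_pwDl.
rewrite divr_ge0 ?(ltW l0) ?(ltW lambda_gt0)//= ler_pdivrMr// mul1r.
by rewrite lerDl.
Qed.

(** Regroups the cells by their arrival count. Setting v to 0 from n on gives all later cells the
    factor 1, so exactly the first n interarrival times appear. *)
Let increment_weight_pattern h n (v : nat -> R) M w :
  increment_weight sigma h (fun c => if (c < n)%N then v c else 0) (pat h M w) w =
  expR (- \sum_(i < n) v i * grid_increment (arrivals w) (fun s => sigma s w) h M i).
Proof.
rewrite /increment_weight /weight size_mkseq -sumrN.
transitivity (expR (\sum_(j < M) - (\sum_(i < n) v i *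
    ((grid_count (arrivals w) h j.+1 == i)%:R * incr sigma h j w)))).
  rewrite expR_sum; apply: eq_bigr => j _; congr (expR (- _)).
  rewrite take_pattern// cnt_pattern.
  set c := grid_count _ _ _; case: ltnP => cn.
    rewrite (bigD1 (Ordinal cn))//= eqxx mul1r big1 ?addr0// => i ic.
    rewrite (_ : (c == i) = false) ?mul0r ?mulr0//.
    by apply/negbTE; apply: contra ic => /eqP e; apply/eqP/val_inj.
  rewrite mul0r big1// => i _; rewrite (_ : (c == i) = false) ?mul0r ?mulr0//.
  by apply/negbTE; rewrite neq_ltn (leq_trans (ltn_ord i) cn) orbT.
congr expR; rewrite !sumrN; congr (- _).
rewrite exchange_big/=; apply: eq_bigr => i _.
by rewrite /grid_increment mulr_sumr.
Qed.

(** [Y m] has expectation close to psi 0 by [Laplace_grid], and converges almost surely to the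
    product of exponentials; being bounded by 1, it carries the limit over to the expectation. *)
Lemma Laplace_interarrivals n (v : nat -> R) : (forall i, 0 <= v i) ->
  \int[P]_w (\prod_(i < n) expR (- (v i * interarrival i w))) =
  \prod_(i < n) (lambda / (lambda + v i `^ nu)).
Proof.
move=> v0; pose v' c := if (c < n)%N then v c else 0.
have v'0 c : 0 <= v' c by rewrite /v'; case: ifP.
(* The transform still to be collected after c arrivals: the full product at c = 0, and 1 from c = n
   on, consistently with v' = 0 there. *)
pose psi c := \prod_(c <= i < n) arrival_factor (v i).
have psi_itv c : 0 <= psi c <= 1.
  by rewrite prodr_ge0 ?prodr_ile1// => i _; have /andP[] := arrival_factor_itv (v i).
have psiS c : lambda * psi c.+1 = (lambda + v' c `^ nu) * psi c.
  rewrite /v' /psi; case: ltnP => cn.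
    rewrite [in RHS]big_ltn// mulrA; congr (_ * _).
    by rewrite /arrival_factor mulrC divfK// gt_eqF// ltr_pwDl// powR_ge0.
  by rewrite powR0 ?gt_eqF// addr0 !big_geq// ltnW.
pose A := \sum_(i < n) v i `^ nu.
have A0 : 0 <= A by apply: sumr_ge0 => i _; exact: powR_ge0.
have vA c : v' c `^ nu <= A.
  rewrite /v'; case: ltnP => cn; last by rewrite powR0 ?gt_eqF.
  by rewrite /A (bigD1 (Ordinal cn))//= lerDl sumr_ge0// => i _; exact: powR_ge0.
pose F m u w := increment_weight sigma (mesh m) v' u w * psi (cnt u).
have uF m u : unit_fun (F m u).
  apply: unit_fun_mul.
    exact: unit_fun_increment_weight.
  by split; [exact: measurable_cst|move=> w; exact: psi_itv].
pose Y m w := F m (pat (mesh m) (horizon m) w) w.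
have uY m : unit_fun (Y m).
  exact: (unit_fun_pattern N (measurable_grid Q_markov (mesh_gt0 m)) _ (uF m)).
pose Z w := \prod_(i < n) expR (- (v i * interarrival i w)).
(* The error is number of cells times mesh squared times a constant, the coefficient of h^2 in
   [Laplace_grid]. *)
have EY : \int[P]_w Y m w @[m --> \oo] --> psi 0%N.
  apply/cvgrPdist_le => e e0.
  have := horizon_mesh_sqr (lambda * A + A ^+ 2 + L ^+ 2).
  move=> /cvgrPdist_le/(_ e e0); apply: filterS => m.
  have [Lm Lms] := small (mesh_gt0 m) (mesh_le m).
  have := Laplace_grid lambda_gt0 mu_gt0 k_ge1 nu_gt0 Q_markov sigma_stable
    Q_sigma_indep (mesh_gt0 m) Lm Lms (horizon m) v'0 vA psi_itv psiS.
  rewrite distrC sub0r normrN => /le_trans H me; apply: H; apply: le_trans me.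
  apply: le_trans (ler_norm _); rewrite ler_wpM2l//.
  by rewrite le_eqVlt; apply/orP; left; apply/eqP; rewrite /L; ring.
have cvY w : good w -> Y m w @[m --> \oo] --> Z w.
  move=> [_ cT large].
  have -> : Z w = expR (- \sum_(i < n) v i * interarrival i w) * 1.
    by rewrite mulr1 /Z -sumrN expR_sum.
  apply: cvgM.
    under eq_fun do rewrite increment_weight_pattern.
    apply: (@continuous_cvg _ _ _ _ _ _ (@expR R)); first exact: continuous_expR.
    apply: cvgN; apply: cvg_big => [|i _]; first exact: add_continuous.
    apply: cvgM; first exact: cvg_cst.
    exact: cT.
  (* Once more than n arrivals have been counted, psi is an empty product. *)
  apply: cvg_near_cst; have := large n; apply: filterS => m nm.
  by rewrite /psi big_geq// ltnW.
have mZ : measurable_fun setT Z.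
  apply: measurable_prod => i _; apply: measurableT_comp => //.
  by apply: measurableT_comp => //; apply: measurable_funM.
have [] := @dominated_convergence _ _ _ P setT measurableT
  (fun m w => (Y m w)%:E) (fun w => (Z w)%:E) (cst 1%E).
- by move=> m; apply/measurable_EFinP; case: (uY m).
- exact/measurable_EFinP.
- have := ae_good; apply: filterS => w gw _.
  by apply: cvg_EFin; [exact: nearW|exact: cvY].
- exact: (@finite_measure_integrable_cst _ _ _ P setT 1).
- by apply: aeW => w m _; rewrite /= lee_fin; exact: unit_fun_norm (uY m).
move=> _ _ cvE; have : \int[P]_w Y m w @[m --> \oo] --> \int[P]_w Z w.
  apply: fine_cvg; rewrite fineK//.
  apply: integrable_fin_num => //; apply: integrable_norm_le1 => // w.
  rewrite /Z ger0_norm ?prodr_ge0//.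
  apply: prodr_ile1 => i _; rewrite expR_ge0 expR_le1 oppr_le0 mulr_ge0//.
  by rewrite /= /T_fun le_max lexx orbT.
move=> cvZ; rewrite -(cvg_unique (@Rhausdorff R) EY cvZ).
by rewrite /psi big_mkord.
Qed.

(** Complete the finite set of indices to an initial segment with exponent 0 at the new ones; both
    e^0 and lambda / (lambda + 0^nu) are 1. *)
Lemma Laplace_interarrivals_seq (s : seq nat) (a : nat -> R) :
  uniq s -> (forall i, 0 <= a i) ->
  \int[P]_w (\prod_(i <- s) expR (- (a i * interarrival i w))) =
  \prod_(i <- s) (lambda / (lambda + a i `^ nu)).
Proof.
move=> us a0; pose n := (\max_(i <- s) i).+1.
have sn i : i \in s -> (i < n)%N.
  by move=> is_; rewrite /n ltnS; apply: (@leq_bigmax_seq _ s xpredT id).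
have perm_s : perm_eq s [seq i <- iota 0 n | i \in s].
  apply: uniq_perm => //; first by rewrite filter_uniq// iota_uniq.
  move=> i; rewrite mem_filter mem_iota add0n /=.
  by case: (boolP (i \in s)) => //= /sn ->.
pose v i := if i \in s then a i else 0.
have v0 i : 0 <= v i by rewrite /v; case: ifP.
have prodE (f g : nat -> R) : (forall i, i \in s -> f i = g i) ->
    (forall i, i \notin s -> g i = 1) -> \prod_(i <- s) f i = \prod_(i < n) g i.
  move=> fg g1; rewrite (perm_big _ perm_s) big_filter big_mkcond.
  rewrite -(big_mkord xpredT g) /index_iota subn0; apply: eq_bigr => i _.
  by case: (boolP (i \in s)) => [/fg//|/g1].
rewrite (prodE _ (fun i => lambda / (lambda + v i `^ nu))); last 2 first.
- by move=> i is_; rewrite /v is_.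
- by move=> i /negbTE is_; rewrite /v is_ powR0 ?gt_eqF// addr0 divff ?gt_eqF.
rewrite -Laplace_interarrivals//; apply: eq_Rintegral => w _.
apply: (prodE _ (fun i => expR (- (v i * interarrival i w)))).
- by move=> i is_; rewrite /v is_.
- by move=> i /negbTE is_; rewrite /v is_ mul0r oppr0 expR0.
Qed.

Let interarrival_ge0 n w : 0 <= interarrival n w.
Proof. by rewrite /= /T_fun le_max lexx orbT. Qed.

Let Laplace_interarrival i a : 0 <= a ->
  \int[P]_w expR (- (a * interarrival i w)) = lambda / (lambda + a `^ nu).
Proof.
move=> a0; have := @Laplace_interarrivals_seq [:: i] (fun=> a) isT (fun=> a0).
rewrite big_seq1 => <-; apply: eq_Rintegral => w _.
by rewrite big_seq1.
Qed.

Lemma interarrival_correct : {ae P, forall w, interarrival_times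
  (fun t => number_in_system (fractional_queue Q sigma t w))
  (fun n => interarrival n w)}.
Proof. by have := ae_good; apply: filterS => w []. Qed.

Lemma interarrival_independent : mutually_independent P interarrival.
Proof.
apply: mutually_independent_of_Laplace => // s a us a0.
rewrite Laplace_interarrivals_seq//; apply: eq_bigr => i _.
by rewrite Laplace_interarrival.
Qed.

Lemma interarrival_distribution n :
  mittag_leffler_distributed nu lambda (interarrival n).
Proof.
apply: mittag_leffler_distributed_of_Laplace => // v v0.
rewrite -(Laplace_interarrival n (ltW v0)) fineK//.
apply: integrable_fin_num => //; apply: unit_fun_integrable; apply: unit_fun_expR.
  by apply: measurable_funM.
by move=> w; rewrite mulr_ge0// ltW.
Qed.

End Interarrivals.

Theorem theorem4p1 (R : realType) (d : measure_display)
    (Omega : measurableType d) (P : probability Omega R)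
    (lambda mu nu : R) (k : nat)
    (Q : R -> Omega -> queue_state k) (sigma : R -> {RV P >-> R})
    (lambda_gt0 : 0 < lambda) (mu_gt0 : 0 < mu) (k_ge1 : (1 <= k)%N)
    (nu_gt0 : 0 < nu) (nu_lt1 : nu < 1)
    (Q_markov : markov_chain P (@queue_rate R lambda mu k) Q)
    (sigma_stable : stable_subordinator nu sigma)
    (Q_sigma_indep : independent_processes P Q sigma) :
  exists T : nat -> {RV P >-> R},
    [/\ {ae P, forall w, interarrival_times
           (fun t => number_in_system (fractional_queue Q sigma t w))
           (fun n => T n w)},
        mutually_independent P T
      & forall n, mittag_leffler_distributed nu lambda (T n)].
Proof.
exists (interarrival sigma lambda_gt0 mu_gt0 Q_markov); split.
- exact: (interarrival_correct lambda_gt0 mu_gt0 k_ge1 nu_gt0 Q_markov sigma_stable).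
- exact: (interarrival_independent lambda_gt0 mu_gt0 k_ge1 nu_gt0 Q_markov
    sigma_stable Q_sigma_indep).
- move=> n; exact: (interarrival_distribution lambda_gt0 mu_gt0 k_ge1 nu_gt0
    Q_markov sigma_stable Q_sigma_indep n).
Qed.
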